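(* Let $d,m\in\mathbb N$. A u.a.u.-product $\odot$ in $\mathbf{AlgP}_{d,m}$ can be reconstructed from the series $(\ln_{\odot,n},\mathrm L_{\odot,n})_{n\in\mathbb N}$ of its $n$-th order cumulant mappings and $n$-th order cumulant Lie algebras; that is, if $\odot$ and $\odot'$ are u.a.u.-products in $\mathbf{AlgP}_{d,m}$ with $\ln_{\odot,n}=\ln_{\odot',n}$ and $\mathrm L_{\odot,n}=\mathrm L_{\odot',n}$ (as Lie algebras) for all $n\in\mathbb N$, then $\odot=\odot'$. More precisely, $\odot$ is given as follows. (i) For each $n\in\mathbb N$ the convolution $\star$ on $\mathbb C\langle\langle X_{nm}\rangle\rangle^d$ is $$\varphi_1\star\varphi_2=\exp_\odot\bigl(\mathrm{CBH}(\ln_{\odot,n}\varphi_1,\ln_{\odot,n}\varphi_2)\bigr),$$ where $\exp_\odot$ is the inverse map of $\ln_{\odot,n}$ and $\mathrm{CBH}$ is the Campbell–Baker–Hausdorff series formed with the Lie bracket of $\mathrm L_{\odot,n}$. (ii) Let $(A_1,(A_1^{(1)},\dots,A_1^{(m)}),\varphi_1)$ and $(A_2,(A_2^{(1)},\dots,A_2^{(m)}),\varphi_2)$ be objects of $\mathbf{AlgP}_{d,m}$, let $W_i^{(l)}\subset A_i^{(l)}$ ($i=1,2$, $l=1,\dots,m$) be finite-dimensional subspaces, not all zero, and put $V=\bigoplus_{l=1}^m(W_1^{(l)}\oplus W_2^{(l)})\cong\mathbb C^n$, $n=\dim V$. For $i=1,2$ let $J_i:\mathrm T(V)^{\sqcup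 m}\to A_i$ be the algebra homomorphism which, on the $l$-th copy of $V$, is the inclusion $W_i^{(l)}\hookrightarrow A_i^{(l)}$ on the summand $W_i^{(l)}$ and $0$ on all other summands of $V$. Then on the subspace of $A_1\sqcup A_2$ spanned by the alternating tensors $b_1\otimes\dots\otimes b_p$, $b_r\in W_{i_r}^{(l_r)}$, $(i_r,l_r)\ne(i_{r+1},l_{r+1})$, regarded as a subspace of $\mathrm T(V)^{\sqcup m}$ (with $b_r$ placed in the summand $W_{i_r}^{(l_r)}$ of the $l_r$-th copy of $V$), one has, componentwise, $$\varphi_1\odot\varphi_2=(\varphi_1\circ J_1)\star(\varphi_2\circ J_2),$$ with $\star$ the convolution of (i).
   Context: Algebras are complex associative, not necessarily unital. $V^{*d}:=(V^* )^d=(V^d)^*$; $\varphi\circ j$ is taken componentwise. $A_1\sqcup A_2$ is the free product (coproduct of non-unital algebras) with embeddings $\iota_1,\iota_2$; $j_1\,\underline\sqcup\,j_2=(\iota_1\circ j_1)\sqcup(\iota_2\circ j_2)$. The free product $\bigsqcup_{i\in I}A_i$ is, as a vector space, the direct sum of the tensor products $A_{\varepsilon_1}\otimes\dots\otimes A_{\varepsilon_p}$ over alternating sequences ($\varepsilon_j\ne\varepsilon_{j+1}$) in $I$. Category $\mathbf{AlgP}_{d,m}$: objects $(A,(A^{(1)},\dots,A^{(m)}),\varphi)$ with $A$ an algebra, $A^{(l)}$ subalgebras freely generating $A$ (the canonical map $A^{(1)}\sqcup\dots\sqcup A^{(m)}\to A$ is bijective), $\varphi\in A^{*d}$; morphisms: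 algebra homomorphisms $j:B\to A$ with $j(B^{(l)})\subset A^{(l)}$ and $\psi=\varphi\circ j$. A universal product $\odot$ assigns to two objects an element $\varphi_1\odot\varphi_2\in(A_1\sqcup A_2)^{*d}$, where $A_1\sqcup A_2$ carries the subalgebras $A_1^{(l)}\sqcup A_2^{(l)}$, such that $(\varphi_1\odot\varphi_2)\circ(j_1\,\underline\sqcup\,j_2)=(\varphi_1\circ j_1)\odot(\varphi_2\circ j_2)$ for all algebra homomorphisms $j_i:B_i\to A_i$ with $j_i(B_i^{(l)})\subset A_i^{(l)}$. It is a u.a.u.-product if moreover $(\varphi_1\odot\varphi_2)\circ\iota_i=\varphi_i$ ($i=1,2$) and $(\varphi_1\odot\varphi_2)\odot\varphi_3=\varphi_1\odot(\varphi_2\odot\varphi_3)$. (Universal products are assumed non-degenerate: not identically zero on all alternating products of length $>1$.) $\mathrm T(V)=\bigoplus_{n\ge1}V^{\otimes n}$ is the tensor algebra without unit, with the algebra homomorphism $\Delta:\mathrm T(V)\to\mathrm T(V)\sqcup\mathrm T(V)$, $\Delta v=\iota_1v+\iota_2v$ ($v\in V$). $\mathrm T(V)^{\sqcup m}\cong\mathrm T(V^m)$ is the free product of $m$ copies of $\mathrm T(V)$ (its $m$ distinguished subalgebras); $\Delta^{\sqcup m}:\mathrm T(V)^{\sqcup m}\to\mathrm T(V)^{\sqcup m}\sqcup\mathrm T(V)^{\sqcup m}$ acts as $\Delta$ on each copy. Put $E=E_V=(\mathrm T(V)^{\sqcup m})^d$. For $\varphi_1,\varphi_2\in E^*=(\mathrm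 T(V)^{\sqcup m})^{*d}$ the convolution is $\varphi_1\star\varphi_2=(\varphi_1\odot\varphi_2)\circ\Delta^{\sqcup m}$. $\mathrm S(W)$ is the unital symmetric tensor algebra of $W$; for $\varphi\in W^*$, $\mathrm S(\varphi):\mathrm S(W)\to\mathbb C$ is the unital homomorphism extending $\varphi$; a linear map $R$ from $W$ to a commutative unital algebra extends to a unital homomorphism $\mathrm S(R)$. For algebras $A_1,A_2$ with $m$ freely generating subalgebras there is a unique map $\sigma_{A_1,A_2}:(A_1\sqcup A_2)^d\to\mathrm S(A_1^d)\otimes\mathrm S(A_2^d)$ with $\varphi_1\odot\varphi_2=(\mathrm S(\varphi_1)\otimes\mathrm S(\varphi_2))\circ\sigma_{A_1,A_2}$ for all $\varphi_i\in A_i^{*d}$. With $\mathrm D=\mathrm T(V)^{\sqcup m}$, $\mathrm S(E)$ is a commutative bialgebra with comultiplication $\mathrm S(\sigma_{\mathrm D,\mathrm D}\circ\Delta^{\sqcup m})$ and counit $\mathrm S(0)$; with $V$ in degree $1$ it is an $\mathbb N_0$-graded Hopf algebra with degree-$0$ part $\mathbb C\mathbf 1$. Let $\star$ also denote the convolution on $\mathrm S(E)^*$, and $[\beta_1,\beta_2]_\star=\beta_1\star\beta_2-\beta_2\star\beta_1$. For $\Phi\in\mathrm S(E)^*$ with $\Phi(\mathbf 1)=1$, $\ln_\star\Phi=\sum_{l\ge1}\frac{(-1)^{l+1}}{l}(\Phi-\mathrm S(0))^{\star l}$ (finite at each point). The cumulant mapping $\ln_\odot:E^*\to E^*$ is $\ln_\odot(\varphi)=\ln_\star(\mathrm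 S(\varphi))|_E$; it is bijective with inverse $\exp_\odot$. For $\psi\in E^*$, $D(\psi)\in\mathrm S(E)^*$ equals $\psi$ on $E=E^{\otimes_s1}$ and $0$ on $E^{\otimes_sk}$, $k\ne1$. The cumulant Lie algebra for $V$ is $E^*$ with the bracket $[\psi_1,\psi_2]_\odot=[D(\psi_1),D(\psi_2)]_\star|_E$. For $V=\mathbb C^n$ identify $\mathrm T(\mathbb C^n)^{\sqcup m}=\mathbb C\langle X_{nm}\rangle$ (non-commutative polynomials without constant term in $x_1,\dots,x_{nm}$) and $E^*=\mathbb C\langle X_{nm}\rangle^{*d}=:\mathbb C\langle\langle X_{nm}\rangle\rangle^d$ (formal power series, dual to $\mathbb C\langle X_{nm}\rangle$). $\ln_{\odot,n}$ is the cumulant mapping and $\mathrm L_{\odot,n}=\mathbb C\langle\langle X_{nm}\rangle\rangle^d$ with bracket $[\cdot,\cdot]_\odot$ is the cumulant Lie algebra for $V=\mathbb C^n$. $\mathrm{CBH}(x,y)=\ln(e^xe^y)=x+y+\frac12[x,y]+\frac1{12}[x,[x,y]]+\cdots$; evaluated in $\mathrm L_{\odot,n}$ it is a finite sum at each point of $E$. *)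

(* Defs.v *)
From HB Require Import structures.
From mathcomp Require Import all_boot all_order all_algebra.
From mathcomp Require Import boolp classical_sets fsbigop.

Set Implicit Arguments.
Unset Strict Implicit.
Unset Printing Implicit Defensive.

Import GRing.Theory.
Local Open Scope ring_scope.
Local Open Scope classical_set_scope.
Local Open Scope quotient_scope.

Declare Scope nualg_scope.
Delimit Scope nualg_scope with nua.
Local Open Scope nualg_scope.

HB.mixin Record Lmodule_isNuAlgebra (K : comPzRingType) A of GRing.Lmodule K A := {
  numul : A -> A -> A;
  numulA : associative numul;
  numulDl : left_distributive numul +%R;
  numulDr : right_distributive numul +%R;
  numulZl : forall (a : K) (x y : A), numul (a *: x) y = a *: numul x y;
  numulZr : forall (a : K) (x y : A), numul x (a *: y) = a *: numul x y
}.

#[short(type="nualgType")]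
HB.structure Definition NuAlgebra (K : comPzRingType) :=
  {A of GRing.Lmodule K A & Lmodule_isNuAlgebra K A}.

Notation "x ** y" := (numul x y) (at level 40, left associativity) : nualg_scope.

(* Unlike [comAlgType], the zero algebra is allowed. *)
HB.mixin Record NuAlgebra_isComUnital (K : comPzRingType) A of NuAlgebra K A := {
  uone : A;
  numulC : commutative (@numul K A);
  umul1 : left_id uone (@numul K A)
}.

#[short(type="cualgType")]
HB.structure Definition CuAlgebra (K : comPzRingType) :=
  {A of NuAlgebra K A & NuAlgebra_isComUnital K A}.

Definition linear_pack (K : comPzRingType) (V W : lmodType K) (f : V -> W)
    (f_lin : linear f) : {linear V -> W} :=
  HB.pack f (GRing.isLinear.Build K V W _ f f_lin).

Section NuAlgebraTheory.
Variable K : comPzRingType.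

Lemma numul0l (A : nualgType K) (x : A) : 0 ** x = 0.
Proof. by rewrite -[X in X ** _](scale0r 0) numulZl scale0r. Qed.

Lemma numul0r (A : nualgType K) (x : A) : x ** 0 = 0.
Proof. by rewrite -[X in _ ** X](scale0r 0) numulZr scale0r. Qed.

(* product of a nonempty sequence; the value on [::] is junk *)
Fixpoint nuprod (A : nualgType K) (s : seq A) : A :=
  match s with
  | [::] => 0
  | a :: s' => if s' is [::] then a else a ** nuprod s'
  end.

Record nuhom (A B : nualgType K) := NuHom {
  nuhom_fun :> {linear A -> B};
  nuhomM : {morph nuhom_fun : x y / x ** y}
}.

Program Definition nuhom_id (A : nualgType K) : nuhom A A :=
  @NuHom A A idfun _.
Next Obligation. by []. Qed.

Program Definition nuhom_comp (A B C : nualgType K)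
    (g : nuhom B C) (f : nuhom A B) : nuhom A C :=
  @NuHom A C (g \o f) _.
Next Obligation. by move=> x y /=; rewrite !nuhomM. Qed.

Lemma nuhom_compE (A B C : nualgType K) (g : nuhom B C) (f : nuhom A B) x :
  nuhom_comp g f x = g (f x).
Proof. by []. Qed.

Lemma nuhom_idE (A : nualgType K) (x : A) : nuhom_id A x = x.
Proof. by []. Qed.

End NuAlgebraTheory.

Inductive nuterm (K G : Type) :=
  | NTgen of G
  | NTzero
  | NTadd of nuterm K G & nuterm K G
  | NTscale of K & nuterm K G
  | NTmul of nuterm K G & nuterm K G.
Arguments NTzero {K G}.

HB.instance Definition _ (K G : Type) := gen_eqMixin (nuterm K G).
HB.instance Definition _ (K G : Type) := gen_choiceMixin (nuterm K G).

Fixpoint nueval (K : comPzRingType) (G : Type) (B : nualgType K) (f : G -> B)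
    (t : nuterm K G) : B :=
  match t with
  | NTgen g => f g
  | NTzero => 0
  | NTadd s t => nueval f s + nueval f t
  | NTscale a t => a *: nueval f t
  | NTmul s t => nueval f s ** nueval f t
  end.

Section Presented.
Variables (K : comPzRingType) (G : Type).
Variable model : forall B : nualgType K, (G -> B) -> Prop.

(* Terms are identified when they agree in every model: the quotient is the
   algebra generated by [G] and universal for the maps satisfying [model]. *)
Definition pres_rel (s t : nuterm K G) : bool :=
  `[< forall (B : nualgType K) (f : G -> B), model f -> nueval f s = nueval f t >].

Lemma pres_rel_refl : reflexive pres_rel.
Proof. by move=> t; apply/asboolP. Qed.

Lemma pres_rel_sym : symmetric pres_rel.
Proof.
by move=> s t; apply/asboolP/asboolP => h B f hf; rewrite h.
Qed.

Lemma pres_rel_trans : transitive pres_rel.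
Proof.
move=> t s u /asboolP h1 /asboolP h2; apply/asboolP => B f hf.
by rewrite h1 // h2.
Qed.

Canonical pres_equiv :=
  EquivRel pres_rel pres_rel_refl pres_rel_sym pres_rel_trans.

Definition presented := {eq_quot pres_equiv}.
HB.instance Definition _ := Choice.on presented.

Definition pres_pi (t : nuterm K G) : presented := \pi_{eq_quot pres_equiv} t.
Definition pres_eval (B : nualgType K) (f : G -> B) (x : presented) : B :=
  nueval f (repr (x : {eq_quot pres_equiv})).

Lemma pres_eval_pi (B : nualgType K) (f : G -> B) t :
  model f -> pres_eval f (pres_pi t) = nueval f t.
Proof.
rewrite /pres_eval /pres_pi => hf; case: piP => u /eqP.
rewrite eqmodE => /asboolP h; by rewrite (h B f hf).
Qed.

Lemma pres_surj (x : presented) : exists t, x = pres_pi t.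
Proof. by exists (repr (x : {eq_quot pres_equiv})); rewrite /pres_pi reprK. Qed.

Lemma pres_ext (x y : presented) :
  (forall (B : nualgType K) (f : G -> B), model f -> pres_eval f x = pres_eval f y) ->
  x = y.
Proof.
have [s ->] := pres_surj x; have [t ->] := pres_surj y => h.
rewrite /pres_pi; apply/eqP; rewrite eqmodE; apply/asboolP => B f hf.
by have := h B f hf; rewrite !pres_eval_pi.
Qed.

Let lift1 (op : nuterm K G -> nuterm K G) (x : presented) : presented :=
  pres_pi (op (repr (x : {eq_quot pres_equiv}))).
Let lift2 (op : nuterm K G -> nuterm K G -> nuterm K G) (x y : presented) :
    presented :=
  pres_pi (op (repr (x : {eq_quot pres_equiv})) (repr (y : {eq_quot pres_equiv}))).

Definition pres_zero : presented := pres_pi NTzero.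
Definition pres_add := lift2 (@NTadd K G).
Definition pres_opp := lift1 (NTscale (-1)).
Definition pres_scale (a : K) := lift1 (NTscale a).
Definition pres_mul := lift2 (@NTmul K G).

Section Eval.
Variables (B : nualgType K) (f : G -> B) (hf : model f).
Lemma pres_eval0 : pres_eval f pres_zero = 0.
Proof. exact: pres_eval_pi. Qed.
Lemma pres_evalD x y : pres_eval f (pres_add x y) = pres_eval f x + pres_eval f y.
Proof. exact: pres_eval_pi. Qed.
Lemma pres_evalN x : pres_eval f (pres_opp x) = - pres_eval f x.
Proof. by rewrite pres_eval_pi //= scaleN1r. Qed.
Lemma pres_evalZ a x : pres_eval f (pres_scale a x) = a *: pres_eval f x.
Proof. exact: pres_eval_pi. Qed.
Lemma pres_evalM x y : pres_eval f (pres_mul x y) = pres_eval f x ** pres_eval f y.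
Proof. exact: pres_eval_pi. Qed.
End Eval.

Local Ltac pres_tac :=
  apply: pres_ext => B f hf;
  rewrite !(pres_evalD, pres_evalN, pres_evalZ, pres_evalM, pres_eval0) //.

Fact pres_addA : associative pres_add.
Proof. by move=> x y z; pres_tac; rewrite addrA. Qed.
Fact pres_addC : commutative pres_add.
Proof. by move=> x y; pres_tac; rewrite addrC. Qed.
Fact pres_add0 : left_id pres_zero pres_add.
Proof. by move=> x; pres_tac; rewrite add0r. Qed.
Fact pres_addN : left_inverse pres_zero pres_opp pres_add.
Proof. by move=> x; pres_tac; rewrite addNr. Qed.
HB.instance Definition _ :=
  GRing.isZmodule.Build presented pres_addA pres_addC pres_add0 pres_addN.

Fact pres_scaleA a b x : pres_scale a (pres_scale b x) = pres_scale (a * b) x.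
Proof. by pres_tac; rewrite scalerA. Qed.
Fact pres_scale1 : left_id 1 pres_scale.
Proof. by move=> x; pres_tac; rewrite scale1r. Qed.
Fact pres_scaleDr : right_distributive pres_scale +%R.
Proof. by move=> a x y; pres_tac; rewrite scalerDr. Qed.
Fact pres_scaleDl x : {morph pres_scale^~ x : a b / a + b}.
Proof. by move=> a b; pres_tac; rewrite scalerDl. Qed.
HB.instance Definition _ :=
  GRing.Zmodule_isLmodule.Build K presented
    pres_scaleA pres_scale1 pres_scaleDr pres_scaleDl.

Fact pres_mulA : associative pres_mul.
Proof. by move=> x y z; pres_tac; rewrite numulA. Qed.
Fact pres_mulDl : left_distributive pres_mul +%R.
Proof. by move=> x y z; pres_tac; rewrite numulDl. Qed.
Fact pres_mulDr : right_distributive pres_mul +%R.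
Proof. by move=> x y z; pres_tac; rewrite numulDr. Qed.
Fact pres_mulZl a (x y : presented) : pres_mul (a *: x) y = a *: pres_mul x y.
Proof. by pres_tac; rewrite numulZl. Qed.
Fact pres_mulZr a (x y : presented) : pres_mul x (a *: y) = a *: pres_mul x y.
Proof. by pres_tac; rewrite numulZr. Qed.
HB.instance Definition _ :=
  Lmodule_isNuAlgebra.Build K presented
    pres_mulA pres_mulDl pres_mulDr pres_mulZl pres_mulZr.

Definition pres_gen (g : G) : presented := pres_pi (NTgen K g).

Section Lift.
Variables (B : nualgType K) (f : G -> B) (hf : model f).
Let ev : presented -> B := pres_eval f.
Fact pres_lift_linear : linear ev.
Proof. by move=> a x y; rewrite /ev pres_evalD // pres_evalZ. Qed.
Definition pres_lift : nuhom presented B :=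
  @NuHom K presented B (linear_pack pres_lift_linear) (pres_evalM hf).
Lemma pres_lift_gen g : pres_lift (pres_gen g) = f g.
Proof. exact: pres_eval_pi. Qed.
End Lift.

Lemma pres_ind (P : presented -> Prop) :
  (forall g, P (pres_gen g)) -> P 0 ->
  (forall a x y, P x -> P y -> P (a *: x + y)) ->
  (forall x y, P x -> P y -> P (x ** y)) -> forall x, P x.
Proof.
move=> Pg P0 PL PM x; have [t ->] := pres_surj x; elim: t => //.
- move=> s Ps t Pt; suff -> : pres_pi (NTadd s t) = 1 *: pres_pi s + pres_pi t.
    exact: PL.
  by apply: pres_ext => B f hf; rewrite scale1r pres_evalD // !pres_eval_pi.
- move=> a t Pt; suff -> : pres_pi (NTscale a t) = a *: pres_pi t + 0 by exact: PL.
  by apply: pres_ext => B f hf; rewrite addr0 pres_evalZ // !pres_eval_pi.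
- move=> s Ps t Pt; suff -> : pres_pi (NTmul s t) = pres_pi s ** pres_pi t.
    exact: PM.
  by apply: pres_ext => B f hf; rewrite pres_evalM // !pres_eval_pi.
Qed.

Lemma pres_hom_ext (B : nualgType K) (h1 h2 : nuhom presented B) :
  (forall g, h1 (pres_gen g) = h2 (pres_gen g)) -> h1 =1 h2.
Proof.
move=> h; apply: pres_ind => //; first by rewrite !linear0.
  by move=> a x y hx hy; rewrite !linearP hx hy.
by move=> x y hx hy; rewrite !nuhomM hx hy.
Qed.

End Presented.

Section TensorAlgebra.
Variables (K : comPzRingType) (V : lmodType K).

Definition talg_model (B : nualgType K) (f : V -> B) : Prop := linear f.

(* T(V), without unit: the free algebra on the vector space [V] *)
Definition talg := presented talg_model.
HB.instance Definition _ := NuAlgebra.on talg.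

Definition talg_gen : V -> talg := pres_gen talg_model.

Fact talg_gen_linear : linear talg_gen.
Proof.
move=> a u v; apply: pres_ext => B f hf; rewrite [LHS]pres_eval_pi //=.
by rewrite pres_evalD // pres_evalZ // !pres_eval_pi //= hf.
Qed.
HB.instance Definition _ :=
  GRing.isLinear.Build K V talg _ talg_gen talg_gen_linear.

Definition talg_lift (B : nualgType K) (f : {linear V -> B}) : nuhom talg B :=
  @pres_lift K V talg_model B f (linearP f).

Lemma talg_lift_gen (B : nualgType K) (f : {linear V -> B}) v :
  talg_lift f (talg_gen v) = f v.
Proof. exact: pres_lift_gen. Qed.

End TensorAlgebra.

Section FreeProduct.
Variables (K : comPzRingType) (I : Type) (A : I -> nualgType K).

Definition fprod_letter i (a : A i) : {i : I & A i} :=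
  existT (fun i => A i : Type) i a.

Definition fprod_model (B : nualgType K) (f : {i : I & A i} -> B) : Prop :=
  forall i, linear (fun a : A i => f (fprod_letter a)) /\
            {morph (fun a : A i => f (fprod_letter a)) : a b / a ** b}.

(* the free product of the [A i], i.e. their coproduct as non-unital algebras *)
Definition fprod := presented fprod_model.
HB.instance Definition _ := NuAlgebra.on fprod.

Section Inj.
Variable i : I.
Definition fprod_inj_fun (a : A i) : fprod :=
  pres_gen fprod_model (fprod_letter a).
Fact fprod_inj_linear : linear fprod_inj_fun.
Proof.
move=> a u v; apply: pres_ext => B f hf; rewrite [LHS]pres_eval_pi //=.
by rewrite pres_evalD // pres_evalZ // !pres_eval_pi //= (hf i).1.
Qed.
HB.instance Definition _ :=
  GRing.isLinear.Build K (A i) fprod _ fprod_inj_fun fprod_inj_linear.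
Fact fprod_injM : {morph fprod_inj_fun : a b / a ** b}.
Proof.
move=> u v; apply: pres_ext => B f hf; rewrite [LHS]pres_eval_pi //=.
by rewrite pres_evalM // !pres_eval_pi //= (hf i).2.
Qed.
Definition fprod_inj : nuhom (A i) fprod := NuHom fprod_injM.
End Inj.

Section Lift.
Variables (B : nualgType K) (f : forall i, nuhom (A i) B).
Let g (x : {i : I & A i}) : B := f (tag x) (tagged x).
Fact fprod_lift_model : fprod_model g.
Proof.
move=> i; split; first by move=> a u v; rewrite /g /= linearP.
by move=> u v; rewrite /g /= nuhomM.
Qed.
Definition fprod_lift : nuhom fprod B := pres_lift fprod_lift_model.
Lemma fprod_lift_inj i a : fprod_lift (fprod_inj i a) = f i a.
Proof. exact: (pres_lift_gen fprod_lift_model (fprod_letter a)). Qed.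
End Lift.

Lemma fprod_hom_ext (B : nualgType K) (h1 h2 : nuhom fprod B) :
  (forall i a, h1 (fprod_inj i a) = h2 (fprod_inj i a)) -> h1 =1 h2.
Proof. by move=> h; apply: pres_hom_ext => -[i a]; exact: h. Qed.

End FreeProduct.

Section BinaryFreeProduct.
Variable K : comPzRingType.

Definition pair_fam (A1 A2 : nualgType K) (i : bool) : nualgType K :=
  if i then A2 else A1.

Definition fprod2 (A1 A2 : nualgType K) : nualgType K := fprod (pair_fam A1 A2).
Definition iota1 (A1 A2 : nualgType K) : nuhom A1 (fprod2 A1 A2) :=
  @fprod_inj K bool (pair_fam A1 A2) false.
Definition iota2 (A1 A2 : nualgType K) : nuhom A2 (fprod2 A1 A2) :=
  @fprod_inj K bool (pair_fam A1 A2) true.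

Definition fprod2_lift (A1 A2 B : nualgType K) (f1 : nuhom A1 B)
    (f2 : nuhom A2 B) : nuhom (fprod2 A1 A2) B :=
  @fprod_lift K bool (pair_fam A1 A2) B
    (fun i => if i as i0 return nuhom (pair_fam A1 A2 i0) B then f2 else f1).

Lemma fprod2_lift1 (A1 A2 B : nualgType K) (f1 : nuhom A1 B) (f2 : nuhom A2 B) a :
  fprod2_lift f1 f2 (iota1 A1 A2 a) = f1 a.
Proof. exact: (@fprod_lift_inj K bool (pair_fam A1 A2) B _ false a). Qed.
Lemma fprod2_lift2 (A1 A2 B : nualgType K) (f1 : nuhom A1 B) (f2 : nuhom A2 B) a :
  fprod2_lift f1 f2 (iota2 A1 A2 a) = f2 a.
Proof. exact: (@fprod_lift_inj K bool (pair_fam A1 A2) B _ true a). Qed.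

Definition fprod2_map (A1 A2 B1 B2 : nualgType K)
    (j1 : nuhom B1 A1) (j2 : nuhom B2 A2) : nuhom (fprod2 B1 B2) (fprod2 A1 A2) :=
  fprod2_lift (nuhom_comp (iota1 A1 A2) j1) (nuhom_comp (iota2 A1 A2) j2).

Definition fprod2_assoc (A1 A2 A3 : nualgType K) :
    nuhom (fprod2 A1 (fprod2 A2 A3)) (fprod2 (fprod2 A1 A2) A3) :=
  fprod2_lift
    (nuhom_comp (iota1 (fprod2 A1 A2) A3) (iota1 A1 A2))
    (fprod2_lift (nuhom_comp (iota1 (fprod2 A1 A2) A3) (iota2 A1 A2))
                 (iota2 (fprod2 A1 A2) A3)).

End BinaryFreeProduct.

Section SymmetricAlgebra.
Variables (K : comPzRingType) (W : lmodType K).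

(* the generator [None] stands for the unit *)
Definition sym_model (B : nualgType K) (f : option W -> B) : Prop :=
  [/\ linear (fun w => f (Some w)),
      forall x y, f x ** f y = f y ** f x &
      forall x, f None ** f x = f x].

(* S(W): the free commutative unital algebra on the vector space [W] *)
Definition sym := presented sym_model.
HB.instance Definition _ := NuAlgebra.on sym.

Definition sym_one : sym := pres_gen sym_model None.

Lemma sym_eval_comm (B : nualgType K) (f : option W -> B) (s t : nuterm K (option W)) :
  sym_model f -> nueval f s ** nueval f t = nueval f t ** nueval f s.
Proof.
move=> [_ fC _]; elim: s t => [x||s1 h1 s2 h2|a s h|s1 h1 s2 h2] t /=.
- elim: t => [y||t1 h1 t2 h2|a t h|t1 h1 t2 h2] /=.
  + exact: fC.
  + by rewrite numul0l numul0r.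
  + by rewrite numulDl numulDr h1 h2.
  + by rewrite numulZl numulZr h.
  + by rewrite numulA h1 -numulA h2 numulA.
- by rewrite numul0l numul0r.
- by rewrite numulDl numulDr h1 h2.
- by rewrite numulZl numulZr h.
- by rewrite -numulA h2 numulA h1 numulA.
Qed.

Lemma sym_eval_one (B : nualgType K) (f : option W -> B) (t : nuterm K (option W)) :
  sym_model f -> f None ** nueval f t = nueval f t.
Proof.
move=> [_ _ f1]; elim: t => [x||t1 h1 t2 h2|a t h|t1 h1 t2 h2] /=.
- exact: f1.
- by rewrite numul0r.
- by rewrite numulDr h1 h2.
- by rewrite numulZr h.
- by rewrite numulA h1.
Qed.

Fact sym_mulC : commutative (@numul K sym).
Proof.
move=> x y; apply: pres_ext => B f hf.
by rewrite !pres_evalM //; exact: sym_eval_comm.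
Qed.
Fact sym_mul1 : left_id sym_one (@numul K sym).
Proof.
move=> x; apply: pres_ext => B f hf; rewrite pres_evalM // pres_eval_pi //=.
exact: sym_eval_one.
Qed.
HB.instance Definition _ := NuAlgebra_isComUnital.Build K sym sym_mulC sym_mul1.

Definition sym_gen (w : W) : sym := pres_gen sym_model (Some w).
Fact sym_gen_linear : linear sym_gen.
Proof.
move=> a u v; apply: pres_ext => B f hf; rewrite [LHS]pres_eval_pi //=.
rewrite pres_evalD // pres_evalZ // !pres_eval_pi //=.
by case: hf => -> _ _.
Qed.
HB.instance Definition _ := GRing.isLinear.Build K W sym _ sym_gen sym_gen_linear.

Section Lift.
Variables (B : cualgType K) (R : {linear W -> B}).
Let g (x : option W) : B := if x is Some w then R w else uone.
Fact sym_lift_model : sym_model g.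
Proof.
split; first by move=> a u v; exact: linearP.
  by move=> x y; exact: numulC.
by move=> x; exact: umul1.
Qed.
Definition sym_lift : nuhom sym B := pres_lift sym_lift_model.
Lemma sym_lift_gen w : sym_lift (sym_gen w) = R w.
Proof. exact: (pres_lift_gen sym_lift_model (Some w)). Qed.
Lemma sym_lift1 : sym_lift (uone : sym) = uone.
Proof. exact: (pres_lift_gen sym_lift_model None). Qed.
End Lift.

End SymmetricAlgebra.

Section TensorProduct.
Variables (K : comPzRingType) (A B : lmodType K).

Definition bilin (W : lmodType K) (f : A -> B -> W) : Prop :=
  (forall b, linear (f^~ b)) /\ (forall a, linear (f a)).

Definition tens_eval (W : lmodType K) (f : A -> B -> W) (s : seq (A * B)) : W :=
  \sum_(x <- s) f x.1 x.2.

(* A formal sum [:: (a_1, b_1); ...; (a_k, b_k)] represents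
   a_1 (x) b_1 + ... + a_k (x) b_k; two of them are identified when every
   bilinear map takes the same value on both. *)
Definition tens_rel (s t : seq (A * B)) : bool :=
  `[< forall (W : lmodType K) (f : A -> B -> W),
        bilin f -> tens_eval f s = tens_eval f t >].

Lemma tens_rel_refl : reflexive tens_rel.
Proof. by move=> t; apply/asboolP. Qed.
Lemma tens_rel_sym : symmetric tens_rel.
Proof. by move=> s t; apply/asboolP/asboolP => h W f hf; rewrite h. Qed.
Lemma tens_rel_trans : transitive tens_rel.
Proof.
move=> t s u /asboolP h1 /asboolP h2; apply/asboolP => W f hf.
by rewrite h1 // h2.
Qed.
Canonical tens_equiv :=
  EquivRel tens_rel tens_rel_refl tens_rel_sym tens_rel_trans.

Definition tens := {eq_quot tens_equiv}.
HB.instance Definition _ := Choice.on tens.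

Definition tens_pi (s : seq (A * B)) : tens := \pi_{eq_quot tens_equiv} s.
Definition tens_repr (x : tens) : seq (A * B) := repr (x : {eq_quot tens_equiv}).
Definition tens_lift_fun (W : lmodType K) (f : A -> B -> W) (x : tens) : W :=
  tens_eval f (tens_repr x).

Lemma tens_lift_pi (W : lmodType K) (f : A -> B -> W) s :
  bilin f -> tens_lift_fun f (tens_pi s) = tens_eval f s.
Proof.
rewrite /tens_lift_fun /tens_repr /tens_pi => hf; case: piP => u /eqP.
by rewrite eqmodE => /asboolP h; rewrite (h W f hf).
Qed.

Lemma tens_liftE (W : lmodType K) (f : A -> B -> W) x :
  tens_lift_fun f x = \sum_(p <- tens_repr x) f p.1 p.2.
Proof. by []. Qed.

Lemma tens_surj (x : tens) : exists s, x = tens_pi s.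
Proof. by exists (tens_repr x); rewrite /tens_pi /tens_repr reprK. Qed.

Lemma tens_ext (x y : tens) :
  (forall (W : lmodType K) (f : A -> B -> W),
     bilin f -> tens_lift_fun f x = tens_lift_fun f y) -> x = y.
Proof.
have [s ->] := tens_surj x; have [t ->] := tens_surj y => h.
rewrite /tens_pi; apply/eqP; rewrite eqmodE; apply/asboolP => W f hf.
by have := h W f hf; rewrite !tens_lift_pi.
Qed.

Definition tens_zero : tens := tens_pi [::].
Definition tens_add (x y : tens) : tens := tens_pi (tens_repr x ++ tens_repr y).
Definition tens_scale (a : K) (x : tens) : tens :=
  tens_pi [seq (a *: p.1, p.2) | p <- tens_repr x].
Definition tens_opp : tens -> tens := tens_scale (-1).

Section Eval.
Variables (W : lmodType K) (f : A -> B -> W) (hf : bilin f).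
Let ev := tens_lift_fun f.
Lemma tens_lift0 : ev tens_zero = 0.
Proof. by rewrite /ev tens_lift_pi // /tens_eval big_nil. Qed.
Lemma tens_liftD x y : ev (tens_add x y) = ev x + ev y.
Proof. by rewrite /ev tens_lift_pi // /tens_eval big_cat. Qed.
Lemma bilinZl a u v : f (a *: u) v = a *: f u v.
Proof.
have h c x y : f (c *: x + y) v = c *: f x v + f y v by exact: hf.1.
have f0 : f 0 v = 0.
  by apply: (addrI (f 0 v)); rewrite addr0 -{2}[f 0 v]scale1r addrC -h scaler0 addr0.
by rewrite -[a *: u]addr0 h f0 addr0.
Qed.
Lemma tens_liftZ a x : ev (tens_scale a x) = a *: ev x.
Proof.
rewrite /ev tens_lift_pi // /tens_lift_fun /tens_eval big_map scaler_sumr.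
by apply: eq_bigr => p _; exact: bilinZl.
Qed.
Lemma tens_liftN x : ev (tens_opp x) = - ev x.
Proof. by rewrite /tens_opp tens_liftZ scaleN1r. Qed.
End Eval.

Local Ltac tens_tac :=
  apply: tens_ext => W f hf;
  rewrite !(tens_liftD, tens_liftN, tens_liftZ, tens_lift0) //.

Fact tens_addA : associative tens_add.
Proof. by move=> x y z; tens_tac; rewrite addrA. Qed.
Fact tens_addC : commutative tens_add.
Proof. by move=> x y; tens_tac; rewrite addrC. Qed.
Fact tens_add0 : left_id tens_zero tens_add.
Proof. by move=> x; tens_tac; rewrite add0r. Qed.
Fact tens_addN : left_inverse tens_zero tens_opp tens_add.
Proof. by move=> x; tens_tac; rewrite addNr. Qed.
HB.instance Definition _ :=
  GRing.isZmodule.Build tens tens_addA tens_addC tens_add0 tens_addN.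

Fact tens_scaleA a b x : tens_scale a (tens_scale b x) = tens_scale (a * b) x.
Proof. by tens_tac; rewrite scalerA. Qed.
Fact tens_scale1 : left_id 1 tens_scale.
Proof. by move=> x; tens_tac; rewrite scale1r. Qed.
Fact tens_scaleDr : right_distributive tens_scale +%R.
Proof. by move=> a x y; tens_tac; rewrite scalerDr. Qed.
Fact tens_scaleDl x : {morph tens_scale^~ x : a b / a + b}.
Proof. by move=> a b; tens_tac; rewrite scalerDl. Qed.
HB.instance Definition _ :=
  GRing.Zmodule_isLmodule.Build K tens
    tens_scaleA tens_scale1 tens_scaleDr tens_scaleDl.

Definition tens_pure (a : A) (b : B) : tens := tens_pi [:: (a, b)].

Section Lift.
Variables (W : lmodType K) (f : A -> B -> W) (hf : bilin f).
Let ev : tens -> W := tens_lift_fun f.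
Fact tens_lift_linear : linear ev.
Proof. by move=> a x y; rewrite /ev tens_liftD // tens_liftZ. Qed.
Definition tens_lift : {linear tens -> W} := linear_pack tens_lift_linear.
Lemma tens_lift_pure a b : tens_lift (tens_pure a b) = f a b.
Proof. by rewrite [LHS](tens_lift_pi _ hf) /tens_eval big_seq1. Qed.
End Lift.

End TensorProduct.

Section TensorAlgebraProduct.
Variables (K : comPzRingType) (A B : nualgType K).

Definition tens_mul (x y : tens A B) : tens A B :=
  tens_pi [seq (p.1 ** q.1, p.2 ** q.2) | p <- tens_repr x, q <- tens_repr y].

Lemma tens_lift_mul (W : lmodType K) (f : A -> B -> W) (x y : tens A B) :
  bilin f -> tens_lift_fun f (tens_mul x y) =
    tens_lift_fun
      (fun a b => tens_lift_fun (fun a' b' => f (a ** a') (b ** b')) y) x.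
Proof.
move=> hf; rewrite /tens_mul tens_lift_pi // /tens_eval big_allpairs_dep.
by rewrite /tens_lift_fun /tens_eval.
Qed.

Lemma bilin_mul2 (W : lmodType K) (f : A -> B -> W) a b :
  bilin f -> bilin (fun a' b' => f (a ** a') (b ** b')).
Proof.
move=> [h1 h2]; split.
  by move=> b' c u v; rewrite numulDr numulZr (h1 (b ** b')).
by move=> a' c u v; rewrite numulDr numulZr h2.
Qed.

Lemma bilin_mul1 (W : lmodType K) (f : A -> B -> W) (y : tens A B) :
  bilin f ->
  bilin (fun a b => tens_lift_fun (fun a' b' => f (a ** a') (b ** b')) y).
Proof.
move=> [h1 h2]; split.
  move=> b c u v; rewrite /tens_lift_fun /tens_eval scaler_sumr -big_split /=.
  by apply: eq_bigr => p _; rewrite numulDl numulZl (h1 (b ** p.2)).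
move=> a c u v; rewrite /tens_lift_fun /tens_eval scaler_sumr -big_split /=.
by apply: eq_bigr => p _; rewrite numulDl numulZl h2.
Qed.

Lemma tens_mulE (W : lmodType K) (f : A -> B -> W) s t :
  bilin f -> tens_lift_fun f (tens_mul (tens_pi s) (tens_pi t)) =
    \sum_(p <- s) \sum_(q <- t) f (p.1 ** q.1) (p.2 ** q.2).
Proof.
move=> hf; rewrite tens_lift_mul // tens_lift_pi; last exact: bilin_mul1.
by apply: eq_bigr => p _; rewrite tens_lift_pi //; exact: bilin_mul2.
Qed.

Lemma tens_mul_pi s t :
  tens_mul (tens_pi s) (tens_pi t) =
  tens_pi [seq (p.1 ** q.1, p.2 ** q.2) | p <- s, q <- t].
Proof.
apply: tens_ext => W f hf; rewrite tens_mulE // tens_lift_pi //.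
by rewrite /tens_eval big_allpairs_dep.
Qed.

Fact tens_mulA : associative tens_mul.
Proof.
move=> x y z; have [s ->] := tens_surj x; have [t ->] := tens_surj y.
have [u ->] := tens_surj z; apply: tens_ext => W f hf.
rewrite !tens_mul_pi !tens_lift_pi // /tens_eval !big_allpairs_dep /=.
apply: eq_bigr => p _; rewrite big_allpairs_dep.
by apply: eq_bigr => q _; apply: eq_bigr => r _; rewrite /= !numulA.
Qed.
Fact tens_mulDl : left_distributive tens_mul +%R.
Proof.
move=> x y z; apply: tens_ext => W f hf.
rewrite tens_liftD // !tens_lift_mul // tens_liftD //; exact: bilin_mul1.
Qed.
Fact tens_mulDr : right_distributive tens_mul +%R.
Proof.
move=> x y z; apply: tens_ext => W f hf.
rewrite tens_liftD // !tens_lift_mul // !(tens_liftE _ x) -big_split /=.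
by apply: eq_bigr => p _; rewrite tens_liftD //; exact: bilin_mul2.
Qed.
Fact tens_mulZl a x y : tens_mul (a *: x) y = a *: tens_mul x y.
Proof.
apply: tens_ext => W f hf.
rewrite tens_liftZ // !tens_lift_mul // tens_liftZ //; exact: bilin_mul1.
Qed.
Fact tens_mulZr a x y : tens_mul x (a *: y) = a *: tens_mul x y.
Proof.
apply: tens_ext => W f hf.
rewrite tens_liftZ // !tens_lift_mul // !(tens_liftE _ x) scaler_sumr.
by apply: eq_bigr => p _; rewrite tens_liftZ //; exact: bilin_mul2.
Qed.
HB.instance Definition _ :=
  Lmodule_isNuAlgebra.Build K (tens A B)
    tens_mulA tens_mulDl tens_mulDr tens_mulZl tens_mulZr.

Lemma tens_pureM (a a' : A) (b b' : B) :
  tens_pure a b ** tens_pure a' b' = tens_pure (a ** a') (b ** b').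
Proof. exact: tens_mul_pi. Qed.

End TensorAlgebraProduct.

Section TensorUnital.
Variables (K : comPzRingType) (A B : cualgType K).

Fact tens_mulC : commutative (@numul K (tens A B)).
Proof.
move=> x y; have [s ->] := tens_surj x; have [t ->] := tens_surj y.
apply: tens_ext => W f hf; rewrite !tens_mulE // exchange_big.
apply: eq_bigr => q _; apply: eq_bigr => p _.
by rewrite (numulC p.1) (numulC p.2).
Qed.
Fact tens_mul1 : left_id (tens_pure uone uone) (@numul K (tens A B)).
Proof.
move=> x; have [s ->] := tens_surj x.
apply: tens_ext => W f hf; rewrite tens_mulE // tens_lift_pi // big_seq1.
by apply: eq_bigr => q _; rewrite !umul1.
Qed.
HB.instance Definition _ :=
  NuAlgebra_isComUnital.Build K (tens A B) tens_mulC tens_mul1.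

End TensorUnital.

HB.instance Definition _ (K : comPzRingType) :=
  Lmodule_isNuAlgebra.Build K K^o (@mulrA K) (@mulrDl K) (@mulrDr K)
    (fun a x y => esym (mulrA a x y)) (fun a x y => mulrCA x a y).
HB.instance Definition _ (K : comPzRingType) :=
  NuAlgebra_isComUnital.Build K K^o (@mulrC K) (@mul1r K).

HB.instance Definition _ (K : comNzRingType) :=
  Lmodule_isNuAlgebra.Build K {poly K} (@mulrA {poly K}) (@mulrDl {poly K})
    (@mulrDr {poly K}) (fun a x y => esym (scalerAl a x y))
    (fun a x y => esym (scalerAr a x y)).
HB.instance Definition _ (K : comNzRingType) :=
  NuAlgebra_isComUnital.Build K {poly K} (@mulrC {poly K}) (@mul1r {poly K}).

Section Subalgebra.
Variables (K : comPzRingType) (A : nualgType K).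

Definition subspace (V : lmodType K) (S : set V) : Prop :=
  S 0 /\ forall (a : K) x y, S x -> S y -> S (a *: x + y).

Record subalg := SubAlg {
  subalg_set :> A -> Prop;
  subalg_subspace : subspace subalg_set;
  subalg_mul : forall x y, subalg_set x -> subalg_set y -> subalg_set (x ** y)
}.

Variable S : subalg.

Definition subalg_pred : {pred A} := [pred x | `[< S x >]].

Fact subalg_pred_closed : submod_closed subalg_pred.
Proof.
split; first by apply/asboolP; exact: (subalg_subspace S).1.
move=> a x y /asboolP hx /asboolP hy; apply/asboolP.
exact: (subalg_subspace S).2.
Qed.
HB.instance Definition _ :=
  GRing.isSubmodClosed.Build K A subalg_pred subalg_pred_closed.

Definition subalg_type := {x : A | x \in subalg_pred}.
HB.instance Definition _ := SubChoice.on subalg_type.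
HB.instance Definition _ := [SubChoice_isSubLmodule of subalg_type by <:].

Definition subalg_val (x : subalg_type) : A := val x.

Fact subalg_mul_in (x y : subalg_type) : subalg_val x ** subalg_val y \in subalg_pred.
Proof.
apply/asboolP; apply: subalg_mul; apply/asboolP.
  exact: (valP x).
exact: (valP y).
Qed.
Definition subalg_numul (x y : subalg_type) : subalg_type :=
  exist _ (subalg_val x ** subalg_val y) (subalg_mul_in x y).

Fact subalg_numulA : associative subalg_numul.
Proof. by move=> x y z; apply: val_inj; exact: numulA. Qed.
Fact subalg_numulDl : left_distributive subalg_numul +%R.
Proof. by move=> x y z; apply: val_inj; exact: numulDl. Qed.
Fact subalg_numulDr : right_distributive subalg_numul +%R.
Proof. by move=> x y z; apply: val_inj; exact: numulDr. Qed.
Fact subalg_numulZl a x y : subalg_numul (a *: x) y = a *: subalg_numul x y.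
Proof. by apply: val_inj; exact: numulZl. Qed.
Fact subalg_numulZr a x y : subalg_numul x (a *: y) = a *: subalg_numul x y.
Proof. by apply: val_inj; exact: numulZr. Qed.
HB.instance Definition _ :=
  Lmodule_isNuAlgebra.Build K subalg_type subalg_numulA subalg_numulDl
    subalg_numulDr subalg_numulZl subalg_numulZr.

Fact subalg_val_linear : linear subalg_val.
Proof. by []. Qed.
HB.instance Definition _ :=
  GRing.isLinear.Build K subalg_type A _ subalg_val subalg_val_linear.
Fact subalg_valM : {morph subalg_val : x y / x ** y}.
Proof. by []. Qed.
Definition subalg_incl : nuhom subalg_type A := NuHom subalg_valM.

Lemma subalg_inclP x : S (subalg_incl x).
Proof. by apply/asboolP; exact: (valP x). Qed.

End Subalgebra.

Section SubalgebraImage.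
Variables (K : comPzRingType) (B A : nualgType K) (h : nuhom B A).

Fact subalg_im_subspace : subspace (range h).
Proof.
split; first by exists 0; rewrite ?linear0.
by move=> a _ _ [x _ <-] [y _ <-]; exists (a *: x + y); rewrite ?linearP.
Qed.
Fact subalg_im_mul x y : range h x -> range h y -> range h (x ** y).
Proof. by move=> [u _ <-] [v _ <-]; exists (u ** v); rewrite ?nuhomM. Qed.
Definition subalg_im : subalg A := SubAlg subalg_im_subspace subalg_im_mul.

Fact subalg_corestrict_in b : h b \in subalg_pred subalg_im.
Proof. by apply/asboolP; exists b. Qed.
Definition subalg_corestrict_fun (b : B) : subalg_type subalg_im :=
  exist _ (h b) (subalg_corestrict_in b).
Fact subalg_corestrict_linear : linear subalg_corestrict_fun.
Proof. by move=> a x y; apply: val_inj; rewrite /= linearP. Qed.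
HB.instance Definition _ :=
  GRing.isLinear.Build K B (subalg_type subalg_im) _ subalg_corestrict_fun
    subalg_corestrict_linear.
Fact subalg_corestrictM : {morph subalg_corestrict_fun : x y / x ** y}.
Proof. by move=> x y; apply: val_inj; rewrite /= nuhomM. Qed.
Definition subalg_corestrict : nuhom B (subalg_type subalg_im) :=
  NuHom subalg_corestrictM.

Lemma subalg_corestrict_surj (x : subalg_type subalg_im) :
  exists b, x = subalg_corestrict b.
Proof.
have [b _ hb] := subalg_inclP x.
by exists b; apply: val_inj; rewrite /= hb.
Qed.

End SubalgebraImage.

Section AlgP.
Variables (K : comPzRingType) (m : nat).

Lemma fprod_im_bij (A : nualgType K) (B : 'I_m -> nualgType K)
    (h : forall l, nuhom (B l) A) :
  bijective (fprod_lift h) ->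
  bijective (fprod_lift (fun l => subalg_incl (subalg_im (h l)))).
Proof.
move=> [F' FK FK'].
pose q : nuhom (fprod B) (fprod (fun l => subalg_type (subalg_im (h l)))) :=
  fprod_lift (fun l => nuhom_comp
    (fprod_inj (fun l => subalg_type (subalg_im (h l))) l)
    (subalg_corestrict (h l))).
set c := fprod_lift _.
have qE l b : q (fprod_inj B l b) = fprod_inj _ l (subalg_corestrict (h l) b).
  exact: fprod_lift_inj.
have cq x : c (q x) = fprod_lift h x.
  apply: (@fprod_hom_ext K _ B A (nuhom_comp c q)) => l b.
  by rewrite nuhom_compE qE !fprod_lift_inj.
have q_surj x : exists y, x = q y.
  elim/pres_ind: x.
  - move=> [l x]; have [b ->] := subalg_corestrict_surj x.
    by exists (fprod_inj B l b); rewrite qE.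
  - by exists 0; rewrite linear0.
  - by move=> a _ _ [u ->] [v ->]; exists (a *: u + v); rewrite linearP.
  - by move=> _ _ [u ->] [v ->]; exists (u ** v); rewrite nuhomM.
exists (fun x => q (F' x)) => x; last by rewrite cq FK'.
by have [y ->] := q_surj x; rewrite cq FK.
Qed.

Record algp := AlgP {
  algp_alg :> nualgType K;
  algp_sub : 'I_m -> subalg algp_alg;
  algp_free : bijective (fprod_lift (fun l => subalg_incl (algp_sub l)))
}.

Definition algp_hom (B A : algp) (j : nuhom B A) : Prop :=
  forall l b, algp_sub B l b -> algp_sub A l (j b).

Section Prod.
Variables A1 A2 : algp.

Definition algp_prod_map (l : 'I_m) :
    nuhom (fprod2 (subalg_type (algp_sub A1 l)) (subalg_type (algp_sub A2 l)))
          (fprod2 A1 A2) :=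
  fprod2_map (subalg_incl (algp_sub A1 l)) (subalg_incl (algp_sub A2 l)).

Lemma nuhom_inv (B A : nualgType K) (f : nuhom B A) :
  bijective f -> exists g : nuhom A B, cancel f g /\ cancel g f.
Proof.
move=> [g fK gK].
have gl : linear g by move=> a x y; apply: (can_inj fK); rewrite linearP !gK.
have gM : {morph g : x y / x ** y}.
  by move=> x y; apply: (can_inj fK); rewrite nuhomM !gK.
by exists (@NuHom K A B (linear_pack gl) gM).
Qed.

Fact algp_prod_free0 : bijective (fprod_lift algp_prod_map).
Proof.
have [g1 [g1K g1K']] := nuhom_inv (algp_free A1).
have [g2 [g2K g2K']] := nuhom_inv (algp_free A2).
pose B l := fprod2 (subalg_type (algp_sub A1 l)) (subalg_type (algp_sub A2 l)).
pose u1 : nuhom (fprod (fun l => subalg_type (algp_sub A1 l))) (fprod B) :=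
  fprod_lift (fun l => nuhom_comp (fprod_inj B l) (iota1 _ _)).
pose u2 : nuhom (fprod (fun l => subalg_type (algp_sub A2 l))) (fprod B) :=
  fprod_lift (fun l => nuhom_comp (fprod_inj B l) (iota2 _ _)).
pose g : nuhom (fprod2 A1 A2) (fprod B) :=
  fprod2_lift (nuhom_comp u1 g1) (nuhom_comp u2 g2).
set F := fprod_lift algp_prod_map.
have u1E l x : u1 (fprod_inj _ l x) = fprod_inj B l (iota1 _ _ x).
  exact: fprod_lift_inj.
have u2E l x : u2 (fprod_inj _ l x) = fprod_inj B l (iota2 _ _ x).
  exact: fprod_lift_inj.
have FE l x : F (fprod_inj B l x) = algp_prod_map l x by exact: fprod_lift_inj.
have gi1 a : g (iota1 A1 A2 a) = u1 (g1 a) by rewrite fprod2_lift1.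
have gi2 a : g (iota2 A1 A2 a) = u2 (g2 a) by rewrite fprod2_lift2.
exists g.
  apply: (@fprod_hom_ext K _ B _ (nuhom_comp g F) (nuhom_id _)) => l x.
  rewrite nuhom_compE nuhom_idE FE; move: x.
  apply: (@fprod_hom_ext K _ _ _
    (nuhom_comp g (algp_prod_map l)) (fprod_inj B l)) => -[] x.
  - rewrite nuhom_compE [algp_prod_map l _]fprod2_lift2 nuhom_compE gi2.
    have -> : subalg_incl (algp_sub A2 l) x =
        fprod_lift (fun l => subalg_incl (algp_sub A2 l))
          (fprod_inj (fun l => subalg_type (algp_sub A2 l)) l x).
      by rewrite fprod_lift_inj.
    by rewrite g2K u2E.
  - rewrite nuhom_compE [algp_prod_map l _]fprod2_lift1 nuhom_compE gi1.
    have -> : subalg_incl (algp_sub A1 l) x =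
        fprod_lift (fun l => subalg_incl (algp_sub A1 l))
          (fprod_inj (fun l => subalg_type (algp_sub A1 l)) l x).
      by rewrite fprod_lift_inj.
    by rewrite g1K u1E.
have Fu1 y : F (u1 y) = iota1 A1 A2 (fprod_lift (fun l => subalg_incl (algp_sub A1 l)) y).
  apply: (@fprod_hom_ext K _ _ _ (nuhom_comp F u1)
    (nuhom_comp (iota1 A1 A2) (fprod_lift _))) => l x.
  by rewrite !nuhom_compE u1E FE [LHS]fprod2_lift1 fprod_lift_inj.
have Fu2 y : F (u2 y) = iota2 A1 A2 (fprod_lift (fun l => subalg_incl (algp_sub A2 l)) y).
  apply: (@fprod_hom_ext K _ _ _ (nuhom_comp F u2)
    (nuhom_comp (iota2 A1 A2) (fprod_lift _))) => l x.
  by rewrite !nuhom_compE u2E FE [LHS]fprod2_lift2 fprod_lift_inj.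
apply: (@fprod_hom_ext K _ _ _ (nuhom_comp F g) (nuhom_id _)) => -[] a.
- by rewrite nuhom_compE gi2 Fu2 g2K'.
- by rewrite nuhom_compE gi1 Fu1 g1K'.
Qed.

(* A_1 |_| A_2 with the subalgebras A_1^(l) |_| A_2^(l) *)
Definition algp_prod : algp :=
  @AlgP (fprod2 A1 A2) (fun l => subalg_im (algp_prod_map l))
    (fprod_im_bij algp_prod_free0).

End Prod.

Section Talg.
Variable V : lmodType K.

Definition talg_copies : nualgType K := @fprod K 'I_m (fun _ => talg V).
Definition talg_copy (l : 'I_m) : nuhom (talg V) talg_copies :=
  @fprod_inj K 'I_m (fun _ => talg V) l.

Fact algp_talg_free0 : bijective (fprod_lift talg_copy).
Proof.
have h : fprod_lift talg_copy =1 id.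
  apply: (@fprod_hom_ext K _ _ _ _ (nuhom_id _)) => l a.
  exact: fprod_lift_inj.
by exists id => x; rewrite h.
Qed.

(* D = T(V)^{|_| m} with its m copies of T(V) *)
Definition algp_talg : algp :=
  @AlgP talg_copies (fun l => subalg_im (talg_copy l))
    (fprod_im_bij algp_talg_free0).

End Talg.
End AlgP.

Section Dual.
Variable K : fieldType.
Implicit Types V W : lmodType K.

Definition ldual W := {linear W -> K^o}.

Lemma ldual_ext W (f g : ldual W) : f =1 g -> f = g.
Proof.
case: f g => [f [[fa] [fs]]] [g [[ga] [gs]]] /= /funext fg.
case: g / fg ga gs => ga gs.
by rewrite (Prop_irrelevance fa ga) (Prop_irrelevance fs gs).
Qed.

(* [f] itself when it is linear; the junk value 0 otherwise *)
Definition to_ldual W (f : W -> K) : ldual W :=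
  match pselect (linear (f : W -> K^o)) with
  | left f_lin => linear_pack f_lin
  | right _ => \0
  end.

Lemma to_ldualE W (f : W -> K) : linear (f : W -> K^o) -> to_ldual f =1 f.
Proof. by rewrite /to_ldual => h; case: pselect. Qed.

Definition pullback V W (phi : ldual W) (f : {linear V -> W}) : ldual V :=
  phi \o f.

Fact tens_dual_bilin V W (b1 : ldual V) (b2 : ldual W) :
  bilin (fun v w => b1 v * b2 w : K^o).
Proof.
split=> [w|v] a x y /=; first by rewrite linearP mulrDl -scalerAl.
by rewrite linearP mulrDr -scalerAr.
Qed.
Definition tens_dual V W (b1 : ldual V) (b2 : ldual W) : ldual (tens V W) :=
  tens_lift (tens_dual_bilin b1 b2).

Definition sym_dual W (phi : ldual W) : ldual (sym W) :=
  sym_lift (phi : {linear W -> K^o}).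

Definition sym_counit W : ldual (sym W) := sym_dual (\0 : ldual W).

End Dual.

Section Powers.
Variables (K : fieldType) (d : nat).

(* A^{*d} is represented by the dual of the d-th power A^d *)
Definition pow (A : lmodType K) : lmodType K := {ffun 'I_d -> A}.

Section PowMap.
Variables (A B : lmodType K) (f : {linear A -> B}).
Definition pow_map_fun (x : pow A) : pow B := [ffun k : 'I_d => f (x k)].
Fact pow_map_linear : linear pow_map_fun.
Proof. by move=> a x y; apply/ffunP => k; rewrite !ffunE linearP. Qed.
HB.instance Definition _ :=
  GRing.isLinear.Build K (pow A) (pow B) _ pow_map_fun pow_map_linear.
Definition pow_map : {linear pow A -> pow B} := pow_map_fun.
End PowMap.

Definition pow_pullback (A B : nualgType K) (phi : ldual (pow A)) (j : nuhom B A) :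
    ldual (pow B) :=
  pullback phi (pow_map j).

(* the vector with [a] in position [k] and 0 elsewhere, so that
   [phi (pow_single k a)] is the value at [a] of the k-th component of phi *)
Definition pow_single (A : lmodType K) (k : 'I_d) (a : A) : pow A :=
  [ffun k' : 'I_d => if k' == k then a else 0].

End Powers.

Section UniversalProducts.
Variables (K : fieldType) (d m : nat).

Definition uproduct := forall A1 A2 : algp K m,
  ldual (pow d A1) -> ldual (pow d A2) -> ldual (pow d (algp_prod A1 A2)).

Definition fprod2_letter (A1 A2 : nualgType K) (x : A1 + A2) : fprod2 A1 A2 :=
  match x with
  | inl a => iota1 A1 A2 a
  | inr a => iota2 A1 A2 a
  end.

Definition alternating (A1 A2 : Type) (s : seq (A1 + A2)) : bool :=
  sorted (fun x y => is_inl x != is_inl y) s.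

Definition nondegenerate (P : uproduct) : Prop :=
  exists (A1 A2 : algp K m) (phi1 : ldual (pow d A1)) (phi2 : ldual (pow d A2))
         (k : 'I_d) (s : seq (A1 + A2)),
    [/\ (1 < size s)%N, alternating s &
        P A1 A2 phi1 phi2 (pow_single k (nuprod (map (@fprod2_letter A1 A2) s)))
          != 0].

Definition universal (P : uproduct) : Prop :=
  forall (A1 A2 B1 B2 : algp K m) (j1 : nuhom B1 A1) (j2 : nuhom B2 A2)
         (phi1 : ldual (pow d A1)) (phi2 : ldual (pow d A2)),
    algp_hom j1 -> algp_hom j2 ->
    pow_pullback (P A1 A2 phi1 phi2) (fprod2_map j1 j2) =
    P B1 B2 (pow_pullback phi1 j1) (pow_pullback phi2 j2).

Record uau_product (P : uproduct) : Prop := {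
  uau_universal : universal P;
  uau_nondegenerate : nondegenerate P;
  uau_unital1 : forall (A1 A2 : algp K m) phi1 phi2,
    pow_pullback (P A1 A2 phi1 phi2) (iota1 A1 A2) = phi1;
  uau_unital2 : forall (A1 A2 : algp K m) phi1 phi2,
    pow_pullback (P A1 A2 phi1 phi2) (iota2 A1 A2) = phi2;
  uau_associative : forall (A1 A2 A3 : algp K m) phi1 phi2 phi3,
    pow_pullback (P (algp_prod A1 A2) A3 (P A1 A2 phi1 phi2) phi3)
                 (fprod2_assoc A1 A2 A3) =
    P A1 (algp_prod A2 A3) phi1 (P A2 A3 phi2 phi3)
}.

Definition is_sigma (P : uproduct) (A1 A2 : algp K m)
    (s : {linear pow d (algp_prod A1 A2) ->
                 tens (sym (pow d A1)) (sym (pow d A2))}) : Prop :=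
  forall (phi1 : ldual (pow d A1)) (phi2 : ldual (pow d A2)),
    P A1 A2 phi1 phi2 =1 tens_dual (sym_dual phi1) (sym_dual phi2) \o s.

(* For infinite K, at most one linear map satisfies [is_sigma], since the
   functionals S(phi1) (x) S(phi2) are jointly injective on
   S(A1^d) (x) S(A2^d); the value is 0 (junk) if there is none. *)
Definition sigma (P : uproduct) (A1 A2 : algp K m) :
    {linear pow d (algp_prod A1 A2) ->
            tens (sym (pow d A1)) (sym (pow d A2))} :=
  match pselect (exists s, is_sigma P s) with
  | left h => projT1 (cid h)
  | right _ => \0
  end.

End UniversalProducts.

Section Convolution.
Variables (K : fieldType) (d m : nat) (P : uproduct K d m) (V : lmodType K).

Let TV : nualgType K := talg V.
Let D : algp K m := algp_talg m V.
Let E : lmodType K := pow d D.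

Section Delta.
Let f (v : V) : fprod2 TV TV :=
  iota1 TV TV (talg_gen v) + iota2 TV TV (talg_gen v).
Fact talg_delta_linear : linear f.
Proof. by move=> a u v; rewrite /f !linearP scalerDr addrACA. Qed.
Definition talg_delta : nuhom TV (fprod2 TV TV) :=
  talg_lift (linear_pack talg_delta_linear).
Lemma talg_delta_gen v : talg_delta (talg_gen v) =
  iota1 TV TV (talg_gen v) + iota2 TV TV (talg_gen v).
Proof. exact: talg_lift_gen. Qed.
End Delta.

(* Delta^{|_| m} : D -> D |_| D *)
Definition copies_delta : nuhom D (fprod2 D D) :=
  @fprod_lift K 'I_m (fun _ => TV) (fprod2 D D) (fun l =>
    nuhom_comp (fprod2_map (talg_copy V l) (talg_copy V l)) talg_delta).

Definition conv (phi1 phi2 : ldual E) : ldual E :=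
  pow_pullback (@P D D phi1 phi2) copies_delta.

Definition sym_comult : nuhom (sym E) (tens (sym E) (sym E)) :=
  sym_lift (sigma P D D \o pow_map d copies_delta).

Definition sconv (b1 b2 : ldual (sym E)) : ldual (sym E) :=
  pullback (tens_dual b1 b2) sym_comult.

Definition sconv_pow (b : ldual (sym E)) (l : nat) : ldual (sym E) :=
  iter l (sconv b) (sym_counit E).

(* The sum [\sum_(l \in _)] is over the indices of the nonzero terms. *)
Definition sconv_ln (Phi : ldual (sym E)) : ldual (sym E) :=
  to_ldual (fun x =>
    \sum_(l \in [set l | (0 < l)%N])
       (-1) ^+ l.+1 / l%:R * sconv_pow (Phi \- sym_counit E) l x).

Definition cumulant (phi : ldual E) : ldual E :=
  pullback (sconv_ln (sym_dual phi)) (@sym_gen K E).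

Definition cumulant_inv (psi : ldual E) : ldual E :=
  match pselect (exists phi, cumulant phi = psi) with
  | left h => projT1 (cid h)
  | right _ => \0
  end.

End Convolution.

Section Infinitesimal.
Variables (K : fieldType) (W : lmodType K) (psi : ldual W).

Let f (w : W) : {poly K} := psi w *: 'X.
Fact inf_char_linear0 : linear f.
Proof. by move=> a u v; rewrite /f linearP scalerDl scalerA. Qed.
Let F : nuhom (sym W) {poly K} := sym_lift (linear_pack inf_char_linear0).

Let g (x : sym W) : K^o := (F x)`_1.
Fact inf_char_linear : linear g.
Proof. by move=> a u v; rewrite /g linearP coefD coefZ. Qed.

(* D(psi), the functional equal to psi on W and to 0 on the other symmetric
   powers of W (see [inf_char_prod]): the coefficient of X of the unital
   homomorphism w |-> psi(w) X *)
Definition inf_char : ldual (sym W) := linear_pack inf_char_linear.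

Lemma inf_char_prod (s : seq W) :
  inf_char (foldr (fun w x => sym_gen w ** x) uone s) =
  if s is [:: w] then psi w else 0.
Proof.
have h : F (foldr (fun w x => sym_gen w ** x) uone s) =
    (\prod_(w <- s) psi w) *: 'X^(size s).
  elim: s => [|w s IH].
    by rewrite big_nil scale1r expr0; exact: sym_lift1.
  have -> : foldr (fun w x => sym_gen w ** x) uone (w :: s) =
      sym_gen w ** foldr (fun w x => sym_gen w ** x) (uone : sym W) s by [].
  rewrite nuhomM sym_lift_gen IH big_cons exprS.
  rewrite [LHS](_ : _ = f w * (\prod_(w <- s) psi w *: 'X^(size s))) //.
  by rewrite /f -scalerAl -scalerAr scalerA.
have -> : forall x, inf_char x = (F x)`_1 by [].
rewrite h coefZ coefXn; case: s {h} => [|w [|w' s]].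
- by rewrite /= mulr0.
- by rewrite big_seq1 /= mulr1.
- by rewrite /= mulr0.
Qed.

End Infinitesimal.

Section CumulantLie.
Variables (K : fieldType) (d m : nat) (P : uproduct K d m) (V : lmodType K).
Let E : lmodType K := pow d (algp_talg m V).

Definition cumulant_lie (psi1 psi2 : ldual E) : ldual E :=
  pullback
    (sconv P (inf_char psi1) (inf_char psi2) \-
     sconv P (inf_char psi2) (inf_char psi1)) (@sym_gen K E).

End CumulantLie.

Section NCSeries.
Variable K : fieldType.

(* formal power series in two non-commuting variables X = false and Y = true,
   given by their coefficients *)
Definition ncseries := seq bool -> K.

Definition nc_one : ncseries := fun w => (w == [::])%:R.
Definition nc_var (b : bool) : ncseries := fun w => (w == [:: b])%:R.
Definition nc_mul (f g : ncseries) : ncseries := fun w =>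
  \sum_(i < (size w).+1) f (take i w) * g (drop i w).
Definition nc_pow (f : ncseries) (n : nat) : ncseries := iter n (nc_mul f) nc_one.

(* e^f and ln(1 + f) for f without constant term: only the powers f^n with
   n <= size w contribute to the coefficient of w *)
Definition nc_expseries (f : ncseries) : ncseries := fun w =>
  \sum_(n < (size w).+1) (n`!)%:R^-1 * nc_pow f n w.
Definition nc_ln1p (f : ncseries) : ncseries := fun w =>
  \sum_(1 <= n < (size w).+1) (-1) ^+ n.+1 / n%:R * nc_pow f n w.

Definition cbh_coef : ncseries :=
  nc_ln1p (fun w =>
    nc_mul (nc_expseries (nc_var false)) (nc_expseries (nc_var true)) w - nc_one w).

Variable W : lmodType K.
Variable br : ldual W -> ldual W -> ldual W.

Fixpoint nested_bracket (a : bool -> ldual W) (w : seq bool) : ldual W :=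
  match w with
  | [::] => \0
  | b :: w' => if w' is [::] then a b else br (a b) (nested_bracket a w')
  end.

(* The component of degree n of ln(e^X e^Y) is a Lie polynomial, hence (Dynkin)
   is unchanged when every word b_1 ... b_n is replaced by
   [b_1, [b_2, ... [b_(n-1), b_n]]] / n.  This expresses the series
   ln(e^X e^Y) by brackets only. *)
Definition cbh (psi1 psi2 : ldual W) : ldual W :=
  to_ldual (fun x =>
    \sum_(n \in [set n | (0 < n)%N]) \sum_(w : n.-tuple bool)
       cbh_coef w / n%:R *
       nested_bracket (fun b => if b then psi2 else psi1) w x).

End NCSeries.

Section FiniteDim.
Variables (K : fieldType) (V : lmodType K).

Definition lspan (X : set V) : set V :=
  [set x | forall S : set V, subspace S -> X `<=` S -> S x].

Definition finite_dim (S : set V) : Prop :=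
  exists N (b : 'I_N -> V), S = lspan (range b).

End FiniteDim.

Section TwoObjects.
Variables (K : fieldType) (m n : nat) (A1 A2 : algp K m).
Let V : lmodType K := 'rV[K]_n.
Let D : nualgType K := algp_talg m V.

(* [p1], [p2] identify K^n with the direct sum of the W1 l and the W2 l:
   [p1 l] and [p2 l] are the coordinate projections. *)
Definition direct_sum_iso (W1 : 'I_m -> set A1) (W2 : 'I_m -> set A2)
    (p1 : 'I_m -> {linear V -> A1}) (p2 : 'I_m -> {linear V -> A2}) : Prop :=
  [/\ forall l v, W1 l (p1 l v), forall l v, W2 l (p2 l v) &
      forall (w1 : 'I_m -> A1) (w2 : 'I_m -> A2),
        (forall l, W1 l (w1 l)) -> (forall l, W2 l (w2 l)) ->
        exists! v : V, (forall l, p1 l v = w1 l) /\ (forall l, p2 l v = w2 l)].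

(* J_i : on the l-th copy of V, the projection onto W_i^(l) followed by the
   inclusion into A_i *)
Definition copies_hom (A : nualgType K) (p : 'I_m -> {linear V -> A}) : nuhom D A :=
  @fprod_lift K 'I_m (fun _ => talg V) A (fun l => talg_lift (p l)).

Variables (p1 : 'I_m -> {linear V -> A1}) (p2 : 'I_m -> {linear V -> A2}).

(* v lies in the summand W_i^(l) of V, where i = 1 is [false], i = 2 is [true] *)
Definition in_summand (i : bool) (l : 'I_m) (v : V) : Prop :=
  (forall l', (~~ i && (l' == l)) = false -> p1 l' v = 0) /\
  (forall l', (i && (l' == l)) = false -> p2 l' v = 0).

Definition summand_letter (x : bool * 'I_m * V) : D :=
  talg_copy V x.1.2 (talg_gen x.2).

(* the subspace of T(V)^{|_| m} spanned by the alternating tensors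
   b_1 (x) ... (x) b_p with b_r in the summand W_{i_r}^(l_r) of the l_r-th copy
   of V *)
Definition alt_tensors : set D :=
  lspan [set x | exists s : seq (bool * 'I_m * V),
    [/\ (0 < size s)%N, sorted (fun x y => x.1 != y.1) s,
        forall t, t \in s -> in_summand t.1.1 t.1.2 t.2 &
        x = nuprod (map summand_letter s)]].

(* the homomorphism T(V)^{|_| m} -> A_1 |_| A_2 sending b in the summand
   W_i^(l) of the l-th copy of V to iota_i b; it maps [alt_tensors] onto the
   span of the alternating tensors b_1 (x) ... (x) b_p in A_1 |_| A_2 *)
Definition alt_incl : nuhom D (fprod2 A1 A2) :=
  @fprod_lift K 'I_m (fun _ => talg V) (fprod2 A1 A2) (fun l =>
    talg_lift ((iota1 A1 A2 \o p1 l) \+ (iota2 A1 A2 \o p2 l))).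

End TwoObjects.

(* Main.v *)
(** By universality and multilinearity, the value of a universal product on a word
    is a polynomial with universal coefficients in the values of the two factors on
    free algebras whose letters are labelled so as to separate all words; this is the
    map sigma. Since the characters S(phi) separate the points of S(E), the dual
    S(E)^* is an associative algebra, filtered by the degree. Comparing
    coefficients of n in the powers Phi^n, the logarithm of a character Phi is a
    derivation over the counit, and the exponential of such a derivation is a
    character, so ln is a bijection. The coefficients of ln(e^x e^y) are primitive for
    the shuffle product, hence by Dynkin's argument words may be replaced by
    right-nested brackets and the convolution is CBH in the bracket of the cumulant
    Lie algebra. Finally any finite family of words of the free product of A1 and
    A2 is a homomorphic image of words of T(C^n)^m, on which the product is a convolution. *)
From HB Require Import structures.
Require Import Defs.
From mathcomp Require Import all_boot all_order all_algebra.
From mathcomp Require Import boolp classical_sets functions fsbigop reals complex.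
From mathcomp Require Import ring.

Set Implicit Arguments.
Unset Strict Implicit.
Unset Printing Implicit Defensive.

Import GRing.Theory.
Local Open Scope ring_scope.
Local Open Scope nualg_scope.

(** * Linear maps *)

(** Nothing is assumed about how a universal product depends on its two functionals, so
    polynomiality has to be forced by universality alone, by pulling functionals back along
    homomorphisms that split, select or rescale letters. The free algebras and S(E) are quotients of
    terms by their universal property, with no normal form, basis or grading at hand. Hence freeness
    is used as an extension property, elements of S(E) are compared by evaluating characters on
    them, and the degree is read off from the dilations v |-> t v of V: an element has degree < N
    when its dilates form a polynomial in t of size at most N, and a functional has order at least k
    when its values on dilates are divisible by t^k. A functional of order at least k kills the
    elements of degree < k, so every series is a finite sum at each point, and identities of series
    reduce to polynomial identities modulo every order. The logarithm theory sees only the abstract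
    record [conv_structure]; the product returns through its instance [product_structure]. *)

Lemma linear_ext (K : comPzRingType) (V W : lmodType K) (f g : {linear V -> W}) :
  f =1 g -> f = g.
Proof.
case: f g => [f [[fa] [fs]]] [g [[ga] [gs]]] /= /funext fg.
case: g / fg ga gs => ga gs.
by rewrite (Prop_irrelevance fa ga) (Prop_irrelevance fs gs).
Qed.

Definition lmap (K : comPzRingType) (V W : lmodType K) := {linear V -> W}.

Section LinearMaps.
Variables (K : comPzRingType) (V W : lmodType K).
Implicit Types f g h : lmap V W.

HB.instance Definition _ := gen_eqMixin (lmap V W).
HB.instance Definition _ := gen_choiceMixin (lmap V W).

Fact lmap_zero_linear : linear (fun _ : V => 0 : W).
Proof. by move=> a x y; rewrite scaler0 addr0. Qed.
Fact lmap_add_linear f g : linear (fun x => f x + g x).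
Proof. by move=> a x y; rewrite !linearP scalerDr addrACA. Qed.
Fact lmap_opp_linear f : linear (fun x => - f x).
Proof. by move=> a x y; rewrite linearP opprD scalerN. Qed.
Fact lmap_scale_linear (c : K) f : linear (fun x => c *: f x).
Proof. by move=> a x y; rewrite linearP scalerDr !scalerA mulrC. Qed.

Definition lmap_zero : lmap V W := linear_pack lmap_zero_linear.
Definition lmap_add f g : lmap V W := linear_pack (lmap_add_linear f g).
Definition lmap_opp f : lmap V W := linear_pack (lmap_opp_linear f).
Definition lmap_scale c f : lmap V W := linear_pack (lmap_scale_linear c f).

Fact lmap_addA : associative lmap_add.
Proof. by move=> f g h; apply: linear_ext => x; exact: addrA. Qed.
Fact lmap_addC : commutative lmap_add.
Proof. by move=> f g; apply: linear_ext => x; exact: addrC. Qed.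
Fact lmap_add0 : left_id lmap_zero lmap_add.
Proof. by move=> f; apply: linear_ext => x; exact: add0r. Qed.
Fact lmap_addN : left_inverse lmap_zero lmap_opp lmap_add.
Proof. by move=> f; apply: linear_ext => x; exact: addNr. Qed.
HB.instance Definition _ :=
  GRing.isZmodule.Build (lmap V W) lmap_addA lmap_addC lmap_add0 lmap_addN.

Fact lmap_scaleA a b f : lmap_scale a (lmap_scale b f) = lmap_scale (a * b) f.
Proof. by apply: linear_ext => x; exact: scalerA. Qed.
Fact lmap_scale1 : left_id 1 lmap_scale.
Proof. by move=> f; apply: linear_ext => x; exact: scale1r. Qed.
Fact lmap_scaleDr : right_distributive lmap_scale +%R.
Proof. by move=> a f g; apply: linear_ext => x; exact: scalerDr. Qed.
Fact lmap_scaleDl f : {morph lmap_scale^~ f : a b / a + b}.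
Proof. by move=> a b; apply: linear_ext => x; exact: scalerDl. Qed.
HB.instance Definition _ :=
  GRing.Zmodule_isLmodule.Build K (lmap V W)
    lmap_scaleA lmap_scale1 lmap_scaleDr lmap_scaleDl.

Lemma lmapDE f g x : (f + g) x = f x + g x. Proof. by []. Qed.
Lemma lmapBE f g x : (f - g) x = f x - g x. Proof. by []. Qed.
Lemma lmap0E x : (0 : lmap V W) x = 0. Proof. by []. Qed.
Lemma lmapZE a f x : (a *: f) x = a *: f x. Proof. by []. Qed.
Lemma lmap_sumE I (r : seq I) (P : pred I) (F : I -> lmap V W) x :
  (\sum_(i <- r | P i) F i) x = \sum_(i <- r | P i) F i x.
Proof.
elim/big_rec2: _ => [|i y1 y2 _ <-]; first exact: lmap0E.
exact: lmapDE.
Qed.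

End LinearMaps.

Section Endomorphisms.
Variables (K : comPzRingType) (V : lmodType K).

(** Endomorphisms form an algebra under composition; [free_on_linear] maps a free algebra into it in
    order to build linear functionals. *)
Definition lmap_comp (f g : lmap V V) : lmap V V := f \o g.

Fact lmap_compA : associative lmap_comp.
Proof. by move=> f g h; apply: linear_ext. Qed.
Fact lmap_compDl : left_distributive lmap_comp +%R.
Proof. by move=> f g h; apply: linear_ext. Qed.
Fact lmap_compDr : right_distributive lmap_comp +%R.
Proof. by move=> f g h; apply: linear_ext => x; exact: linearD. Qed.
Fact lmap_compZl a f g : lmap_comp (a *: f) g = a *: lmap_comp f g.
Proof. exact: linear_ext. Qed.
Fact lmap_compZr a f g : lmap_comp f (a *: g) = a *: lmap_comp f g.
Proof. by apply: linear_ext => x; exact: linearZ. Qed.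
HB.instance Definition _ :=
  Lmodule_isNuAlgebra.Build K (lmap V V)
    lmap_compA lmap_compDl lmap_compDr lmap_compZl lmap_compZr.

End Endomorphisms.

(** * Words in a free algebra *)

Section Words.
Variable K : comPzRingType.
Implicit Types A B C : nualgType K.

Lemma nuprod_cons B (a : B) s : s <> [::] -> nuprod (a :: s) = a ** nuprod s.
Proof. by case: s => [/(_ erefl)|]. Qed.

Lemma nuprod_cat B (s t : seq B) :
  s <> [::] -> t <> [::] -> nuprod (s ++ t) = nuprod s ** nuprod t.
Proof.
move=> + t0; elim: s => [/(_ erefl)//|a [|b s] IH] _; first by rewrite cat1s nuprod_cons.
by rewrite cat_cons nuprod_cons // IH // numulA.
Qed.

Lemma nuhom_prod B C (j : nuhom B C) s : j (nuprod s) = nuprod (map j s).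
Proof.
elim: s => [|a [|b s] IH]; first exact: linear0.
  by [].
by rewrite nuprod_cons // nuhomM IH.
Qed.

Definition word B (Y : Type) (g : Y -> B) (w : seq Y) : B := nuprod (map g w).

Lemma word_cons B Y (g : Y -> B) y w :
  w <> [::] -> word g (y :: w) = g y ** word g w.
Proof. by move=> w0; rewrite [LHS]nuprod_cons //; case: w w0. Qed.

Lemma nuhom_word B C (j : nuhom B C) Y (g : Y -> B) w :
  j (word g w) = word (j \o g) w.
Proof. by rewrite /word nuhom_prod -map_comp. Qed.

Lemma eq_word B Y (g h : Y -> B) : g =1 h -> word g =1 word h.
Proof. by move=> gh w; rewrite /word (eq_map gh). Qed.

(** Spanning is stated as an induction principle, the form in which it is used. The empty word is
    excluded because [nuprod] has a junk value there. *)
Definition spanned_by_words B (Y : Type) (g : Y -> B) : Prop :=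
  forall Q : B -> Prop, Q 0 -> (forall a x y, Q x -> Q y -> Q (a *: x + y)) ->
    (forall w, w <> [::] -> Q (word g w)) -> forall x, Q x.

(** Generation as an algebra is enough: the span of the words is closed under products, by
    distributing over both factors and concatenating words. *)
Lemma spanned_by_wordsP B Y (g : Y -> B) :
  (forall Q : B -> Prop, Q 0 -> (forall a x y, Q x -> Q y -> Q (a *: x + y)) ->
     (forall y, Q (g y)) -> (forall x y, Q x -> Q y -> Q (x ** y)) ->
     forall x, Q x) ->
  spanned_by_words g.
Proof.
move=> ind.
pose sp x := forall Q : B -> Prop,
  Q 0 -> (forall a x y, Q x -> Q y -> Q (a *: x + y)) ->
  (forall w, w <> [::] -> Q (word g w)) -> Q x.
have sp0 : sp 0 by move=> Q.
have spL a x y : sp x -> sp y -> sp (a *: x + y).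
  by move=> hx hy Q Q0 QL QW; apply: (QL); [exact: hx | exact: hy].
have spW w : w <> [::] -> sp (word g w) by move=> w0 Q _ _ QW; exact: QW.
suff h x : sp x by move=> Q Q0 QL QW x; exact: h.
apply: ind => // [y|{}x y sx sy]; first exact: (spW [:: y]).
apply: (sx (fun x => sp (x ** y))).
- by rewrite numul0l.
- by move=> a u v hu hv; rewrite numulDl numulZl; exact: spL.
move=> u u0; apply: (sy (fun y => sp (word g u ** y))).
- by rewrite numul0r.
- by move=> a v v' hv hv'; rewrite numulDr numulZr; exact: spL.
move=> v v0; rewrite /word -nuprod_cat; [|by case: u u0|by case: v v0].
by rewrite -map_cat; apply: spW; case: u u0.
Qed.

Lemma spanned_linear_ext B Y (g : Y -> B) (W : lmodType K) (f h : {linear B -> W}) :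
  spanned_by_words g -> (forall w, w <> [::] -> f (word g w) = h (word g w)) ->
  f =1 h.
Proof.
move=> sp fh; apply: sp => //; first by rewrite !linear0.
by move=> a x y hx hy; rewrite !linearP hx hy.
Qed.

(** Only existence of the extension is required; its uniqueness follows from the spanning half. *)
Definition free_on B (Y : Type) (g : Y -> B) : Prop :=
  spanned_by_words g /\
  forall C (f : Y -> C), exists h : nuhom B C, forall y, h (g y) = f y.

(* [B] acts on functions of words by right translation,
   [(g y . f) v = f (rcons v y)]; the extension of [beta] is [x |-> (x . beta) [::]]. *)
Lemma free_on_linear B Y (g : Y -> B) (W : lmodType K) (beta : seq Y -> W) :
  free_on g ->
  exists phi : {linear B -> W}, forall w, w <> [::] -> phi (word g w) = beta w.
Proof.
case=> _ free; pose M : lmodType K := (seq Y -> W : Type).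
pose shift (y : Y) (f : M) : M := fun v => f (rcons v y).
have shift_lin y : linear (shift y) by move=> a f h; apply/funext => v.
have [h hE] := free (lmap M M) (fun y => linear_pack (shift_lin y)).
have phi_lin : linear (fun x => h x beta [::]).
  by move=> a x y; rewrite linearP.
exists (linear_pack phi_lin) => w w0; rewrite -[RHS]/(beta ([::] ++ w)) [LHS]/=.
elim: w w0 [::] => [/(_ erefl)//|y [|z w] IH] _ v; first by rewrite [LHS](congr1 (fun f : lmap M M => f beta v) (hE y)) cats1.
rewrite word_cons // nuhomM.
rewrite -[LHS]/(h (g y) (h (word g (z :: w)) beta) v) hE.
by rewrite -[LHS]/(h (word g (z :: w)) beta (rcons v y)) IH // cat_rcons.
Qed.

End Words.

(** * Free generators of T(V)^{|_| m} and of its free square *)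

Section FreeAlgebras.
Variables (K : comPzRingType) (m : nat).

(** A basis given by spanning and extension of functions. It covers both the spaces K^n of the
    theorem and the function spaces on labelled letters. *)
Definition free_basis (V : lmodType K) (X : Type) (e : X -> V) : Prop :=
  (forall S : V -> Prop, S 0 -> (forall a x y, S x -> S y -> S (a *: x + y)) ->
     (forall x, S (e x)) -> forall v, S v) /\
  forall (W : lmodType K) (f : X -> W),
    exists h : {linear V -> W}, forall x, h (e x) = f x.

Lemma free_basis_row n : free_basis (fun i : 'I_n => delta_mx 0 i : 'rV[K]_n).
Proof.
split=> [S S0 SL Se v|W f].
  rewrite (row_sum_delta v); elim/big_rec: _ => // i x _ Sx; exact: SL.
have lin : linear (fun v : 'rV[K]_n => \sum_i v 0 i *: f i).
  move=> a u v; rewrite scaler_sumr -big_split /=; apply: eq_bigr => i _.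
  by rewrite !mxE scalerDl scalerA.
exists (linear_pack lin) => i /=; rewrite (bigD1 i) //= mxE !eqxx scale1r.
by rewrite big1 ?addr0 // => j /negPf ji; rewrite mxE eqxx ji scale0r.
Qed.

Lemma free_basis_ffun (X : finType) :
  free_basis (fun x : X => [ffun y => (x == y)%:R] : {ffun X -> K^o}).
Proof.
split=> [S S0 SL Se v|W f].
  have -> : v = \sum_x v x *: ([ffun y => (x == y)%:R] : {ffun X -> K^o}).
    apply/ffunP => y; rewrite sum_ffunE (bigD1 y) //= !ffunE eqxx big1.
      by rewrite addr0; exact/esym/mulr1.
    by move=> x /negPf xy; rewrite !ffunE xy; exact: mulr0.
  by elim/big_rec: _ => // i x _ Sx; exact: SL.
have lin : linear (fun v : {ffun X -> K^o} => \sum_x v x *: f x).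
  move=> a u v; rewrite scaler_sumr -big_split /=; apply: eq_bigr => i _.
  by rewrite !ffunE scalerDl scalerA.
exists (linear_pack lin) => x /=; rewrite (bigD1 x) //= ffunE eqxx scale1r.
by rewrite big1 ?addr0 // => y /negPf yx; rewrite ffunE eq_sym yx scale0r.
Qed.

Section Letters.
Variables (V : lmodType K) (X : Type) (e : X -> V).
Hypothesis eP : free_basis e.

Definition letter (y : 'I_m * X) : talg_copies m V :=
  talg_copy V y.1 (talg_gen (e y.2)).

Lemma talg_spanned (l : 'I_m) (Q : talg_copies m V -> Prop) :
  Q 0 -> (forall a x y, Q x -> Q y -> Q (a *: x + y)) ->
  (forall y, Q (letter y)) -> (forall x y, Q x -> Q y -> Q (x ** y)) ->
  forall a, Q (talg_copy V l a).
Proof.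
move=> Q0 QL Qe QM; apply: pres_ind.
- move=> v; rewrite -[pres_gen _ _]/(talg_gen v).
  apply: (eP.1 (fun v => Q (talg_copy V l (talg_gen v)))) => //.
  + by rewrite !linear0.
  + by move=> a x y; rewrite !linearP; exact: QL.
  + by move=> x; exact: (Qe (l, x)).
- by rewrite linear0.
- by move=> a x y; rewrite linearP; exact: QL.
- by move=> x y; rewrite nuhomM; exact: QM.
Qed.

Lemma letter_hom_exists (C : nualgType K) (f : 'I_m * X -> C) :
  exists h : nuhom (talg_copies m V) C,
    (forall y, h (letter y) = f y) /\
    exists p : 'I_m -> {linear V -> C},
      (forall l x, p l (e x) = f (l, x)) /\
      forall l v, h (talg_copy V l (talg_gen v)) = p l v.
Proof.
have hp l := eP.2 C (fun x => f (l, x)).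
pose p l := projT1 (cid (hp l)).
have pE l : forall x, p l (e x) = f (l, x) := projT2 (cid (hp l)).
pose h := @fprod_lift K 'I_m (fun _ => talg V) C (fun l => talg_lift (p l)).
have hE l v : h (talg_copy V l (talg_gen v)) = p l v.
  by rewrite [LHS]fprod_lift_inj talg_lift_gen.
exists h; split; last by exists p.
by move=> [l x]; rewrite hE pE.
Qed.

Lemma letter_free : free_on letter.
Proof.
split; last by move=> C f; have [h [hE _]] := letter_hom_exists f; exists h.
apply: spanned_by_wordsP => Q Q0 QL Qe QM; apply: pres_ind => //.
by move=> [l a]; exact: talg_spanned.
Qed.

Definition letter2 (y : bool * ('I_m * X)) :
    fprod2 (talg_copies m V) (talg_copies m V) :=
  if y.1 then iota2 _ _ (letter y.2) else iota1 _ _ (letter y.2).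

Lemma letter2_free : free_on letter2.
Proof.
have [sp free] := letter_free; split=> [|C f].
  apply: spanned_by_wordsP => Q Q0 QL Qe QM; apply: pres_ind => // -[] [] a.
  - apply: (sp (fun a => Q (iota2 _ _ a))) => [|c x y|w].
    + by rewrite linear0.
    + by rewrite linearP; exact: QL.
    + elim: w => [/(_ erefl)//|y [|z w] IH] _; first exact: (Qe (true, y)).
      rewrite word_cons // nuhomM; apply: QM; [exact: (Qe (true, y))|exact: IH].
  - apply: (sp (fun a => Q (iota1 _ _ a))) => [|c x y|w].
    + by rewrite linear0.
    + by rewrite linearP; exact: QL.
    + elim: w => [/(_ erefl)//|y [|z w] IH] _; first exact: (Qe (false, y)).
      rewrite word_cons // nuhomM; apply: QM; [exact: (Qe (false, y))|exact: IH].
have [h1 h1E] := free C (fun y => f (false, y)).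
have [h2 h2E] := free C (fun y => f (true, y)).
exists (fprod2_lift h1 h2) => -[[] y]; rewrite /letter2.
  by rewrite fprod2_lift2 h2E.
by rewrite fprod2_lift1 h1E.
Qed.

End Letters.
End FreeAlgebras.

(** * Convolution and universality *)

Section CopiesHom.
Variables (K : comPzRingType) (m : nat).

Lemma talg_copies_ext (V : lmodType K) (B : nualgType K)
    (h1 h2 : nuhom (talg_copies m V) B) :
  (forall l v, h1 (talg_copy V l (talg_gen v)) = h2 (talg_copy V l (talg_gen v))) ->
  h1 =1 h2.
Proof.
move=> h; apply: fprod_hom_ext => l.
by apply: (@pres_hom_ext K _ _ _ (nuhom_comp h1 (talg_copy V l))
  (nuhom_comp h2 (talg_copy V l))) => v; exact: h.
Qed.

Lemma copies_homE (V : lmodType K) (A : nualgType K) (p : 'I_m -> {linear V -> A}) l v :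
  @fprod_lift K 'I_m (fun _ => talg V) A (fun l => talg_lift (p l))
    (talg_copy V l (talg_gen v)) = p l v.
Proof. by rewrite [LHS]fprod_lift_inj talg_lift_gen. Qed.

Lemma copies_hom_algp (V : lmodType K) (A : algp K m) (h : nuhom (algp_talg m V) A) :
  (forall l v, algp_sub A l (h (talg_copy V l (talg_gen v)))) -> algp_hom h.
Proof.
move=> hA l _ [t _ <-]; elim/pres_ind: t => [v||a x y hx hy|x y hx hy].
- exact: hA.
- by rewrite !linear0; exact: (subalg_subspace (algp_sub A l)).1.
- by rewrite !linearP; exact: (subalg_subspace (algp_sub A l)).2.
- by rewrite !nuhomM; exact: subalg_mul.
Qed.

Lemma letter_algp_hom (V : lmodType K) X (e : X -> V) (A : algp K m)
    (f : 'I_m * X -> A) :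
  free_basis e -> (forall y, algp_sub A y.1 (f y)) ->
  exists h : nuhom (algp_talg m V) A,
    (forall y, h (letter e y) = f y) /\ algp_hom h.
Proof.
move=> eP fA; have [h [hE [p [pE hp]]]] := letter_hom_exists eP f.
exists h; split=> //; apply: copies_hom_algp => l v; rewrite [h _]hp.
have [A0 AL] := subalg_subspace (algp_sub A l).
apply: (eP.1 (fun v => algp_sub A l (p l v))) => [|a x y|x].
- by rewrite linear0.
- by rewrite linearP; exact: AL.
- by rewrite pE; exact: (fA (l, x)).
Qed.

Lemma letter_in_sub (V : lmodType K) X (e : X -> V) y :
  algp_sub (algp_talg m V) y.1 (letter e y).
Proof. by exists (talg_gen (e y.2)). Qed.

Lemma algp_hom_id (A : algp K m) : algp_hom (nuhom_id A).
Proof. by []. Qed.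

Lemma fprod2_map1 (A1 A2 B1 B2 : nualgType K) (j1 : nuhom B1 A1) (j2 : nuhom B2 A2) a :
  fprod2_map j1 j2 (iota1 B1 B2 a) = iota1 A1 A2 (j1 a).
Proof. exact: fprod2_lift1. Qed.
Lemma fprod2_map2 (A1 A2 B1 B2 : nualgType K) (j1 : nuhom B1 A1) (j2 : nuhom B2 A2) a :
  fprod2_map j1 j2 (iota2 B1 B2 a) = iota2 A1 A2 (j2 a).
Proof. exact: fprod2_lift2. Qed.

End CopiesHom.

Section PowMaps.
Variables (K : fieldType) (d : nat).

Lemma pow_map_comp (A B C : lmodType K) (f : {linear B -> C}) (g : {linear A -> B})
    (h : {linear A -> C}) x :
  (forall y, h y = f (g y)) -> pow_map d h x = pow_map d f (pow_map d g x).
Proof. by move=> hE; apply/ffunP => k; rewrite !ffunE hE. Qed.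

Lemma pow_map_id (A : lmodType K) (f : {linear A -> A}) x :
  f =1 id -> pow_map d f x = x.
Proof. by move=> fE; apply/ffunP => k; rewrite !ffunE fE. Qed.

Lemma pow_single_linear (A : lmodType K) (k : 'I_d) :
  linear (fun a : A => pow_single k a : pow d A).
Proof.
move=> c x y; apply/ffunP => k'; rewrite !ffunE.
by case: eqP; rewrite ?scaler0 ?addr0.
Qed.

Lemma pow_single0 (A : lmodType K) (k : 'I_d) : pow_single k 0 = 0 :> pow d A.
Proof. by apply/ffunP => k'; rewrite !ffunE if_same. Qed.

Lemma pow_map_single (A B : lmodType K) (f : {linear A -> B}) (k : 'I_d) (a : A) :
  pow_map d f (pow_single k a) = pow_single k (f a).
Proof. by apply/ffunP => k'; rewrite !ffunE; case: eqP; rewrite ?linear0. Qed.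

Lemma pow_sum_single (A : lmodType K) (x : pow d A) :
  x = \sum_k (pow_single k (x k) : pow d A).
Proof.
apply/ffunP => k; rewrite sum_ffunE (bigD1 k) //= ffunE eqxx big1 ?addr0 //.
by move=> k' /negPf kk'; rewrite ffunE eq_sym kk'.
Qed.

Lemma pow_ind (A : lmodType K) (Q : pow d A -> Prop) :
  Q 0 -> (forall a x y, Q x -> Q y -> Q (a *: x + y)) ->
  (forall k a, Q (pow_single k a)) -> forall x, Q x.
Proof.
move=> Q0 QL Qs x; rewrite (pow_sum_single x); elim/big_rec: _ => // k y _ Qy.
by rewrite -[pow_single _ _]scale1r; exact: QL.
Qed.

Lemma pow_linear_ext (A W : lmodType K) (f g : {linear pow d A -> W}) :
  (forall k a, f (pow_single k a) = g (pow_single k a)) -> f =1 g.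
Proof.
move=> fg; apply: pow_ind => //; first by rewrite !linear0.
by move=> a x y; rewrite !linearP => -> ->.
Qed.

End PowMaps.

Section Conv.
Variables (K : fieldType) (d m : nat) (P : uproduct K d m).
Hypothesis HP : uau_product P.
Implicit Types V : lmodType K.

Local Notation D V := (algp_talg m V).

Lemma universalE (A1 A2 B1 B2 : algp K m) (j1 : nuhom B1 A1) (j2 : nuhom B2 A2)
    (phi1 : ldual (pow d A1)) (phi2 : ldual (pow d A2)) x :
  algp_hom j1 -> algp_hom j2 ->
  P (pow_pullback phi1 j1) (pow_pullback phi2 j2) x =
  P phi1 phi2 (pow_map d (fprod2_map j1 j2) x).
Proof. by move=> h1 h2; rewrite -(uau_universal HP). Qed.

Lemma copies_delta_gen V l v :
  copies_delta m V (talg_copy V l (talg_gen v)) =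
  iota1 (D V) (D V) (talg_copy V l (talg_gen v)) +
  iota2 (D V) (D V) (talg_copy V l (talg_gen v)).
Proof.
rewrite [LHS]fprod_lift_inj nuhom_compE talg_delta_gen linearD.
by rewrite [X in X + _]fprod2_map1 [X in _ + X]fprod2_map2.
Qed.

(** On generators [h] agrees with the composite of [copies_delta] and the free product of [j1] and
    [j2], so this is universality. It is the source of the unit laws, of the compatibility with
    dilations and of the reconstruction. *)
Lemma conv_pullback V (A1 A2 : algp K m) (j1 : nuhom (D V) A1) (j2 : nuhom (D V) A2)
    (phi1 : ldual (pow d A1)) (phi2 : ldual (pow d A2)) x
    (h : nuhom (talg_copies m V) (fprod2 A1 A2)) :
  algp_hom j1 -> algp_hom j2 ->
  (forall l v, h (talg_copy V l (talg_gen v)) =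
     iota1 A1 A2 (j1 (talg_copy V l (talg_gen v))) +
     iota2 A1 A2 (j2 (talg_copy V l (talg_gen v)))) ->
  conv P (pow_pullback phi1 j1) (pow_pullback phi2 j2) x =
  P phi1 phi2 (pow_map d h x).
Proof.
move=> h1 h2 hE; rewrite -[LHS]/(P _ _ (pow_map d (copies_delta m V) x)).
rewrite universalE //; congr (P _ _ _); apply/esym/pow_map_comp.
apply: (@talg_copies_ext _ _ _ _ _ (nuhom_comp (fprod2_map j1 j2) (copies_delta m V))).
move=> l v; rewrite hE nuhom_compE copies_delta_gen linearD.
by rewrite [X in _ = X + _]fprod2_map1 [X in _ = _ + X]fprod2_map2.
Qed.

(** Part (ii) of the theorem: [conv_pullback] for the two homomorphisms J_i, whose values on a
    generator v of copy l are [p1 l v] and [p2 l v]. *)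
Lemma conv_alt_incl n (A1 A2 : algp K m) (phi1 : ldual (pow d A1))
    (phi2 : ldual (pow d A2))
    (p1 : 'I_m -> {linear 'rV[K]_n -> A1}) (p2 : 'I_m -> {linear 'rV[K]_n -> A2}) x :
  (forall l v, algp_sub A1 l (p1 l v)) -> (forall l v, algp_sub A2 l (p2 l v)) ->
  conv P (pow_pullback phi1 (copies_hom p1)) (pow_pullback phi2 (copies_hom p2)) x =
  P phi1 phi2 (pow_map d (alt_incl p1 p2) x).
Proof.
move=> h1 h2; apply: conv_pullback.
- by apply: copies_hom_algp => l v; rewrite [copies_hom _ _]copies_homE.
- by apply: copies_hom_algp => l v; rewrite [copies_hom _ _]copies_homE.
move=> l v; have E (A : nualgType K) p : @copies_hom K m n A p
    (talg_copy 'rV[K]_n l (talg_gen v)) = p l v := copies_homE p l v.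
by rewrite !E.
Qed.

End Conv.

(** * Reconstruction of the product from its convolutions *)

Section Reconstruction.
Variables (K : fieldType) (m : nat) (A1 A2 : algp K m).

Definition sub_letter (y : {l : 'I_m & (subalg_type (algp_sub A1 l) +
    subalg_type (algp_sub A2 l))%type}) : fprod2 A1 A2 :=
  match tagged y with
  | inl a => iota1 A1 A2 (subalg_incl (algp_sub A1 (tag y)) a)
  | inr a => iota2 A1 A2 (subalg_incl (algp_sub A2 (tag y)) a)
  end.

Lemma sub_letter_spanned : spanned_by_words sub_letter.
Proof.
apply: spanned_by_wordsP => Q Q0 QL Qg QM; apply: pres_ind => // -[] [] a.
- rewrite -[pres_gen _ _]/(iota2 A1 A2 a); have [g _ gK] := algp_free A2.
  rewrite -(gK a); move: (g a); apply: pres_ind.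
  + move=> [l x]; rewrite [fprod_lift _ _]fprod_lift_inj.
    exact: (Qg (existT _ l (inr x))).
  + by rewrite !linear0.
  + by move=> c x y hx hy; rewrite !linearP; exact: QL.
  + by move=> x y hx hy; rewrite !nuhomM; exact: QM.
- rewrite -[pres_gen _ _]/(iota1 A1 A2 a); have [g _ gK] := algp_free A1.
  rewrite -(gK a); move: (g a); apply: pres_ind.
  + move=> [l x]; rewrite [fprod_lift _ _]fprod_lift_inj.
    exact: (Qg (existT _ l (inl x))).
  + by rewrite !linear0.
  + by move=> c x y hx hy; rewrite !linearP; exact: QL.
  + by move=> x y hx hy; rewrite !nuhomM; exact: QM.
Qed.

Variable d : nat.

(** A word with n letters, each lying in some A_i^(l), is the image of a word in n distinct
    variables of T(K^n)^{|_| m}, one variable per position. By [conv_pullback] the product at the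
    word is then a convolution over K^n. *)
Lemma eq_conv_eq_product (P P' : uproduct K d m) :
  uau_product P -> uau_product P' ->
  (forall n, (0 < n)%N ->
     forall phi1 phi2 : ldual (pow d (algp_talg m 'rV[K]_n)),
       conv P phi1 phi2 = conv P' phi1 phi2) ->
  forall (phi1 : ldual (pow d A1)) (phi2 : ldual (pow d A2)),
    P _ _ phi1 phi2 = P' _ _ phi1 phi2.
Proof.
move=> HP HP' eqc phi1 phi2; apply: linear_ext; apply: pow_linear_ext => k.
pose f (Q : uproduct K d m) (a : fprod2 A1 A2) : K^o :=
  Q A1 A2 phi1 phi2 (pow_single k a).
have lin Q : linear (f Q) by move=> c x y; rewrite /f pow_single_linear linearP.
apply: (@spanned_linear_ext _ _ _ _ _ (linear_pack (lin P)) (linear_pack (lin P')));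
  first exact: sub_letter_spanned.
move=> w w0; rewrite /= /f; have n0 : (0 < size w)%N by case: w w0 => [/(_ erefl)|].
set n := size w in n0.
pose lt (i : 'I_n) := tnth (in_tuple w) i.
(* Variable i is sent to the letter at position i in the factor containing that letter, and to 0 in
   the other factor. In a copy different from the letter's own it also goes to 0, which keeps the
   values inside the prescribed subalgebra. *)
pose f1 (y : 'I_m * 'I_n) : A1 := if tagged (lt y.2) is inl a then
  (if tag (lt y.2) == y.1 then subalg_incl _ a else 0) else 0.
pose f2 (y : 'I_m * 'I_n) : A2 := if tagged (lt y.2) is inr a then
  (if tag (lt y.2) == y.1 then subalg_incl _ a else 0) else 0.
have f1A y : algp_sub A1 y.1 (f1 y).
  rewrite /f1; have A0 := (subalg_subspace (algp_sub A1 y.1)).1.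
  case: (lt y.2) => l [] a //=; case: eqP => // <-; exact: subalg_inclP.
have f2A y : algp_sub A2 y.1 (f2 y).
  rewrite /f2; have A0 := (subalg_subspace (algp_sub A2 y.1)).1.
  case: (lt y.2) => l [] a //=; case: eqP => // <-; exact: subalg_inclP.
have eP := free_basis_row K n.
have [j1 [j1E hj1]] := letter_algp_hom eP f1A.
have [j2 [j2E hj2]] := letter_algp_hom eP f2A.
pose h := nuhom_comp (fprod2_map j1 j2) (copies_delta m 'rV[K]_n).
have hE l v : h (talg_copy _ l (talg_gen v)) =
     iota1 A1 A2 (j1 (talg_copy _ l (talg_gen v))) +
     iota2 A1 A2 (j2 (talg_copy _ l (talg_gen v))).
  rewrite /h nuhom_compE copies_delta_gen linearD.
  by rewrite [X in X + _]fprod2_map1 [X in _ + X]fprod2_map2.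
pose x : talg_copies m 'rV[K]_n :=
  word (@letter K m _ _ (fun i : 'I_n => delta_mx 0 i))
    [seq (tag (lt i), i) | i <- enum 'I_n].
have -> : word sub_letter w = h x.
  rewrite /x nuhom_word /word -map_comp; congr nuprod.
  have -> : w = [seq lt i | i <- enum 'I_n].
    by rewrite -[LHS]/(tval (in_tuple w)) -[LHS]map_tnth_enum.
  rewrite -map_comp; apply: eq_map => i.
  rewrite [RHS](hE (tag (lt i)) (delta_mx 0 i)).
  rewrite [j1 _](j1E (tag (lt i), i)) [j2 _](j2E (tag (lt i), i)).
  rewrite /f1 /f2 /= /sub_letter; case: (lt i) => l [] a /=.
    by rewrite eqxx linear0 addr0.
  by rewrite eqxx linear0 add0r.
rewrite -!(pow_map_single h k).
by rewrite -(conv_pullback HP phi1 phi2 _ hj1 hj2 hE)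
  -(conv_pullback HP' phi1 phi2 _ hj1 hj2 hE) eqc.
Qed.

End Reconstruction.

(** * Universal coefficients *)

Section AllWords.
Variable S : finType.

Fixpoint words (n : nat) : seq (seq S) :=
  if n is n'.+1 then [seq s :: t | s <- enum S, t <- words n'] else [:: [::]].

Lemma mem_words n t : (t \in words n) = (size t == n).
Proof.
elim: n t => [|n IH] [|s t] //=.
  by apply/allpairsP => -[[s t] [_ _]].
apply/allpairsP/idP => [[[s' t'] /= [_]]|st].
  by rewrite IH => t'n [_ ->].
by exists (s, t); rewrite mem_enum IH.
Qed.

Lemma words_uniq n : uniq (words n).
Proof.
elim: n => [//|n IH] /=; apply: allpairs_uniq => //; first exact: enum_uniq.
by move=> [a s] [b t] _ _ /= [-> ->].
Qed.

Lemma big_words_cons (V : nmodType) n (F : seq S -> V) :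
  \sum_(t <- words n.+1) F t = \sum_(s : S) \sum_(t <- words n) F (s :: t).
Proof. by rewrite /= big_allpairs_dep big_enum. Qed.

End AllWords.

Section WordExpansion.
Variables (K : comPzRingType) (B : nualgType K) (Y : Type).

Lemma word_sum (S : finType) (g : Y * S -> B) v : v <> [::] ->
  word (fun y => \sum_(s : S) g (y, s)) v =
  \sum_(t <- words S (size v)) word g (zip v t).
Proof.
have mul_sumr (I : Type) (r : seq I) (F : I -> B) x :
    \sum_(i <- r) x ** F i = x ** \sum_(i <- r) F i.
  elim: r => [|i r IH]; first by rewrite !big_nil numul0r.
  by rewrite !big_cons IH numulDr.
have mul_suml (I : Type) (r : seq I) (F : I -> B) x :
    \sum_(i <- r) F i ** x = (\sum_(i <- r) F i) ** x.
  elim: r => [|i r IH]; first by rewrite !big_nil numul0l.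
  by rewrite !big_cons IH numulDl.
elim: v => [/(_ erefl)//|y [|z v] IH] _.
  rewrite big_words_cons; apply: eq_bigr => s _.
  by rewrite big_seq1.
rewrite word_cons // IH //; set X := \sum_(t <- words _ _) _.
rewrite [RHS]big_words_cons.
transitivity (\sum_s g (y, s) ** X); first exact/esym/mul_suml.
apply: eq_bigr => s _; rewrite -mul_sumr; apply: eq_big_seq => t; rewrite mem_words => /eqP.
by case: t => // t0 t _; rewrite -[LHS]word_cons.
Qed.

Lemma word_scale (g : Y -> B) (c : Y -> K) v : v <> [::] ->
  word (fun y => c y *: g y) v = (\prod_(y <- v) c y) *: word g v.
Proof.
elim: v => [/(_ erefl)//|y [|z v] IH] _; first by rewrite big_seq1.
rewrite word_cons // IH // [X in _ = _ *: X]word_cons // [X in _ = X *: _]big_cons.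
by rewrite -[X in X ** _]/(c y *: g y) numulZl numulZr scalerA.
Qed.

End WordExpansion.

Section TensorCharacters.
Variable K : fieldType.

Lemma tens_dual_pure (V W : lmodType K) (b1 : ldual V) (b2 : ldual W) v w :
  tens_dual b1 b2 (tens_pure v w) = b1 v * b2 w.
Proof. exact: tens_lift_pure. Qed.

Lemma tens_dualE (V W : lmodType K) (b1 : ldual V) (b2 : ldual W) x :
  tens_dual b1 b2 x = \sum_(p <- tens_repr x) b1 p.1 * b2 p.2.
Proof. by []. Qed.

Lemma tens_dualM (A B : nualgType K) (b1 : nuhom A K^o) (b2 : nuhom B K^o)
    (x y : tens A B) :
  tens_dual b1 b2 (x ** y) = tens_dual b1 b2 x * tens_dual b1 b2 y.
Proof.
rewrite [LHS](tens_lift_mul _ _ (tens_dual_bilin b1 b2)) !tens_dualE mulr_suml.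
apply: eq_bigr => p _; rewrite mulr_sumr; apply: eq_bigr => q _ /=.
by rewrite !nuhomM; exact: mulrACA.
Qed.

Lemma sym_dual_gen (W : lmodType K) (phi : ldual W) w :
  sym_dual phi (sym_gen w) = phi w.
Proof. exact: sym_lift_gen. Qed.

Lemma sym_dual1 (W : lmodType K) (phi : ldual W) : sym_dual phi uone = 1.
Proof. exact: sym_lift1. Qed.

Lemma sym_dualM (W : lmodType K) (phi : ldual W) x y :
  sym_dual phi (x ** y) = sym_dual phi x * sym_dual phi y.
Proof. by rewrite /sym_dual /= pres_evalM //; exact: sym_lift_model. Qed.

(** The polynomial functions of a pair of functionals, represented by elements of S(E1) (x) S(E2).
    They contain the coordinates and are closed under products because S(phi) is multiplicative; the
    representing element is what [sigma] must return. *)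
Definition polyfun (E1 E2 : lmodType K) (F : ldual E1 -> ldual E2 -> K) : Prop :=
  exists u : tens (sym E1) (sym E2),
    forall phi1 phi2, F phi1 phi2 = tens_dual (sym_dual phi1) (sym_dual phi2) u.

Variables E1 E2 : lmodType K.
Implicit Types F G : ldual E1 -> ldual E2 -> K.

Lemma polyfun_eq F G : (forall phi1 phi2, F phi1 phi2 = G phi1 phi2) ->
  polyfun G -> polyfun F.
Proof. by move=> FG [u uE]; exists u => phi1 phi2; rewrite FG uE. Qed.

Lemma polyfun_const c : polyfun (fun (_ : ldual E1) (_ : ldual E2) => c).
Proof.
exists (c *: tens_pure uone uone) => phi1 phi2.
by rewrite linearZZ [X in _ *: X]tens_dual_pure !sym_dual1 mulr1; exact/esym/mulr1.
Qed.

Lemma polyfun_coord1 e : polyfun (fun (phi1 : ldual E1) (_ : ldual E2) => phi1 e).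
Proof.
exists (tens_pure (sym_gen e) uone) => phi1 phi2.
by rewrite tens_dual_pure sym_dual_gen sym_dual1 mulr1.
Qed.

Lemma polyfun_coord2 e : polyfun (fun (_ : ldual E1) (phi2 : ldual E2) => phi2 e).
Proof.
exists (tens_pure uone (sym_gen e)) => phi1 phi2.
by rewrite tens_dual_pure sym_dual_gen sym_dual1 mul1r.
Qed.

Lemma polyfun_mul F G :
  polyfun F -> polyfun G -> polyfun (fun phi1 phi2 => F phi1 phi2 * G phi1 phi2).
Proof.
move=> [u uE] [v vE]; exists (u ** v) => phi1 phi2; rewrite uE vE.
exact/esym/(@tens_dualM (sym E1) (sym E2) (sym_lift _) (sym_lift _)).
Qed.

Lemma polyfun_sum (I : Type) (r : seq I) (F : I -> ldual E1 -> ldual E2 -> K) :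
  (forall i, polyfun (F i)) -> polyfun (fun phi1 phi2 => \sum_(i <- r) F i phi1 phi2).
Proof.
move=> pF; elim: r => [|i r [v vE]].
  by apply: polyfun_eq (polyfun_const 0) => phi1 phi2; rewrite big_nil.
have [u uE] := pF i; exists (u + v) => phi1 phi2.
by rewrite big_cons vE uE linearD.
Qed.

Lemma polyfun_prod (I : Type) (r : seq I) (F : I -> ldual E1 -> ldual E2 -> K) :
  (forall i, polyfun (F i)) -> polyfun (fun phi1 phi2 => \prod_(i <- r) F i phi1 phi2).
Proof.
move=> pF; elim: r => [|i r IH].
  by apply: polyfun_eq (polyfun_const 1) => phi1 phi2; rewrite big_nil.
by apply: polyfun_eq (polyfun_mul (pF i) IH) => phi1 phi2; rewrite big_cons.
Qed.

End TensorCharacters.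

Section PowDual.
Variables (K : fieldType) (d : nat).

Lemma pow_linear (A W : lmodType K) (f : 'I_d -> {linear A -> W}) :
  exists phi : {linear pow d A -> W}, forall k a, phi (pow_single k a) = f k a.
Proof.
have lin : linear (fun x : pow d A => \sum_k f k (x k)).
  move=> c x y; rewrite scaler_sumr -big_split; apply: eq_bigr => k _.
  by rewrite !ffunE linearP.
exists (linear_pack lin) => k a /=; rewrite (bigD1 k) //= ffunE eqxx big1 ?addr0 //.
by move=> k' /negPf kk'; rewrite ffunE kk' linear0.
Qed.

Lemma pow_free (A : nualgType K) Y (g : Y -> A) (W : lmodType K)
    (beta : 'I_d -> seq Y -> W) :
  free_on g -> exists phi : {linear pow d A -> W},
    forall k w, w <> [::] -> phi (pow_single k (word g w)) = beta k w.
Proof.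
move=> gP; have h k := free_on_linear (beta k) gP.
have [phi phiE] := pow_linear (fun k => projT1 (cid (h k))).
by exists phi => k w w0; rewrite phiE; exact: (projT2 (cid (h k))).
Qed.

Lemma pow_words_ext (A : nualgType K) Y (g : Y -> A) (W : lmodType K)
    (phi psi : {linear pow d A -> W}) :
  spanned_by_words g ->
  (forall k w, w <> [::] ->
     phi (pow_single k (word g w)) = psi (pow_single k (word g w))) -> phi =1 psi.
Proof.
move=> gP h; apply: pow_linear_ext => k; apply: gP => [|a x y hx hy|w w0].
- by rewrite pow_single0 !linear0.
- by rewrite pow_single_linear !linearP hx hy.
- exact: h.
Qed.

End PowDual.

Section LastOccurrences.
Variable T : eqType.

Fixpoint last_occ (s : seq T) : seq bool :=
  if s is a :: s' then (a \notin s') :: last_occ s' else [::].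

Lemma size_last_occ s : size (last_occ s) = size s.
Proof. by elim: s => //= a s ->. Qed.

(** A letter occurring twice would carry the flag false at its earlier occurrence and true at its
    last one, which is impossible when the flag is a function of the letter. *)
Lemma map_last_occ (c : T -> bool) s : map c s = last_occ s -> uniq s && all c s.
Proof.
elim: s => //= a s IH [ca] /IH /andP [us cs]; rewrite us cs !andbT ca andbb.
by apply/negP => a_s; have := allP cs a a_s; rewrite ca a_s.
Qed.

End LastOccurrences.

(** * The value on a word of fixed pattern as a polynomial *)

Section Coefficients.
Variables (K : fieldType) (d m : nat) (P : uproduct K d m).
Hypothesis HP : uau_product P.
Variables (k : nat) (b : 'I_k -> bool) (l : 'I_k -> 'I_m).
Hypothesis k_gt0 : (0 < k)%N.

Local Notation fV Z := {ffun Z -> K^o}.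
Local Notation D Z := (algp_talg m (fV Z)).
Let base (Z : finType) (x : Z) : fV Z := [ffun y => (x == y)%:R].
Let g (Z : finType) (y : 'I_m * Z) : D Z := letter (@base Z) y.
Let g2 (Z : finType) (y : bool * ('I_m * Z)) : fprod2 (D Z) (D Z) :=
  letter2 (@base Z) y.
Let slots (Z : finType) (z : 'I_k -> Z) := [seq (b i, (l i, z i)) | i <- enum 'I_k].
Let Fval (Z : finType) (phi1 phi2 : ldual (pow d (D Z))) r (z : 'I_k -> Z) : K :=
  P phi1 phi2 (pow_single r (word (@g2 Z) (slots z))).

Let enum_neq0 : enum 'I_k <> [::].
Proof. by move=> e0; move: k_gt0; rewrite -(size_enum_ord k) e0. Qed.

Let g_free (Z : finType) : free_on (@g Z).
Proof. exact: letter_free (free_basis_ffun _ _). Qed.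

Let Fval_linear (A1 A2 : algp K m) (phi1 : ldual (pow d A1)) (phi2 : ldual (pow d A2)) r :
  linear (fun x : fprod2 A1 A2 => P phi1 phi2 (pow_single r x : pow d (algp_prod A1 A2)) : K^o).
Proof. by move=> c x y; rewrite pow_single_linear linearP. Qed.

(** The only handle on the dependence on the functionals: rescaling letters inside the functionals
    rescales the word, and the product is linear in the word. *)
Let Fval_scale (Z Z' : finType) (j1 j2 : nuhom (D Z) (D Z')) (z : 'I_k -> Z)
    (z' : 'I_k -> Z') (c : 'I_k -> K) phi1 phi2 r :
  algp_hom j1 -> algp_hom j2 ->
  (forall i, (if b i then j2 else j1) (g (l i, z i)) = c i *: g (l i, z' i)) ->
  Fval (pow_pullback phi1 j1) (pow_pullback phi2 j2) r z =
  (\prod_i c i) * Fval phi1 phi2 r z'.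
Proof.
move=> h1 h2 hc; rewrite /Fval (universalE HP) // pow_map_single nuhom_word.
have -> : word (fprod2_map j1 j2 \o @g2 Z) (slots z) =
    (\prod_i c i) *: word (@g2 Z') (slots z').
  rewrite -big_enum -[RHS]/(_ *: nuprod (map _ (map _ _))).
  rewrite -map_comp -[nuprod _]/(word (@g2 Z' \o (fun i => (b i, (l i, z' i)))) _).
  rewrite -word_scale // /word -map_comp; congr nuprod; apply: eq_map => i.
  rewrite /= /g2 /letter2 /=; case: (b i) (hc i) => hci.
    by rewrite [LHS]fprod2_map2 [X in iota2 _ _ X]hci linearZZ.
  by rewrite [LHS]fprod2_map1 [X in iota1 _ _ X]hci linearZZ.
by rewrite (scalable_linear (Fval_linear phi1 phi2 r)).
Qed.

(** A label consists of a flag, a component and a word of length at most k. Finitely many labels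
    suffice, because a fitted word has distinct variables and hence at most k letters. *)
Let label : finType := (bool * ('I_d * k.-bseq ('I_m * 'I_k)))%type.
Let lab (r : 'I_d) (v : seq ('I_m * 'I_k)) : seq label :=
  [seq (c, (r, insub_bseq k v)) | c <- last_occ (map snd v)].
Let fits (s : 'I_k -> label) r v := map (s \o snd) v == lab r v.

Let size_lab r v : size (lab r v) = size v.
Proof. by rewrite size_map size_last_occ size_map. Qed.

(* The label of a letter names its word and, within a word, marks the last
   occurrence of the letter; hence a labelling [s] of the letters that fits [v]
   forces the letters of [v] to be distinct, and different words fitted by [s]
   have no letter in common. *)
Let fitsP (s : 'I_k -> label) r v : fits s r v ->
  [/\ uniq (map snd v), insub_bseq k v = v :> seq _ &
      forall y, y \in v -> s y.2 = (true, (r, insub_bseq k v))].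
Proof.
move=> /eqP e.
have e1 : map (fst \o s) (map snd v) = last_occ (map snd v).
  have := congr1 (map fst) e; rewrite /lab -!map_comp => e'.
  by apply: etrans e' _; exact: map_id.
have /andP [uv /allP av] := map_last_occ e1; split=> //.
  have sz : (size v <= k)%N.
    by have := max_card (mem (map snd v)); rewrite (card_uniqP uv) size_map card_ord.
  by rewrite /insub_bseq /insubd insubT.
move=> y yv; have := av _ (map_f snd yv); rewrite /=.
have : s y.2 \in lab r v by rewrite -(eqP (introT eqP e)); exact: (map_f (s \o snd)).
by move=> /mapP [c _ ->] /= ->.
Qed.

Let split_hom : exists J : nuhom (D 'I_k) (D ('I_k * label)%type),
  (forall y, J (g y) = \sum_(s : label) g (y.1, (y.2, s))) /\ algp_hom J.
Proof.
apply: (letter_algp_hom (free_basis_ffun _ _)) => y.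
have [S0 SL] := subalg_subspace (algp_sub (D ('I_k * label)%type) y.1).
elim/big_rec: _ => // s x _ Sx; rewrite -[X in X + _]scale1r; apply: SL => //.
exact: (letter_in_sub _ (y.1, _)).
Qed.

Let choice_hom (s : 'I_k -> label) : exists h : nuhom (D 'I_k) (D ('I_k * label)%type),
  (forall y, h (g y) = g (y.1, (y.2, s y.2))) /\ algp_hom h.
Proof.
by apply: (letter_algp_hom (free_basis_ffun _ _)) => y; exact: (letter_in_sub _ (y.1, _)).
Qed.

Let scale_hom (c : 'I_k -> K) : exists h : nuhom (D 'I_k) (D 'I_k),
  (forall y, h (g y) = c y.2 *: g y) /\ algp_hom h.
Proof.
apply: (letter_algp_hom (free_basis_ffun _ _)) => y.
have [S0 SL] := subalg_subspace (algp_sub (D 'I_k) y.1).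
by rewrite -[X in algp_sub _ _ X]addr0; apply: SL => //; exact: (letter_in_sub _ y).
Qed.

(** This functional depends on [s] but on no given [beta]; the values of the product at such
    indicators are the universal coefficients. *)
Let indicator (s : 'I_k -> label) : exists delta : ldual (pow d (D 'I_k)),
  forall r v, v <> [::] -> delta (pow_single r (word (@g _) v)) = (fits s r v)%:R.
Proof. exact: (pow_free (W := K^o)). Qed.

(** The label of variable i names the only word fitted by [s] that can contain it. The whole value
    of [beta] on that word is charged to its first letter, and the other letters get 1; as fitted
    words share no letter, one family of scalars serves all of them at once. *)
Let weight (beta : ldual (pow d (D 'I_k))) (s : 'I_k -> label) (i : 'I_k) : K :=
  let: (_, (r, v)) := s i in
  if fits s r v && (ohead (map snd v) == Some i) then beta (pow_single r (word (@g _) v))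
  else 1.

Let prod_weight beta s r v : v <> [::] -> fits s r v ->
  \prod_(y <- v) weight beta s y.2 = beta (pow_single r (word (@g _) v)).
Proof.
move=> v0 fv; have [uv bv sv] := fitsP fv.
rewrite (eq_big_seq (fun y : 'I_m * 'I_k => if ohead (map snd v) == Some y.2 then
    beta (pow_single r (word (@g _) v)) else 1)); last first.
  by move=> y yv; rewrite /weight sv // bv fv.
case: v v0 uv {fv bv sv} => [/(_ erefl)//|y v] _ /= /andP [yv _].
rewrite big_cons eqxx big1_seq ?mulr1 // => z /= zv.
by case: eqP => // -[yz]; rewrite yz (map_f snd zv) in yv.
Qed.

(** [Phi] accepts a labelled word only when its labels are the prescribed ones [lab r v] of the
    underlying word v; this makes every word of labelled letters detectable. *)
Let lifts (beta : ldual (pow d (D 'I_k))) (Phi : ldual (pow d (D ('I_k * label)%type))) :=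
  forall r u, u <> [::] ->
    Phi (pow_single r (word (@g _) u)) =
    let v := [seq (y.1, y.2.1) | y <- u] in
    if [seq y.2.2 | y <- u] == lab r v then beta (pow_single r (word (@g _) v)) else 0.

Let lifted beta : exists Phi, lifts beta Phi.
Proof. exact: (pow_free (W := K^o)). Qed.

(** Replacing each letter by the sum of its labelled copies expands a word over all labellings, of
    which [Phi] accepts exactly one. *)
Let lifted_split beta Phi (J : nuhom (D 'I_k) (D ('I_k * label)%type)) :
  lifts beta Phi ->
  (forall y, J (g y) = \sum_(s : label) g (y.1, (y.2, s))) ->
  pow_pullback Phi J = beta.
Proof.
move=> PhiE JE; apply: linear_ext; apply: (pow_words_ext (g_free _).1) => r v v0.
rewrite -[LHS]/(Phi (pow_map d J _)) pow_map_single nuhom_word.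
rewrite (eq_word (h := fun y => \sum_(s : label) g (y.1, (y.2, s)))); last exact: JE.
rewrite (word_sum (fun p => g (p.1.1, (p.1.2, p.2)))) //.
have lin : linear (fun x => Phi (pow_single r x)).
  by move=> c x y; rewrite pow_single_linear linearP.
rewrite -[LHS]/(linear_pack lin _) linear_sum /=.
have valE t : size t = size v ->
    Phi (pow_single r (word (fun p => g (p.1.1, (p.1.2, p.2))) (zip v t))) =
    if t == lab r v then beta (pow_single r (word (@g _) v)) else 0.
  move=> tv; pose f (p : 'I_m * 'I_k * label) := (p.1.1, (p.1.2, p.2)).
  rewrite -[word _ _]/(nuprod (map (@g _ \o f) _)) map_comp PhiE; last first.
    by case: (v) v0 (t) tv => [/(_ erefl)|? ?] // _ [].
  rewrite /= -!map_comp.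
  have -> : [seq ((fun y => (y.1, y.2.1)) \o f) i | i <- zip v t] = v.
    by rewrite -[RHS](unzip1_zip (eq_leq (esym tv))); apply: eq_map => -[[]].
  have -> // : [seq ((fun y => y.2.2) \o f) i | i <- zip v t] = t.
  by rewrite -[RHS](unzip2_zip (eq_leq tv)).
have lab_in : lab r v \in words label (size v) by rewrite mem_words size_lab.
rewrite (bigD1_seq (lab r v)) ?words_uniq //= valE ?size_lab // eqxx.
rewrite big1_seq ?addr0 // => t /andP [/negPf tl]; rewrite mem_words => /eqP tv.
by rewrite valE // tl.
Qed.

(** After labelling by [s], [Phi] returns [beta] on the fitted words and 0 elsewhere. By
    [prod_weight] this is the indicator of [s] with its letters rescaled by the weights. *)
Let lifted_choice beta Phi s (delta : ldual (pow d (D 'I_k))) (h : nuhom (D 'I_k) (D ('I_k * label)%type))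
    (sc : nuhom (D 'I_k) (D 'I_k)) :
  lifts beta Phi -> (forall y, h (g y) = g (y.1, (y.2, s y.2))) ->
  (forall r v, v <> [::] -> delta (pow_single r (word (@g _) v)) = (fits s r v)%:R) ->
  (forall y, sc (g y) = weight beta s y.2 *: g y) ->
  pow_pullback Phi h = pow_pullback delta sc.
Proof.
move=> PhiE hE deltaE scE; apply: linear_ext.
apply: (pow_words_ext (g_free _).1) => r v v0.
rewrite -[LHS]/(Phi (pow_map d h _)) -[RHS]/(delta (pow_map d sc _)).
rewrite !pow_map_single !nuhom_word.
rewrite [in RHS](eq_word (h := fun y => weight beta s y.2 *: g y)); last exact: scE.
have lin : linear (fun x => delta (pow_single r x)).
  by move=> c x y; rewrite pow_single_linear linearP.
rewrite word_scale // (scalable_linear lin) deltaE //.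
rewrite (eq_word (h := @g _ \o fun y => (y.1, (y.2, s y.2)))); last exact: hE.
rewrite /word map_comp PhiE; last by case: (v) v0.
rewrite /= -!map_comp.
have -> : [seq ((fun y => (y.1, y.2.1)) \o (fun y => (y.1, (y.2, s y.2)))) i | i <- v] = v.
  by rewrite -[RHS]map_id; apply: eq_map => -[].
rewrite -[_ == _]/(fits s r v); case: ifP => fv; last by rewrite -[RHS]/(_ * _) mulr0.
by rewrite (prod_weight beta v0 fv); exact/esym/mulr1.
Qed.

(** Write each functional as a lift pulled back along the splitting. Universality moves the
    splitting into the word, which becomes a sum over labellings; for each labelling the lifts may
    be replaced by rescaled indicators, and the scalars come out since every variable occurs once in
    the word. *)
Let Fval_expand r : exists C : seq label -> K, forall beta1 beta2 : ldual (pow d (D 'I_k)),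
  Fval beta1 beta2 r id = \sum_(t <- words label k)
    (\prod_i weight (if b i then beta2 else beta1) (nth (true, (r, [bseq])) t) i) * C t.
Proof.
have hdelta s := cid (indicator s).
exists (fun t => let s := nth (true, (r, [bseq])) t in
  Fval (projT1 (hdelta s)) (projT1 (hdelta s)) r id) => beta1 beta2.
have [Phi1 Phi1E] := lifted beta1; have [Phi2 Phi2E] := lifted beta2.
have [J [JE hJ]] := split_hom.
rewrite -{1}(lifted_split Phi1E JE) -{1}(lifted_split Phi2E JE).
rewrite /Fval (universalE HP) // pow_map_single nuhom_word.
pose z (t : seq label) (i : 'I_k) : 'I_k * label := (i, nth (true, (r, [bseq])) t i).
have -> : word (fprod2_map J J \o @g2 _) (slots id) =
    \sum_(t <- words label k) word (@g2 _) (slots (z t)).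
  rewrite [LHS]/word -map_comp.
  pose G (p : 'I_k * label) := @g2 ('I_k * label)%type (b p.1, (l p.1, p)).
  have -> : [seq ((fprod2_map J J \o @g2 _) \o (fun i => (b i, (l i, i)))) i | i <- enum 'I_k]
      = [seq \sum_(s : label) G (i, s) | i <- enum 'I_k].
    apply: eq_map => i; rewrite /= /G /g2 /letter2 /=; case: (b i).
      by rewrite [LHS]fprod2_map2 [X in iota2 _ _ X]JE linear_sum.
    by rewrite [LHS]fprod2_map1 [X in iota1 _ _ X]JE linear_sum.
  rewrite -[LHS]/(word (fun i => \sum_(s : label) G (i, s)) _) word_sum // size_enum_ord.
  apply: eq_big_seq => t; rewrite mem_words => /eqP tk.
  rewrite /word /slots -map_comp; congr nuprod.
  have tE : t = [seq nth (true, (r, [bseq])) t (val i) | i <- enum 'I_k].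
    rewrite -[LHS](mkseq_nth (true, (r, [bseq]))) tk /mkseq -val_enum_ord -map_comp.
    exact: eq_map.
  rewrite {1}tE -{1}[enum 'I_k]map_id zip_map -map_comp; exact: eq_map.
rewrite -[LHS]/(linear_pack (Fval_linear Phi1 Phi2 r) _) linear_sum.
apply: eq_bigr => t _; rewrite -[LHS]/(Fval Phi1 Phi2 r (z t)).
set s := nth (true, (r, [bseq])) t.
have [h [hE hh]] := choice_hom s.
have [sc1 [sc1E hsc1]] := scale_hom (weight beta1 s).
have [sc2 [sc2E hsc2]] := scale_hom (weight beta2 s).
have <- : Fval (pow_pullback Phi1 h) (pow_pullback Phi2 h) r id = Fval Phi1 Phi2 r (z t).
  rewrite (Fval_scale (z' := z t) (c := fun=> 1)) // ?big1 ?mul1r // => i.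
  by rewrite if_same hE scale1r.
case: (hdelta s) => delta /= deltaE.
rewrite (lifted_choice Phi1E hE deltaE sc1E) (lifted_choice Phi2E hE deltaE sc2E).
rewrite (Fval_scale (z' := id)
  (c := fun i => weight (if b i then beta2 else beta1) s i)) // => i.
by case: (b i); rewrite ?sc1E ?sc2E.
Qed.

Lemma coefficients (V : lmodType K) (e : 'I_k -> V) r :
  polyfun (fun phi1 phi2 : ldual (pow d (algp_talg m V)) =>
    P phi1 phi2 (pow_single r (word (letter2 e) [seq (b i, (l i, i)) | i <- enum 'I_k]))).
Proof.
have [j [jE hj]] := letter_algp_hom (A := algp_talg m V) (f := letter e)
  (free_basis_ffun K 'I_k) (@letter_in_sub _ _ _ _ e).
have [C CE] := Fval_expand r.
apply: (polyfun_eq (G := fun phi1 phi2 => Fval (pow_pullback phi1 j)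
    (pow_pullback phi2 j) r id)) => [phi1 phi2|].
  rewrite /Fval (universalE HP) // pow_map_single nuhom_word.
  congr (P _ _ (pow_single r _)); rewrite /word /slots -!map_comp; congr nuprod.
  apply: eq_map => i; rewrite /= /g2 /letter2 /=; case: (b i).
    by rewrite [RHS]fprod2_map2 [X in _ = iota2 _ _ X]jE.
  by rewrite [RHS]fprod2_map1 [X in _ = iota1 _ _ X]jE.
apply: polyfun_eq (fun phi1 phi2 => CE (pow_pullback phi1 j) (pow_pullback phi2 j)) _.
apply: polyfun_sum => t; apply: polyfun_mul; last exact: polyfun_const.
apply: polyfun_prod => i; rewrite /weight.
(* The condition [c] involves the labelling only, so a weight is either a coordinate of one
   functional or the constant 1. *)
case: (nth _ t i) => _ [r' v]; set c := _ && _.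
case: c; last exact: polyfun_const.
case: (b i); first exact: (polyfun_coord2 _ (pow_map d j _)).
exact: (polyfun_coord1 _ (pow_map d j _)).
Qed.

End Coefficients.

Section Sigma.
Variables (K : fieldType) (d m : nat) (P : uproduct K d m).
Hypothesis HP : uau_product P.
Variables (V : lmodType K) (X : Type) (e : X -> V).
Hypothesis eP : free_basis e.
Local Notation D := (algp_talg m V).

Lemma word_coefficients r (w : seq (bool * ('I_m * X))) :
  polyfun (fun phi1 phi2 : ldual (pow d D) =>
    P phi1 phi2 (pow_single r (word (letter2 e) w))).
Proof.
case: w => [|y w].
  apply: polyfun_eq (polyfun_const _ _ 0) => phi1 phi2.
  by rewrite -[word _ _]/0 pow_single0 linear0.
pose y_ i := tnth (in_tuple (y :: w)) i.
(* Repeated letters are allowed: each position gets its own variable, and the map to V need not be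
   injective. *)
apply: polyfun_eq (coefficients HP (fun i => (y_ i).1) (fun i => (y_ i).2.1)
  isT (fun i => e (y_ i).2.2) r) => phi1 phi2.
congr (P _ _ (pow_single r _)).
have wE : y :: w = [seq y_ i | i <- enum 'I_(size (y :: w))].
  by rewrite -[LHS]/(tval (in_tuple (y :: w))) -[LHS]map_tnth_enum.
rewrite {1}wE /word -!map_comp; congr nuprod; exact: eq_map.
Qed.

(** A representing tensor is chosen for each word and extended linearly, which is possible because
    the words are free in D |_| D. So [sigma] does not take its junk value. *)
Lemma sigma_exists : exists s, is_sigma P (A1 := D) (A2 := D) s.
Proof.
have U r w := cid (word_coefficients r w).
have [s sE] := pow_free (fun r w => projT1 (U r w)) (letter2_free m eP).
exists s => phi1 phi2.
apply: (@pow_words_ext K d _ _ (letter2 e) K^o _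
  (tens_dual (sym_dual phi1) (sym_dual phi2) \o s)) => [|r w w0].
  by have [] := letter2_free m eP.
by rewrite /= sE //; case: (U r w).
Qed.

Lemma sigmaP phi1 phi2 x :
  P phi1 phi2 x = tens_dual (sym_dual phi1) (sym_dual phi2) (sigma P D D x).
Proof.
rewrite /sigma; case: pselect => [h|/(_ sigma_exists) //].
exact: (projT2 (cid h)).
Qed.

End Sigma.

(** * Characters separate the points of a symmetric algebra *)

Section PolyNat.
Variable K : fieldType.
Hypothesis K_char0 : [pchar K] =i pred0.

Lemma natr_inj : injective (fun n : nat => n%:R : K).
Proof.
have nat0 n : (n%:R == 0 :> K) = (n == 0%N) by exact: (iffLR (pcharf0P K)).
have le n p : (n <= p)%N -> n%:R = p%:R :> K -> n = p.
  move=> np /eqP; rewrite eq_sym -subr_eq0 -natrB // nat0 subn_eq0 => pn.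
  by apply/eqP; rewrite eqn_leq np.
by move=> n p; case: (leqP n p) => [/le//|/ltnW /le h /esym /h].
Qed.

Lemma poly_nat_eq0 (p : {poly K}) : (forall n : nat, p.[n%:R] = 0) -> p = 0.
Proof.
move=> p0; apply/eqP; apply: contraT => pn0.
have := max_poly_roots (rs := [seq n%:R | n <- iota 0 (size p)]) pn0.
rewrite size_map size_iota ltnn => -> //; last first.
  by rewrite map_inj_uniq ?iota_uniq //; exact: natr_inj.
by apply/allP => x /mapP [n _ ->]; apply/rootP.
Qed.

Lemma poly_nat_inj (p q : {poly K}) : (forall n : nat, p.[n%:R] = q.[n%:R]) -> p = q.
Proof.
move=> pq; apply/eqP; rewrite -subr_eq0; apply/eqP/poly_nat_eq0 => n.
by rewrite hornerD hornerN pq subrr.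
Qed.

End PolyNat.

Section SymRing.
Variables (K : fieldType) (W : lmodType K).

(** Nontriviality, seen by the counit, makes S(W) a ring in the sense of the library, so that
    polynomials with coefficients in S(W) can be formed. *)
Fact sym_one_neq0 : (uone : sym W) != 0.
Proof.
apply/eqP => e; have := congr1 (sym_counit W) e.
by rewrite linear0 /sym_counit sym_dual1 => /eqP; rewrite oner_eq0.
Qed.

HB.instance Definition _ := GRing.Zmodule_isComNzRing.Build (sym W)
  (@numulA K (sym W)) (@numulC K (sym W)) (@umul1 K (sym W)) (@numulDl K (sym W))
  sym_one_neq0.
HB.instance Definition _ := GRing.Lmodule_isLalgebra.Build K (sym W)
  (fun a x y => esym (numulZl a x y)).

Lemma sym_dualX (phi : ldual W) (x : sym W) k :
  sym_dual phi (x ^+ k) = (sym_dual phi x) ^+ k.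
Proof.
elim: k => [|k IH]; first by rewrite !expr0; exact: sym_dual1.
by rewrite !exprS -IH; exact: sym_dualM.
Qed.

Lemma sym_dual_const (phi : ldual W) (c : K) : sym_dual phi (c *: 1) = c.
Proof. by rewrite linearZZ [sym_dual phi _]sym_dual1; exact: mulr1. Qed.

Lemma sym_dual_horner (phi : ldual W) (p : {poly sym W}) (x : sym W) :
  sym_dual phi p.[x] = \sum_(k < size p) sym_dual phi p`_k * sym_dual phi x ^+ k.
Proof.
rewrite horner_coef linear_sum; apply: eq_bigr => k _.
by rewrite -sym_dualX; exact: sym_dualM.
Qed.

Lemma sym_scaleE (a : K) (x : sym W) : a *: x = (a *: 1) * x.
Proof. by rewrite [RHS](numulZl a (uone : sym W)) umul1. Qed.

Lemma sym_ind (Q : sym W -> Prop) :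
  Q 1 -> (forall w, Q (sym_gen w)) ->
  (forall a x y, Q x -> Q y -> Q (a *: x + y)) ->
  (forall x y, Q x -> Q y -> Q (x * y)) -> forall x, Q x.
Proof.
move=> Q1 Qg QL QM; apply: pres_ind => //; first by case.
by rewrite -(addNr (1 : sym W)) -scaleN1r; exact: QL.
Qed.

End SymRing.

Section Separation.
Variables (K : fieldType) (W : lmodType K) (I : eqType) (g : I -> W).
Hypothesis K_char0 : [pchar K] =i pred0.
Hypothesis g_span : forall S : W -> Prop, S 0 ->
  (forall a x y, S x -> S y -> S (a *: x + y)) -> (forall i, S (g i)) -> forall w, S w.
Hypothesis g_dual : forall beta : I -> K, exists phi : ldual W, forall i, phi (g i) = beta i.

(** An iterated polynomial in the generators [g i] with i in [L]. This gives elements of S(W) a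
    polynomial form without first proving that S(W) is a polynomial ring. *)
Fixpoint poly_in (L : seq I) (u : sym W) : Prop :=
  if L is i :: L' then
    exists p : {poly sym W}, (forall k, poly_in L' p`_k) /\ u = p.[sym_gen (g i)]
  else exists c : K, u = c *: 1.

Lemma poly_in_closed L :
  [/\ forall c : K, poly_in L (c *: 1),
      forall x y, poly_in L x -> poly_in L y -> poly_in L (x + y) &
      forall x y, poly_in L x -> poly_in L y -> poly_in L (x * y)].
Proof.
elim: L => [|i L [LC LD LM]] /=.
  split=> [c|_ _ [c ->] [c' ->]|_ _ [c ->] [c' ->]].
  - by exists c.
  - by exists (c + c'); rewrite scalerDl.
  - by exists (c * c'); rewrite -sym_scaleE scalerA.
have L0 : poly_in L 0 by rewrite -(scale0r 1).
split=> [c|_ _ [p [hp ->]] [q [hq ->]]|_ _ [p [hp ->]] [q [hq ->]]].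
- exists (c *: 1)%:P; split=> [k|]; last by rewrite hornerC.
  by rewrite coefC; case: ifP.
- exists (p + q); split=> [k|]; last by rewrite hornerD.
  by rewrite coefD; exact: LD.
- exists (p * q); split=> [k|]; last by rewrite hornerM.
  by rewrite coefM; elim/big_ind: _ => // j _; exact: LM.
Qed.

Lemma poly_in_gen L i : i \in L -> poly_in L (sym_gen (g i)).
Proof.
elim: L => [//|j L IH]; rewrite inE => /orP [/eqP <-|/IH iL] /=; last first.
  exists (sym_gen (g i))%:P; split=> [k|]; last by rewrite hornerC.
  by rewrite coefC; case: ifP => // _; rewrite -(scale0r 1); have [] := poly_in_closed L.
have [LC _ _] := poly_in_closed L.
exists 'X; split=> [k|]; last by rewrite hornerX.
by rewrite coefX -scaler_nat; exact: LC.
Qed.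

Lemma poly_in_sub L L' u : {subset L <= L'} -> poly_in L u -> poly_in L' u.
Proof.
have [LC LD LM] := poly_in_closed L'.
elim: L u => [|i L IH] u sub /=; first by case=> c ->.
case=> p [hp ->]; rewrite horner_coef.
elim/big_ind: _ => // [|k _]; first by rewrite -(scale0r 1).
have subL : {subset L <= L'} by move=> j jL; apply: sub; rewrite inE jL orbT.
apply: (LM); first exact: IH.
elim: (val k) => [|k' IHk]; first by rewrite expr0 -(scale1r 1).
by rewrite exprS; apply: (LM) => //; apply: poly_in_gen; apply: sub; rewrite inE eqxx.
Qed.

Lemma poly_in_exists u : exists L, uniq L /\ poly_in L u.
Proof.
suff [L uL] : exists L, poly_in L u.
  exists (undup L); split; first exact: undup_uniq.
  by apply: poly_in_sub uL => i; rewrite mem_undup.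
have lin a x y : (exists L, poly_in L x) -> (exists L, poly_in L y) ->
    exists L, poly_in L (a *: x + y).
  move=> [L xL] [L' yL]; exists (L ++ L').
  have [LC LD LM] := poly_in_closed (L ++ L').
  apply: (LD); last by apply: poly_in_sub yL => i; rewrite mem_cat orbC => ->.
  rewrite sym_scaleE; apply: (LM) => //.
  by apply: poly_in_sub xL => i; rewrite mem_cat => ->.
move: u; apply: sym_ind => [|w||x y [L xL] [L' yL]].
- by exists [::], 1; rewrite scale1r.
- apply: (g_span (S := fun w => exists L, poly_in L (sym_gen w))) => [|a x y|i].
  + by rewrite linear0; exists [::], 0; rewrite scale0r.
  + by rewrite linearP; exact: lin.
  + by exists [:: i]; apply: poly_in_gen; rewrite inE.
- exact: lin.
exists (L ++ L'); have [LC LD LM] := poly_in_closed (L ++ L').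
apply: LM; first by apply: poly_in_sub xL => i; rewrite mem_cat => ->.
by apply: poly_in_sub yL => i; rewrite mem_cat orbC => ->.
Qed.

Lemma poly_in_dual L (phi psi : ldual W) u :
  {in L, forall i, phi (g i) = psi (g i)} -> poly_in L u ->
  sym_dual phi u = sym_dual psi u.
Proof.
elim: L u => [|i L IH] u eL; first by case=> c ->; rewrite !sym_dual_const.
case=> p [hp ->]; rewrite !sym_dual_horner; apply: eq_bigr => k _.
rewrite !sym_dual_gen eL ?inE ?eqxx // (IH p`_k) => // [j jL|].
  by apply: eL; rewrite inE jL orbT.
exact: hp.
Qed.

(** Induction on the generators involved: letting phi run through the naturals at [g i] turns u into
    a one-variable polynomial with infinitely many zeros, so all characters kill its coefficients,
    which involve fewer generators. *)
Lemma sym_separated u : (forall phi : ldual W, sym_dual phi u = 0) -> u = 0.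
Proof.
have [L [uniqL uL]] := poly_in_exists u.
elim: L uniqL u uL => [|i L IH] uniqL u.
  by case=> c -> /(_ \0); rewrite sym_dual_const => ->; rewrite scale0r.
case/andP: uniqL => iL uniqL [p [hp ->]] p0.
suff -> : p = 0 by rewrite horner0.
apply/polyP => k; rewrite coef0; apply: IH; [exact: uniqL|exact: hp|move=> phi].
have [kp|] := ltnP k (size p); last by move=> /(nth_default 0) ->; exact: linear0.
pose q := \poly_(j < size p) sym_dual phi p`_j.
suff q0 : q = 0 by have := coef_poly (size p) (fun j => sym_dual phi p`_j) k;
  rewrite kp -/q q0 coef0.
apply: (poly_nat_eq0 K_char0) => n.
(* [psi] differs from [phi] only at i, and i is not in [L], so the coefficients of [p] have the same
   values under both. *)
have [psi psiE] := g_dual (fun j => if j == i then n%:R else phi (g j)).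
rewrite -[RHS](p0 psi) sym_dual_horner horner_poly; apply: eq_bigr => j _.
rewrite sym_dual_gen psiE eqxx; congr (_ * _).
apply: (@poly_in_dual L); last exact: hp.
by move=> j' j'L; rewrite psiE; case: eqP j'L => // ->; rewrite (negPf iL).
Qed.

End Separation.

(** * The convolution algebra *)

Section ConvMonoid.
Variables (K : fieldType) (d m : nat) (P : uproduct K d m).
Hypothesis HP : uau_product P.
Variable V : lmodType K.
Local Notation D := (algp_talg m V).
Implicit Types phi psi : ldual (pow d D).

Lemma copies_delta_algp : algp_hom (A := algp_prod D D) (copies_delta m V : nuhom D _).
Proof.
apply: copies_hom_algp => l v; rewrite copies_delta_gen.
pose a := subalg_corestrict (talg_copy V l) (talg_gen v).
exists (iota1 _ _ a + iota2 _ _ a) => //; rewrite linearD.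
by rewrite [X in X + _]fprod2_map1 [X in _ + X]fprod2_map2.
Qed.

Lemma pow_pullbackE (A B : nualgType K) (phi : ldual (pow d A)) (j : nuhom B A) x :
  pow_pullback phi j x = phi (pow_map d j x).
Proof. by []. Qed.

(** Once the outer functionals are written as pullbacks along the identity, universality and
    associativity of the product leave the coassociativity of [copies_delta], which is checked on
    generators. *)
Lemma conv_assoc phi1 phi2 phi3 :
  conv P (conv P phi1 phi2) phi3 = conv P phi1 (conv P phi2 phi3).
Proof.
apply: linear_ext => x; rewrite [LHS]pow_pullbackE [RHS]pow_pullbackE.
set dx := pow_map d _ x.
rewrite -{1}[phi3](linear_ext (f := pow_pullback phi3 (nuhom_id D))); last first.
  by move=> y; rewrite pow_pullbackE pow_map_id.
rewrite -{2}[phi1](linear_ext (f := pow_pullback phi1 (nuhom_id D))); last first.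
  by move=> y; rewrite pow_pullbackE pow_map_id.
rewrite !(universalE HP) //; [|exact: copies_delta_algp|exact: copies_delta_algp].
rewrite -(uau_associative HP) pow_pullbackE.
rewrite -(pow_map_comp (h := nuhom_comp (fprod2_assoc D D D)
   (fprod2_map (nuhom_id D) (copies_delta m V)))) //.
rewrite /dx -!(pow_map_comp (h := nuhom_comp (nuhom_comp (fprod2_assoc D D D)
   (fprod2_map (nuhom_id D) (copies_delta m V))) (copies_delta m V))) //.
apply: (@talg_copies_ext _ _ _ _ (nuhom_comp (nuhom_comp (fprod2_assoc D D D)
   (fprod2_map (nuhom_id D) (copies_delta m V))) (copies_delta m V))
   (nuhom_comp (fprod2_map (copies_delta m V) (nuhom_id D)) (copies_delta m V))).
move=> l v; rewrite !nuhom_compE; set c := talg_copy V l (talg_gen v).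
have cE : copies_delta m V c = iota1 D D c + iota2 D D c := copies_delta_gen l v.
rewrite !cE !linearD.
have -> : fprod2_map (copies_delta m V) (nuhom_id D) (iota1 D D c) =
  iota1 (fprod2 D D) D (copies_delta m V c) := fprod2_map1 _ _ _.
have -> : fprod2_map (copies_delta m V) (nuhom_id D) (iota2 D D c) =
  iota2 (fprod2 D D) D c := fprod2_map2 _ _ _.
have -> : fprod2_map (nuhom_id D) (copies_delta m V) (iota1 D D c) =
  iota1 D (fprod2 D D) c := fprod2_map1 _ _ _.
have -> : fprod2_map (nuhom_id D) (copies_delta m V) (iota2 D D c) =
  iota2 D (fprod2 D D) (copies_delta m V c) := fprod2_map2 _ _ _.
have -> : fprod2_assoc D D D (iota1 D (fprod2 D D) c) =
  iota1 (fprod2 D D) D (iota1 D D c) := fprod2_lift1 _ _ _.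
rewrite !cE !linearD.
have aE y : fprod2_assoc D D D (iota2 D (fprod2 D D) y) =
  fprod2_lift (nuhom_comp (iota1 (fprod2 D D) D) (iota2 D D)) (iota2 (fprod2 D D) D) y
  := fprod2_lift2 _ _ _.
by rewrite !aE fprod2_lift1 fprod2_lift2 addrA.
Qed.

Fact nuhom_zeroM (A B : nualgType K) : {morph (\0 : {linear A -> B}) : x y / x ** y}.
Proof. by move=> x y /=; rewrite numul0l. Qed.
Definition nuhom_zero (A B : nualgType K) : nuhom A B := NuHom (@nuhom_zeroM A B).

Lemma nuhom_zero_algp (A B : algp K m) : algp_hom (nuhom_zero B A).
Proof. by move=> l b _; exact: (subalg_subspace _).1. Qed.

Lemma pow_pullback_id phi : pow_pullback phi (nuhom_id D) = phi.
Proof. by apply: linear_ext => x; rewrite pow_pullbackE pow_map_id. Qed.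

Lemma pow_pullback_zero phi : pow_pullback phi (nuhom_zero D D) = \0.
Proof.
apply: linear_ext => x; rewrite pow_pullbackE (_ : pow_map d _ x = 0) ?linear0 //.
Qed.

(** The functional 0 is a pullback along the zero homomorphism, so the unit law is the restriction
    axiom for the second factor. *)
Lemma conv0l phi : conv P \0 phi = phi.
Proof.
apply: linear_ext => x; rewrite -{1}(pow_pullback_zero phi) -{2}[phi]pow_pullback_id.
rewrite (conv_pullback HP phi phi x (h := iota2 D D) (@nuhom_zero_algp D D)
  (@algp_hom_id _ _ D)); last first.
  by move=> l v; rewrite [X in iota1 _ _ X]/= linear0 add0r.
by rewrite -pow_pullbackE uau_unital2.
Qed.

Lemma conv0r phi : conv P phi \0 = phi.
Proof.
apply: linear_ext => x; rewrite -{1}(pow_pullback_zero phi) -{1}[phi]pow_pullback_id.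
rewrite (conv_pullback HP phi phi x (h := iota1 D D) (@algp_hom_id _ _ D)
  (@nuhom_zero_algp D D)); last first.
  by move=> l v; rewrite [X in iota2 _ _ X]/= linear0 addr0.
by rewrite -pow_pullbackE uau_unital1.
Qed.

Section Dilation.
Variable t : K.
Let f (l : 'I_m) (v : V) : D := talg_copy V l (talg_gen (t *: v)).
Fact dilation_linear l : linear (f l).
Proof. by move=> a u v; rewrite /f scalerDr scalerA mulrC -scalerA !linearP. Qed.
(** Multiplies words of length k by t^k; the family of all dilations takes the place of the
    grading. *)
Definition dilation : nuhom D D :=
  @fprod_lift K 'I_m (fun _ => talg V) D
    (fun l => talg_lift (linear_pack (dilation_linear l))).
Lemma dilation_gen l v :
  dilation (talg_copy V l (talg_gen v)) = t *: talg_copy V l (talg_gen v).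
Proof. by rewrite [LHS]copies_homE /= /f !linearZZ. Qed.

Lemma dilation_algp : algp_hom dilation.
Proof.
apply: copies_hom_algp => l v; rewrite dilation_gen -!linearZZ.
by exists (talg_gen (t *: v)).
Qed.

Lemma conv_dilation phi psi :
  conv P (pow_pullback phi dilation) (pow_pullback psi dilation) =
  pow_pullback (conv P phi psi) dilation.
Proof.
apply: linear_ext => x.
rewrite (conv_pullback HP phi psi x (h := nuhom_comp (copies_delta m V) dilation)
  dilation_algp dilation_algp).
  by rewrite !pow_pullbackE; congr (P _ _ _); exact: pow_map_comp.
by move=> l v; rewrite nuhom_compE dilation_gen !linearZZ copies_delta_gen scalerDr.
Qed.

End Dilation.
End ConvMonoid.

(** All that the theory of logarithms uses: a comultiplication dual to a monoid law on E^*, enough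
    characters, and dilations that depend polynomially on t and respect the law. *)
Record conv_structure (K : fieldType) (E : lmodType K) := ConvStructure {
  comult : nuhom (sym E) (tens (sym E) (sym E));
  star : ldual E -> ldual E -> ldual E;
  dil : K -> {linear E -> E};
  comult_char : forall phi psi x,
    tens_dual (sym_dual phi) (sym_dual psi) (comult x) = sym_dual (star phi psi) x;
  starA : forall phi psi chi, star (star phi psi) chi = star phi (star psi chi);
  star0l : forall phi, star \0 phi = phi;
  star0r : forall phi, star phi \0 = phi;
  char_separated : forall u v : sym E,
    (forall phi : ldual E, sym_dual phi u = sym_dual phi v) -> u = v;
  star_dil : forall t phi psi,
    star (pullback phi (dil t)) (pullback psi (dil t)) = pullback (star phi psi) (dil t);
  dil0 : forall w, dil 0 w = 0;
  dil1 : forall w, dil 1 w = w;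
  dilM : forall s t w, dil s (dil t w) = dil (s * t) w;
  dil_poly : forall w, exists (N : nat) (p : nat -> E),
    forall t, dil t w = \sum_(k < N) t ^+ k *: p k
}.

Section ConvAlgebra.
Variables (K : fieldType) (E : lmodType K) (C : conv_structure E).
Implicit Types (phi psi : ldual E) (b : ldual (sym E)) (x y u : sym E).

(** The structure is a phantom argument, on which the ring instance below can depend. *)
Definition calg of conv_structure E := lmap (sym E) K^o.
Local Notation A := (calg C).
HB.instance Definition _ := GRing.Lmodule.on A.

Definition cmul (b1 b2 : lmap (sym E) K^o) : lmap (sym E) K^o :=
  pullback (tens_dual b1 b2) (comult C).

Lemma cmulE b1 b2 x : cmul b1 b2 x = tens_dual b1 b2 (comult C x).
Proof. by []. Qed.

(** Contraction of one leg of the comultiplication. It yields elements of S(E), which characters can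
    compare even when [b] is arbitrary. *)
Definition rcontract b x : sym E := \sum_(p <- tens_repr (comult C x)) b p.2 *: p.1.
Definition lcontract b x : sym E := \sum_(p <- tens_repr (comult C x)) b p.1 *: p.2.

Lemma cmul_rcontract b1 b2 x : cmul b1 b2 x = b1 (rcontract b2 x).
Proof.
rewrite cmulE tens_dualE linear_sum; apply: eq_bigr => p _.
by rewrite linearZZ mulrC.
Qed.

Lemma cmul_lcontract b1 b2 x : cmul b1 b2 x = b2 (lcontract b1 x).
Proof.
by rewrite cmulE tens_dualE linear_sum; apply: eq_bigr => p _; rewrite linearZZ.
Qed.

Lemma cmul_char phi psi : cmul (sym_dual phi) (sym_dual psi) = sym_dual (star C phi psi).
Proof. by apply: linear_ext => x; rewrite cmulE comult_char. Qed.

(** For three characters this is [starA]. Each step then frees one factor: an equality of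
    contractions is tested on characters and, once proved in S(E), may be evaluated at any
    functional. *)
Lemma cmulA : associative cmul.
Proof.
move=> b1 b2 b3; apply: linear_ext => x.
have assoc1 phi1 phi2 :
    lcontract (sym_dual phi2) (lcontract (sym_dual phi1) x) =
    lcontract (cmul (sym_dual phi1) (sym_dual phi2)) x.
  apply: (char_separated C) => phi3.
  by rewrite -!cmul_lcontract !cmul_char starA.
have assoc2 phi1 : rcontract b3 (lcontract (sym_dual phi1) x) =
    lcontract (sym_dual phi1) (rcontract b3 x).
  apply: (char_separated C) => phi2.
  rewrite -cmul_rcontract cmul_lcontract assoc1.
  by rewrite -!cmul_lcontract cmul_rcontract.
have assoc3 : rcontract (cmul b2 b3) x = rcontract b2 (rcontract b3 x).
  apply: (char_separated C) => phi1.
  rewrite -[LHS]cmul_rcontract [LHS]cmul_lcontract [LHS]cmul_rcontract assoc2.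
  by rewrite -[RHS]cmul_rcontract [RHS]cmul_lcontract.
by rewrite cmul_rcontract assoc3 -!cmul_rcontract.
Qed.

Lemma cmul1l : left_id (sym_counit E) cmul.
Proof.
move=> b; apply: linear_ext => x; rewrite cmul_lcontract; congr (b _).
by apply: (char_separated C) => phi; rewrite -cmul_lcontract cmul_char star0l.
Qed.

Lemma cmul1r : right_id (sym_counit E) cmul.
Proof.
move=> b; apply: linear_ext => x; rewrite cmul_rcontract; congr (b _).
by apply: (char_separated C) => phi; rewrite -cmul_rcontract cmul_char star0r.
Qed.

Lemma cmulDl : left_distributive cmul +%R.
Proof. by move=> b1 b2 b3; apply: linear_ext => x; rewrite lmapDE !cmul_rcontract. Qed.
Lemma cmulDr : right_distributive cmul +%R.
Proof. by move=> b1 b2 b3; apply: linear_ext => x; rewrite lmapDE !cmul_lcontract. Qed.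

Fact counit_neq0 : (sym_counit E : A) != 0.
Proof.
apply/eqP => e; have := congr1 (fun f : A => f 1) e.
by rewrite lmap0E [LHS]sym_dual1 => /eqP; rewrite oner_eq0.
Qed.

Lemma cmulZl a b1 b2 : (a *: cmul b1 b2 : lmap (sym E) K^o) = cmul (a *: (b1 : lmap _ _)) b2.
Proof. by apply: linear_ext => x; rewrite lmapZE !cmul_rcontract. Qed.
Lemma cmulZr a b1 b2 : (a *: cmul b1 b2 : lmap (sym E) K^o) = cmul b1 (a *: (b2 : lmap _ _)).
Proof. by apply: linear_ext => x; rewrite lmapZE !cmul_lcontract. Qed.

HB.instance Definition _ := GRing.Zmodule_isNzRing.Build A
  cmulA cmul1l cmul1r cmulDl cmulDr counit_neq0.
HB.instance Definition _ := GRing.Lmodule_isLalgebra.Build K A cmulZl.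
HB.instance Definition _ := GRing.Lalgebra_isAlgebra.Build K A cmulZr.

End ConvAlgebra.

(** * The order filtration *)

Section Filtration.
Variables (K : fieldType) (E : lmodType K) (C : conv_structure E).
Hypothesis K_char0 : [pchar K] =i pred0.
Local Notation A := (calg C).
Implicit Types (phi psi : ldual E) (x y u : sym E) (b : A).

Lemma calg_mulE b1 b2 x :
  (b1 * b2) x = \sum_(p <- tens_repr (comult C x)) b1 p.1 * b2 p.2.
Proof. exact: tens_dualE. Qed.

Lemma calg_oneE x : (1 : A) x = sym_counit E x.
Proof. by []. Qed.

Lemma calg_one1 : (1 : A) 1 = 1.
Proof. exact: sym_dual1. Qed.

Definition sdil (t : K) : nuhom (sym E) (sym E) := sym_lift (@sym_gen K E \o dil C t).

Lemma sdil_gen t w : sdil t (sym_gen w) = sym_gen (dil C t w).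
Proof. exact: sym_lift_gen. Qed.
Lemma sdil_one t : sdil t 1 = 1.
Proof. exact: sym_lift1. Qed.
Lemma sdilM t x y : sdil t (x * y) = sdil t x * sdil t y.
Proof. exact: nuhomM. Qed.

Lemma scale_oneX (t : K) k : (t *: 1 : sym E) ^+ k = t ^+ k *: 1.
Proof.
elim: k => [|k IH]; first by rewrite !expr0 scale1r.
by rewrite !exprS IH -sym_scaleE scalerA.
Qed.

Lemma sym_dual_sdil phi t x :
  sym_dual phi (sdil t x) = sym_dual (pullback phi (dil C t)) x.
Proof.
elim/sym_ind: x => [|w|a x y hx hy|x y hx hy].
- by rewrite sdil_one [LHS]sym_dual1 [RHS]sym_dual1.
- by rewrite sdil_gen !sym_dual_gen.
- by rewrite !linearP hx hy.
- by rewrite sdilM [LHS]sym_dualM [RHS]sym_dualM hx hy.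
Qed.

(** Comultiplication commutes with dilations; the two factors pass from characters to arbitrary
    functionals as in [cmulA]. *)
Lemma cmul_sdil b1 b2 t x :
  cmul C b1 b2 (sdil t x) = cmul C (pullback b1 (sdil t)) (pullback b2 (sdil t)) x.
Proof.
have dilE phi : pullback (sym_dual phi) (sdil t) = sym_dual (pullback phi (dil C t)).
  by apply: linear_ext => y; rewrite -sym_dual_sdil.
have step1 phi : lcontract C (sym_dual phi) (sdil t x) =
    sdil t (lcontract C (pullback (sym_dual phi) (sdil t)) x).
  apply: (char_separated C) => psi; rewrite -cmul_lcontract cmul_char [LHS]sym_dual_sdil.
  by rewrite -(star_dil C) -cmul_char cmul_lcontract -!dilE.
have step2 : rcontract C b2 (sdil t x) =
    sdil t (rcontract C (pullback b2 (sdil t)) x).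
  apply: (char_separated C) => phi.
  rewrite -cmul_rcontract cmul_lcontract step1.
  by rewrite -[LHS]/(pullback b2 (sdil t) _) -cmul_lcontract cmul_rcontract.
by rewrite !cmul_rcontract step2.
Qed.

Definition deg_lt (N : nat) x : Prop :=
  exists q : {poly sym E}, (size q <= N)%N /\ forall t : K, sdil t x = q.[t *: 1].

Definition ordge (k : nat) b : Prop :=
  forall x, exists r : {poly K}, forall t, b (sdil t x) = (r * 'X^k).[t].

Lemma deg_lt_leq N M x : (N <= M)%N -> deg_lt N x -> deg_lt M x.
Proof. by move=> NM [q [qN qx]]; exists q; split=> //; exact: leq_trans NM. Qed.

Lemma deg_lt_lin N a x y : deg_lt N x -> deg_lt N y -> deg_lt N (a *: x + y).
Proof.
move=> [q [qN qx]] [r [rN ry]]; exists ((a *: 1)%:P * q + r); split=> [|t].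
  rewrite (leq_trans (size_polyD _ _)) // geq_max rN andbT mul_polyC.
  exact: leq_trans (size_scale_leq _ _) qN.
by rewrite linearP qx ry hornerD hornerM hornerC sym_scaleE.
Qed.

Lemma deg_lt_mul N M x y : deg_lt N x -> deg_lt M y -> deg_lt (N + M) (x * y).
Proof.
move=> [q [qN qx]] [r [rM ry]]; exists (q * r); split=> [|t].
  rewrite (leq_trans (size_polyMleq _ _)) // (leq_trans (leq_pred _)) //.
  exact: leq_add.
by rewrite sdilM hornerM qx ry.
Qed.

Lemma deg_lt_one : deg_lt 1 1.
Proof.
exists 1%:P; split=> [|t]; first by rewrite size_polyC; case: eqP.
by rewrite sdil_one hornerC.
Qed.

Lemma deg_lt_exists x : exists N, deg_lt N x.
Proof.
elim/sym_ind: x => [|w|a x y [N xN] [M yM]|x y [N xN] [M yM]].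
- by exists 1%N; exact: deg_lt_one.
- have [N [p pE]] := dil_poly C w; exists N, (\poly_(k < N) sym_gen (p k)).
  split=> [|t]; first exact: size_poly.
  rewrite sdil_gen pE linear_sum horner_poly; apply: eq_bigr => k _.
  by rewrite linearZZ scale_oneX mulrC -sym_scaleE.
- exists (maxn N M); apply: deg_lt_lin.
    exact: deg_lt_leq (leq_maxl _ _) xN.
  exact: deg_lt_leq (leq_maxr _ _) yM.
- by exists (N + M)%N; exact: deg_lt_mul.
Qed.

Lemma deg_lt_poly N x b : deg_lt N x ->
  exists2 r : {poly K}, (size r <= N)%N & forall t, b (sdil t x) = r.[t].
Proof.
move=> [q [qN qx]]; exists (\poly_(k < size q) b q`_k) => [|t].
  exact: leq_trans (size_poly _ _) qN.
rewrite qx horner_coef horner_poly linear_sum; apply: eq_bigr => k _.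
by rewrite scale_oneX mulrC -sym_scaleE linearZZ mulrC.
Qed.

Lemma sdil1 x : sdil 1 x = x.
Proof.
elim/sym_ind: x => [|w|a x y hx hy|x y hx hy].
- exact: sdil_one.
- by rewrite sdil_gen dil1.
- by rewrite linearP hx hy.
- by rewrite sdilM hx hy.
Qed.

Lemma sdil_mul s t x : sdil s (sdil t x) = sdil (s * t) x.
Proof.
elim/sym_ind: x => [|w|a x y hx hy|x y hx hy].
- by rewrite !sdil_one.
- by rewrite !sdil_gen dilM.
- by rewrite !linearP hx hy.
- by rewrite !sdilM hx hy.
Qed.

Lemma deg_lt_sdil N t x : deg_lt N x -> deg_lt N (sdil t x).
Proof.
move=> [q [qN qx]]; exists (\poly_(k < N) (t ^+ k *: q`_k)); split=> [|s].
  exact: size_poly.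
rewrite sdil_mul qx (horner_coef_wide _ qN) horner_poly; apply: eq_bigr => k _.
by rewrite !scale_oneX exprMn [LHS]mulrC [RHS]mulrC -!sym_scaleE scalerA.
Qed.

Lemma sdil0 x : sdil 0 x = sym_counit E x *: 1.
Proof.
elim/sym_ind: x => [|w|a x y hx hy|x y hx hy].
- by rewrite sdil_one [sym_counit E _]sym_dual1 scale1r.
- by rewrite sdil_gen dil0 linear0 [sym_counit E _]sym_dual_gen scale0r.
- by rewrite !linearP hx hy scalerDl scalerA.
- by rewrite sdilM hx hy -sym_scaleE scalerA [sym_counit E (x * y)]sym_dualM.
Qed.

Lemma poly_eq_at (p q : {poly K}) : (forall t, p.[t] = q.[t]) -> p = q.
Proof. by move=> pq; apply: (poly_nat_inj K_char0) => k. Qed.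

(** As a polynomial in t, [b (sdil t x)] has size at most N and is divisible by t^k with N <= k, so
    it vanishes, in particular at t = 1. *)
Lemma ordge_vanish k b N x : ordge k b -> deg_lt N x -> (N <= k)%N -> b x = 0.
Proof.
move=> /(_ x) [r rE] /(deg_lt_poly b) [q qN qE] Nk.
have qr : q = r * 'X^k by apply: poly_eq_at => t; rewrite -rE -qE.
rewrite -[x]sdil1 qE qr; have [->|r0] := eqVneq r 0; first by rewrite mul0r horner0.
move: qN; rewrite qr size_Mmonic ?monicXn // size_polyXn addnS /= => rk.
have := leq_trans rk Nk; rewrite -{2}[k]add0n leq_add2r leqn0 size_poly_eq0.
by rewrite (negPf r0).
Qed.

Lemma ordge0 b : ordge 0 b.
Proof.
move=> x; have [N xN] := deg_lt_exists x; have [r _ rE] := deg_lt_poly b xN.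
by exists r => t; rewrite expr0 mulr1.
Qed.

Lemma ordge_leq k l b : (k <= l)%N -> ordge l b -> ordge k b.
Proof.
move=> kl hb x; have [r rE] := hb x; exists (r * 'X^(l - k)) => t.
by rewrite -mulrA -exprD subnK.
Qed.

Lemma ordge_zero k : ordge k 0.
Proof. by move=> x; exists 0 => t; rewrite mul0r horner0 lmap0E. Qed.

Lemma ordgeD k b1 b2 : ordge k b1 -> ordge k b2 -> ordge k (b1 + b2).
Proof.
move=> h1 h2 x; have [r1 r1E] := h1 x; have [r2 r2E] := h2 x; exists (r1 + r2) => t.
by rewrite mulrDl hornerD lmapDE r1E r2E.
Qed.

Lemma ordgeZ k a b : ordge k b -> ordge k (a *: b).
Proof.
move=> h x; have [r rE] := h x; exists (a *: r) => t.
by rewrite -scalerAl hornerZ lmapZE rE.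
Qed.

Lemma ordgeN k b : ordge k b -> ordge k (- b).
Proof. by rewrite -scaleN1r; exact: ordgeZ. Qed.

Lemma ordgeB k b1 b2 : ordge k b1 -> ordge k b2 -> ordge k (b1 - b2).
Proof. by move=> h1 h2; apply: ordgeD => //; exact: ordgeN. Qed.

Lemma ordge_sum k (I : Type) (r : seq I) (Q : pred I) (F : I -> A) :
  (forall i, Q i -> ordge k (F i)) -> ordge k (\sum_(i <- r | Q i) F i).
Proof.
move=> h; elim/big_rec: _ => [|i y Qi hy]; first exact: ordge_zero.
by apply: ordgeD => //; exact: h.
Qed.

Lemma ordge_mul k l b1 b2 : ordge k b1 -> ordge l b2 -> ordge (k + l) (b1 * b2).
Proof.
move=> h1 h2 x; set s := tens_repr (comult C x).
suff [r rE] : exists r : {poly K}, forall t,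
    \sum_(p <- s) b1 (sdil t p.1) * b2 (sdil t p.2) = (r * 'X^(k + l)).[t].
  exists r => t; rewrite -rE [LHS]cmul_sdil cmulE tens_dualE; exact: eq_bigr.
elim: s => [|p s [r rE]]; first by exists 0 => t; rewrite big_nil mul0r horner0.
have [r1 r1E] := h1 p.1; have [r2 r2E] := h2 p.2; exists (r1 * r2 + r) => t.
by rewrite big_cons rE r1E r2E mulrDl hornerD exprD mulrACA -hornerM.
Qed.

Lemma ordge_mull k b1 b2 : ordge k b2 -> ordge k (b1 * b2).
Proof. by move=> h; rewrite -[k]add0n; apply: ordge_mul => //; exact: ordge0. Qed.
Lemma ordge_mulr k b1 b2 : ordge k b1 -> ordge k (b1 * b2).
Proof. by move=> h; rewrite -[k]addn0; apply: ordge_mul => //; exact: ordge0. Qed.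

(** The constant term in t is the value at the dilation by 0, which maps x to a multiple of the
    unit. *)
Lemma ordge1 b : b 1 = 0 -> ordge 1 b.
Proof.
move=> b1 x; have [N xN] := deg_lt_exists x; have [r _ rE] := deg_lt_poly b xN.
have /factor_theorem [q qE] : root r 0.
  by apply/rootP; rewrite -rE sdil0 linearZZ b1; exact: mulr0.
by exists q => t; rewrite rE qE subr0.
Qed.

Lemma ordgeX k b : ordge 1 b -> ordge k (b ^+ k).
Proof.
move=> h; elim: k => [|k IH]; first exact: ordge0.
by rewrite exprS -add1n; exact: ordge_mul.
Qed.

Lemma ordge_eq N b1 b2 : ordge N (b1 - b2) -> forall x, deg_lt N x -> b1 x = b2 x.
Proof.
move=> h x xN; apply/eqP; rewrite -subr_eq0.
by rewrite -[_ - _]/((b1 - b2) x) (ordge_vanish h xN).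
Qed.

Lemma ordge_sub_trans N b1 b2 b3 :
  ordge N (b1 - b2) -> ordge N (b2 - b3) -> ordge N (b1 - b3).
Proof. by move=> h1 h2; rewrite -(subrKA b2); exact: ordgeD. Qed.

Lemma eq_of_ordge b1 b2 : (forall N, ordge N (b1 - b2)) -> b1 = b2.
Proof.
move=> h; apply: linear_ext => x; have [N xN] := deg_lt_exists x.
exact: ordge_eq (h N) _ xN.
Qed.

(** Here [f] is a limit of functionals that is stationary at each point, from the degree of the
    point on; this is how infinite series become functionals. *)
Lemma lim_linear (f : sym E -> K) (c : nat -> A) :
  (forall x N, deg_lt N x -> f x = c N x) -> linear (f : sym E -> K^o).
Proof.
move=> fE a x y; have [N xN] := deg_lt_exists x; have [M yM] := deg_lt_exists y.
have {}xN := deg_lt_leq (leq_maxl N M) xN; have {}yM := deg_lt_leq (leq_maxr N M) yM.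
by rewrite (fE _ _ (deg_lt_lin a xN yM)) (fE _ _ xN) (fE _ _ yM) linearP.
Qed.

Lemma lim_ordge b (c : nat -> A) :
  (forall x N, deg_lt N x -> b x = c N x) ->
  (forall M N, (M <= N)%N -> ordge M (c N - c M)) -> forall M, ordge M (b - c M).
Proof.
move=> bE cauchy M x; have [N xN] := deg_lt_exists x.
have {}xN := deg_lt_leq (leq_maxl N M) xN.
have [r rE] := cauchy M _ (leq_maxr N M) x; exists r => t.
by rewrite -rE !lmapBE (bE _ _ (deg_lt_sdil t xN)).
Qed.

End Filtration.

(** * Truncated exponential and logarithm *)

Section ExpLogPoly.
Variable K : fieldType.
Hypothesis K_char0 : [pchar K] =i pred0.
Implicit Types p q r : {poly K}.

Lemma natSr_neq0 k : k.+1%:R != 0 :> K.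
Proof. by rewrite (iffLR (pcharf0P K) K_char0). Qed.

Lemma factr_neq0 k : k`!%:R != 0 :> K.
Proof. by rewrite -[k`!]prednK ?fact_gt0 // natSr_neq0. Qed.

Definition eq_trunc (N : nat) p q := forall i, (i < N)%N -> p`_i = q`_i.

Lemma eq_trunc_dvd N p q : eq_trunc N p q -> exists r, p - q = r * 'X^N.
Proof.
move=> h; exists (drop_poly N (p - q)).
rewrite -{1}[p - q](poly_take_drop N) (_ : take_poly N _ = 0) ?add0r //.
apply/polyP => i; rewrite coef_take_poly coef0; case: ifP => // iN.
by rewrite coefB h // subrr.
Qed.

Lemma eq_trunc_trans N p q r : eq_trunc N p q -> eq_trunc N q r -> eq_trunc N p r.
Proof. by move=> h1 h2 i iN; rewrite h1 ?h2. Qed.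

Lemma eq_truncM N p q p' q' :
  eq_trunc N p q -> eq_trunc N p' q' -> eq_trunc N (p * p') (q * q').
Proof.
move=> h1 h2 i iN; rewrite !coefM; apply: eq_bigr => j _.
have ji : (j <= i)%N by rewrite -ltnS.
by rewrite h1 ?h2 // (leq_ltn_trans _ iN) // leq_subr.
Qed.

Lemma eq_trunc_deriv N p q :
  p`_0 = q`_0 -> eq_trunc N p^`() q^`() -> eq_trunc N.+1 p q.
Proof.
move=> h0 h [//|i] iN; have := h i iN; rewrite !coef_deriv -mulr_natr -[RHS]mulr_natr.
exact: (mulIf (natSr_neq0 i)).
Qed.

Lemma eq_trunc_Xn N q k : q`_0 = 0 -> (N <= k)%N -> eq_trunc N (q ^+ k) 0.
Proof.
move=> q0 Nk; have /factor_theorem [r ->] : root q 0 by apply/rootP; rewrite horner_coef0.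
rewrite subr0 exprMn => i iN; rewrite coefMXn coef0 (leq_trans iN Nk) //.
Qed.

Lemma comp_poly_coef0 p q : q`_0 = 0 -> (p \Po q)`_0 = p`_0.
Proof. by move=> q0; rewrite -!horner_coef0 horner_comp !horner_coef0 q0 horner_coef0. Qed.

Definition exp_poly M : {poly K} := \poly_(k < M.+1) (k`!%:R)^-1.
Definition log_coef l : K := (-1) ^+ l.+1 / l%:R.
Definition log_poly M : {poly K} := \sum_(1 <= l < M.+1) log_coef l *: 'X^l.

Lemma coef_exp_poly M i : (exp_poly M)`_i = if (i <= M)%N then (i`!%:R)^-1 else 0.
Proof. by rewrite coef_poly ltnS. Qed.

Lemma exp_poly_deriv M : (exp_poly M)^`() = exp_poly M - (M`!%:R)^-1 *: 'X^M.
Proof.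
apply/polyP => i; rewrite coef_deriv coefB coefZ coefXn !coef_exp_poly.
have [iM|Mi|->] := ltngtP i M.
- rewrite mulr0 subr0 factS natrM invfM -[LHS]mulr_natr mulrAC.
  by rewrite mulVf ?natSr_neq0 // mul1r.
- by rewrite mulr0 subr0 mul0rn.
- by rewrite mulr1 subrr mul0rn.
Qed.

Lemma exp_poly_coef0 M : (exp_poly M)`_0 = 1.
Proof. by rewrite coef_exp_poly fact0 invr1. Qed.

Lemma log_poly_coef0 M : (log_poly M)`_0 = 0.
Proof.
rewrite coef_sum big_nat big1 // => l /andP [l0 _].
by rewrite coefZ coefXn ltn_eqF // mulr0.
Qed.

Definition geo_poly M : {poly K} := \sum_(l < M) (- 'X) ^+ l.

Lemma log_poly_deriv M : (log_poly M)^`() = geo_poly M.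
Proof.
rewrite /log_poly linear_sum big_add1 big_mkord; apply: eq_bigr => l _.
rewrite [LHS]derivZ derivXn -scaler_nat scalerA /log_coef mulfVK ?natSr_neq0 //.
by rewrite -scaleN1r exprZn 2!exprS mulrA mulrNN !mul1r.
Qed.

Lemma geo_polyE M : (1 + 'X) * geo_poly M = 1 - (- 'X) ^+ M.
Proof.
by rewrite -{1}['X]opprK -[RHS]opprB subrX1 -mulNr opprB; congr (_ * _).
Qed.

(** With g the truncation of e^X - 1 one has g' = 1 + g below order M, so the derivative of ln(1 +
    g) telescopes to 1 - (-g)^M. *)
Lemma log_exp_poly M : eq_trunc M.+1 (log_poly M \Po (exp_poly M - 1)) 'X.
Proof.
set g := exp_poly M - 1.
have g0 : g`_0 = 0 by rewrite coefB exp_poly_coef0 coef1 subrr.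
apply: eq_trunc_deriv; first by rewrite comp_poly_coef0 // log_poly_coef0 coefX.
rewrite deriv_comp log_poly_deriv derivX.
have g'E : eq_trunc M g^`() (1 + g).
  rewrite /g derivB exp_poly_deriv derivC subr0 [1 + _]addrC subrK.
  by move=> i iM; rewrite coefB coefZ coefXn ltn_eqF // mulr0 subr0.
apply: eq_trunc_trans (eq_truncM _ g'E) _; first by move=> i.
rewrite mulrC (_ : 1 + g = (1 + 'X) \Po g); last by rewrite comp_polyD comp_polyX comp_polyC.
rewrite -comp_polyM geo_polyE.
have -> : (1 - (- 'X) ^+ M) \Po g = 1 - (- g) ^+ M.
  by rewrite comp_polyB comp_polyC [in LHS]rmorphXn rmorphN /= comp_polyX.
by move=> i iM; rewrite coefB (@eq_trunc_Xn M) ?coef0 ?subr0 // coefN g0 oppr0.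
Qed.

(** Below order M the composite G solves (1 + X) G' = G, as 1 + X does, and both have constant term
    1. *)
Lemma exp_log_poly M : eq_trunc M.+1 (exp_poly M \Po log_poly M) (1 + 'X).
Proof.
set L := log_poly M; set G := exp_poly M \Po L.
have L0 := log_poly_coef0 M.
have G'E : eq_trunc M ((1 + 'X) * G^`()) G.
  rewrite deriv_comp log_poly_deriv mulrCA geo_polyE exp_poly_deriv.
  rewrite -[X in eq_trunc _ _ X]mulr1; apply: eq_truncM => i iM.
    rewrite comp_polyB comp_polyZ comp_Xn_poly coefB coefZ.
    by rewrite (@eq_trunc_Xn M) // coef0 mulr0 subr0.
  rewrite coefB (@eq_trunc_Xn M) ?coef0 ?subr0 // coefN coefX oppr0 //.
suff h i : (i <= M)%N -> (G - (1 + 'X))`_i = 0.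
  by move=> i iM; apply/eqP; rewrite -subr_eq0 -coefB h.
elim: i => [_|i IH iM].
  by rewrite coefB comp_poly_coef0 // exp_poly_coef0 coefD coef1 coefX addr0 subrr.
(* For the difference H the coefficient of X^i in this equation reads (i+1) H_(i+1) + i H_i = H_i,
   and H_i is already 0. *)
have := G'E i iM.
have hG : G = (G - (1 + 'X)) + (1 + 'X) by rewrite subrK.
set H := G - (1 + 'X) in IH hG *.
have Hi := IH (ltnW iM).
have dG : G^`() = H^`() + 1.
  by rewrite [in LHS]hG derivD [(1 + 'X)^`()]derivD derivC derivX add0r.
rewrite dG mulrDr mulr1 coefD [in RHS]hG [in RHS]coefD Hi add0r.
move/(canRL (addrK _)); rewrite subrr mulrDl mul1r coefD.
rewrite ['X * _]mulrC coefMX !coef_deriv.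
case: i IH iM Hi => [|i] IH iM Hi /=.
  by rewrite addr0 => /eqP; rewrite -mulr_natr mulf_eq0 (negPf (natSr_neq0 0)) orbF => /eqP.
rewrite Hi mul0rn addr0 => /eqP.
by rewrite -mulr_natr mulf_eq0 (negPf (natSr_neq0 i.+1)) orbF => /eqP.
Qed.

End ExpLogPoly.

(** * Logarithms of characters and exponentials of derivations *)

Section Calculus.
Variables (K : fieldType) (E : lmodType K) (C : conv_structure E).
Hypothesis K_char0 : [pchar K] =i pred0.
Local Notation A := (calg C).
Implicit Types (phi psi : ldual E) (x y u : sym E) (a b : A) (p q : {poly K}).

Local Notation "p .{ a }" := (horner_alg (a : A) p) (at level 2, a at next level).

Lemma evD a p q : (p + q).{a} = p.{a} + q.{a}. Proof. exact: rmorphD. Qed.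
Lemma evB a p q : (p - q).{a} = p.{a} - q.{a}. Proof. exact: rmorphB. Qed.
Lemma evM a p q : (p * q).{a} = p.{a} * q.{a}. Proof. exact: rmorphM. Qed.
Lemma ev1 a : (1 : {poly K}).{a} = 1. Proof. exact: rmorph1. Qed.
Lemma evX a : 'X.{a} = a. Proof. exact: horner_algX. Qed.
Lemma evXn a p k : (p ^+ k).{a} = p.{a} ^+ k. Proof. exact: rmorphXn. Qed.
Lemma ev_big a (I : Type) (r : seq I) (F : I -> {poly K}) :
  (\sum_(i <- r) F i).{a} = \sum_(i <- r) (F i).{a}.
Proof. exact: rmorph_sum. Qed.

Lemma ev_scaleXn a (c : K) k : (c *: 'X^k).{a} = c *: a ^+ k.
Proof.
rewrite -mul_polyC evM evXn evX [X in X * _]horner_algC.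
exact: mulr_algl.
Qed.

Lemma ev_scale a (c : K) p : (c *: p).{a} = c *: p.{a}.
Proof. rewrite -mul_polyC evM [X in X * _]horner_algC; exact: mulr_algl. Qed.

Lemma ev_sum a p : p.{a} = \sum_(k < size p) p`_k *: a ^+ k.
Proof.
rewrite -{1}[p]coefK poly_def ev_big; apply: eq_bigr => k _.
exact: ev_scaleXn.
Qed.

Lemma ev_comp a p q : (p \Po q).{a} = p.{q.{a}}.
Proof.
rewrite comp_polyE ev_big ev_sum; apply: eq_bigr => k _.
by rewrite ev_scale evXn.
Qed.

Lemma ev_trunc N a p q : ordge 1 a -> eq_trunc N p q -> ordge N (p.{a} - q.{a}).
Proof.
move=> ha /eq_trunc_dvd [r rE]; rewrite -evB rE evM evXn evX;
 apply: ordge_mull; exact: ordgeX.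
Qed.

Lemma ordge_evB N a b p : ordge N (a - b) -> ordge N (p.{a} - p.{b}).
Proof.
move=> hab; rewrite !ev_sum -sumrB; apply: ordge_sum => k _.
rewrite -scalerBr; apply: ordgeZ; elim: (val k) => [|j IH].
  by rewrite !expr0 subrr; exact: ordge_zero.
rewrite !exprS -[_ - _](subrKA (a * b ^+ j)) -mulrBr -mulrBl.
by apply: ordgeD; [exact: ordge_mull | exact: ordge_mulr].
Qed.

Lemma ordge_ev a p : p`_0 = 0 -> ordge 1 a -> ordge 1 p.{a}.
Proof.
move=> p0 ha; rewrite ev_sum; apply: ordge_sum => -[[|k] kp] _ /=.
  by rewrite p0 scale0r; exact: ordge_zero.
by apply: ordgeZ; apply: ordge_leq (ordgeX k.+1 ha).
Qed.

Definition exp_trunc M a : A := (exp_poly K M).{a}.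
Definition log_trunc M b : A := (log_poly K M).{b - 1}.

Lemma exp_log_trunc M b : ordge 1 (b - 1) -> ordge M.+1 (exp_trunc M (log_trunc M b) - b).
Proof.
move=> hb; have := ev_trunc hb (@exp_log_poly K K_char0 M).
by rewrite ev_comp evD ev1 evX [1 + _]addrC subrK.
Qed.

Lemma log_exp_trunc M a : ordge 1 a -> ordge M.+1 (log_trunc M (exp_trunc M a) - a).
Proof.
move=> ha; have := ev_trunc ha (@log_exp_poly K K_char0 M).
by rewrite ev_comp evB ev1 evX.
Qed.

Lemma log_truncE M b :
  log_trunc M b = \sum_(1 <= l < M.+1) log_coef K l *: (b - 1) ^+ l.
Proof.
rewrite /log_trunc /log_poly ev_big; apply: eq_bigr => l _.
exact: ev_scaleXn.
Qed.

Lemma exp_truncE M a : exp_trunc M a = \sum_(k < M.+1) (k`!%:R)^-1 *: a ^+ k.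
Proof.
rewrite /exp_trunc /exp_poly poly_def ev_big; apply: eq_bigr => k _.
exact: ev_scaleXn.
Qed.

Lemma ordge_log M b : ordge 1 (b - 1) -> ordge 1 (log_trunc M b).
Proof. by move=> hb; apply: ordge_ev => //; exact: log_poly_coef0. Qed.

Lemma exp_trunc_sub1 M a : ordge 1 a -> ordge 1 (exp_trunc M a - 1).
Proof.
move=> ha; rewrite /exp_trunc -(ev1 a) -evB.
by apply: ordge_ev => //; rewrite coefB exp_poly_coef0 coef1 subrr.
Qed.

Lemma log_trunc_cauchy b : ordge 1 (b - 1) -> forall M N, (M <= N)%N ->
  ordge M (log_trunc N b - log_trunc M b).
Proof.
move=> hb M N MN; rewrite !log_truncE (big_cat_nat (n := M.+1)) //=.
rewrite [X in ordge _ X]addrC addKr big_nat; apply: ordge_sum => l /andP [Ml _].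
by apply: ordgeZ; apply: ordge_leq (ordgeX l hb); exact: ltnW.
Qed.

Lemma exp_trunc_cauchy a : ordge 1 a -> forall M N, (M <= N)%N ->
  ordge M (exp_trunc N a - exp_trunc M a).
Proof.
move=> ha M N MN; rewrite !exp_truncE.
rewrite -(big_mkord xpredT (fun k => (k`!%:R)^-1 *: a ^+ k)).
rewrite -(big_mkord xpredT (fun k => (k`!%:R)^-1 *: a ^+ k)).
rewrite (big_cat_nat (n := M.+1)) //= [X in ordge _ X]addrC addKr big_nat.
apply: ordge_sum => l /andP [Ml _].
by apply: ordgeZ; apply: ordge_leq (ordgeX l ha); exact: ltnW.
Qed.

Definition sdeg x : nat := projT1 (cid (deg_lt_exists C x)).
Lemma sdegP x : deg_lt C (sdeg x) x.
Proof. exact: (projT2 (cid (deg_lt_exists C x))). Qed.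

Lemma cauchy_eq (c : nat -> A) x M N :
  (forall M N, (M <= N)%N -> ordge M (c N - c M)) ->
  deg_lt C M x -> deg_lt C N x -> c M x = c N x.
Proof.
move=> hc; wlog MN : M N / (M <= N)%N => [hw|] xM xN.
  by case: (leqP M N) => [|/ltnW] /hw h; [|apply/esym]; exact: h.
exact/esym/(ordge_eq K_char0 (hc _ _ MN)).
Qed.

(** At x the exponential series is cut at a chosen degree bound of x; by [cauchy_eq] any other bound
    gives the same value when [a] has order at least 1. *)
Definition calg_exp a : A := to_ldual (fun x => exp_trunc (sdeg x) a x).

Lemma calg_expE a x N : ordge 1 a -> deg_lt C N x -> calg_exp a x = exp_trunc N a x.
Proof.
move=> ha xN; have sE y M : deg_lt C M y -> exp_trunc (sdeg y) a y = exp_trunc M a y.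
  by move=> yM; apply: cauchy_eq (exp_trunc_cauchy ha) (sdegP y) yM.
by rewrite [LHS]to_ldualE ?(sE x N xN) //; exact: lim_linear sE.
Qed.

Lemma calg_exp_ordge a M : ordge 1 a -> ordge M (calg_exp a - exp_trunc M a).
Proof.
move=> ha; apply: (lim_ordge (c := fun M => exp_trunc M a)) => [x N xN|].
  exact: calg_expE.
exact: exp_trunc_cauchy.
Qed.

Definition calg_ln b : A := to_ldual (fun x =>
  \sum_(l \in [set l | (0 < l)%N]%classic) (-1) ^+ l.+1 / l%:R * ((b - 1) ^+ l) x).

Lemma fsum_pos (f : nat -> K) N : (forall l, (N <= l)%N -> f l = 0) ->
  \sum_(l \in [set l | (0 < l)%N]%classic) f l = \sum_(1 <= l < N) f l.
Proof.
move=> f0; rewrite (fsbigE (index_iota 1 N)); first last.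
- move=> l /= l0; rewrite mem_index_iota l0 /= -leqNgt; exact: f0.
- by move=> l /=; rewrite mem_index_iota => /andP [].
- exact: iota_uniq.
rewrite big_nat_cond [RHS]big_nat_cond; apply: eq_bigl => l.
by case: (boolP (1 <= l < N)%N) => // /andP [l0 _]; rewrite mem_set.
Qed.

Lemma calg_lnE b x N : ordge 1 (b - 1) -> deg_lt C N x -> calg_ln b x = log_trunc N b x.
Proof.
move=> hb; move: x N; suff sE y M : deg_lt C M y ->
    \sum_(l \in [set l | (0 < l)%N]%classic) (-1) ^+ l.+1 / l%:R * ((b - 1) ^+ l) y =
    log_trunc M b y.
  by move=> x N xN; rewrite [LHS]to_ldualE ?(sE _ _ xN) //; exact: lim_linear sE.
move=> yM; rewrite (@fsum_pos _ M.+1) => [|l Ml].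
  by rewrite log_truncE lmap_sumE; apply: eq_bigr => l _.
by rewrite (ordge_vanish K_char0 (ordgeX l hb) yM) ?mulr0 // ltnW.
Qed.

Lemma calg_ln_ordge b M : ordge 1 (b - 1) -> ordge M (calg_ln b - log_trunc M b).
Proof.
move=> hb; apply: (lim_ordge (c := fun M => log_trunc M b)) => [x N xN|].
  exact: calg_lnE.
exact: log_trunc_cauchy.
Qed.

Lemma calg_ln_ordge1 b : ordge 1 (b - 1) -> ordge 1 (calg_ln b).
Proof.
move=> hb; rewrite -[calg_ln b](subrK (log_trunc 1 b)); apply: ordgeD.
  exact: calg_ln_ordge.
exact: ordge_log.
Qed.

Lemma calg_exp_sub1 a : ordge 1 a -> ordge 1 (calg_exp a - 1).
Proof.
move=> ha; rewrite -[calg_exp a](subrK (exp_trunc 1 a)) -addrA; apply: ordgeD.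
  exact: calg_exp_ordge.
exact: exp_trunc_sub1.
Qed.

Lemma calg_expK a : ordge 1 a -> calg_ln (calg_exp a) = a.
Proof.
move=> ha; apply: eq_of_ordge => // N.
have he := calg_exp_sub1 ha.
apply: ordge_sub_trans (calg_ln_ordge N he) _.
apply: (@ordge_sub_trans _ _ _ _ _ (log_trunc N (exp_trunc N a))).
  apply: ordge_evB; rewrite opprB addrA subrK; exact: calg_exp_ordge.
exact: ordge_leq (leqnSn N) (log_exp_trunc N ha).
Qed.

Lemma calg_lnK b : ordge 1 (b - 1) -> calg_exp (calg_ln b) = b.
Proof.
move=> hb; apply: eq_of_ordge => // N.
have hl := calg_ln_ordge1 hb.
apply: ordge_sub_trans (calg_exp_ordge N hl) _.
apply: (@ordge_sub_trans _ _ _ _ _ (exp_trunc N (log_trunc N b))).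
  by apply: ordge_evB; exact: calg_ln_ordge.
exact: ordge_leq (leqnSn N) (exp_log_trunc N hb).
Qed.

End Calculus.

Section BinomialLog.
Variable K : fieldType.
Hypothesis K_char0 : [pchar K] =i pred0.

(** The binomial coefficient X over k as a polynomial in X. Its coefficient of X is that of t^k in
    ln(1 + t), the derivative of (1 + t)^X at X = 0. *)
Definition bin_poly k : {poly K} := (k`!%:R)^-1 *: \prod_(i < k) ('X - i%:R%:P).

Lemma bin_poly_nat n k : (bin_poly k).[n%:R] = 'C(n, k)%:R.
Proof.
rewrite hornerZ horner_prod -[RHS](mulKf (factr_neq0 K_char0 k)); congr (_ * _).
rewrite -natrM mulnC bin_ffact; elim: k => [|k IH]; first by rewrite big_ord0.
rewrite big_ord_recr /= IH !hornerE ffactnSr natrM.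
have [kn|nk] := leqP k n; first by rewrite natrB.
by rewrite ffact_small // !mul0r.
Qed.

Lemma bin_poly_coef0 k : (bin_poly k)`_0 = (k == 0%N)%:R.
Proof.
rewrite -horner_coef0 -[0]/(0%:R) bin_poly_nat bin0n.
by [].
Qed.

Lemma bin_poly_coef1 k : (bin_poly k.+1)`_1 = log_coef K k.+1.
Proof.
rewrite coefZ big_ord_recl subr0 coefXM /= -horner_coef0 horner_prod.
have -> : \prod_(i < k) ('X - (lift ord0 i)%:R%:P : {poly K}).[0] = (-1) ^+ k * k`!%:R.
  elim: k => [|k IH]; first by rewrite big_ord0 expr0 fact0 mulr1.
  rewrite big_ord_recr /= IH hornerXsubC /bump /= add1n factS natrM exprS.
  by ring.
rewrite factS natrM /log_coef !exprS; field.
by rewrite factr_neq0 // nat1r natSr_neq0.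
Qed.

(* With [a k = N^k(x)] etc. the hypothesis says that the powers [(1 + N)^n] are
   multiplicative; comparing the coefficients of [n] in these polynomials of [n]
   gives the derivation property of the logarithm. *)
Lemma log_binomial (a b c : nat -> K) M :
  (forall n, \sum_(k < M.+1) 'C(n, k)%:R * c k =
     (\sum_(k < M.+1) 'C(n, k)%:R * a k) * (\sum_(k < M.+1) 'C(n, k)%:R * b k)) ->
  \sum_(1 <= k < M.+1) log_coef K k * c k =
  a 0%N * (\sum_(1 <= k < M.+1) log_coef K k * b k) +
  (\sum_(1 <= k < M.+1) log_coef K k * a k) * b 0%N.
Proof.
move=> h; pose pol (f : nat -> K) := \sum_(k < M.+1) f k *: bin_poly k.
have polE f n : (pol f).[n%:R] = \sum_(k < M.+1) 'C(n, k)%:R * f k.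
  rewrite horner_sum; apply: eq_bigr => k _.
  by rewrite hornerZ bin_poly_nat mulrC.
have pol0 f : (pol f)`_0 = f 0%N.
  rewrite coef_sum big_ord_recl big1 => [|k _]; rewrite coefZ bin_poly_coef0 /=.
    by rewrite mulr1 addr0.
  by rewrite mulr0.
have pol1 f : (pol f)`_1 = \sum_(1 <= k < M.+1) log_coef K k * f k.
  rewrite coef_sum big_ord_recl big_add1 big_mkord.
  rewrite [X in X + _](_ : _ = 0) ?add0r.
    by apply: eq_bigr => k _; rewrite coefZ bin_poly_coef1 mulrC.
  by rewrite coefZ /bin_poly big_ord0 fact0 invr1 scale1r coef1 mulr0.
have e : pol c = pol a * pol b.
  by apply: (poly_nat_inj K_char0) => n; rewrite hornerM !polE h.
rewrite -!pol1 -(pol0 a) -(pol0 b) e coefM !big_ord_recl big_ord0 addr0.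
by [].
Qed.

Lemma sum_widen (F : nat -> K) m n : (m <= n)%N -> (forall k, (m <= k)%N -> F k = 0) ->
  \sum_(k < n) F k = \sum_(k < m) F k.
Proof.
move=> mn F0; rewrite (big_ord_widen _ _ mn) [RHS]big_mkcond.
by apply: eq_bigr => k _; case: ltnP => // /F0.
Qed.

End BinomialLog.

(** * Characters and derivations over the counit *)

Section Derivations.
Variables (K : fieldType) (E : lmodType K) (C : conv_structure E).
Hypothesis K_char0 : [pchar K] =i pred0.
Local Notation A := (calg C).
Implicit Types (phi psi : ldual E) (x y u : sym E) (a b : A).
Local Notation eps := (sym_counit E).

(** Comultiplication is an algebra homomorphism, so the expansions of functionals on products x * y
    multiply factor by factor. *)
Lemma calg_mul_product (I J : Type) (r : seq I) (s : seq J) b1 b2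
    (F F' : I -> A) (G G' : J -> A) :
  (forall x y, b1 (x * y) = \sum_(i <- r) F i x * F' i y) ->
  (forall x y, b2 (x * y) = \sum_(j <- s) G j x * G' j y) ->
  forall x y, (b1 * b2) (x * y) =
    \sum_(i <- r) \sum_(j <- s) (F i * G j) x * (F' i * G' j) y.
Proof.
move=> h1 h2 x y; rewrite [LHS]cmulE nuhomM.
rewrite [LHS](tens_lift_mul _ _ (tens_dual_bilin b1 b2)) tens_liftE.
transitivity (\sum_(p <- tens_repr (comult C x)) \sum_(q <- tens_repr (comult C y))
    \sum_(i <- r) \sum_(j <- s) (F i p.1 * G j p.2) * (F' i q.1 * G' j q.2)).
  apply: eq_bigr => p _; rewrite tens_liftE; apply: eq_bigr => q _.
  rewrite [p.1 ** q.1]/(p.1 * q.1) h1 h2 mulr_suml; apply: eq_bigr => i _.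
  by rewrite mulr_sumr; apply: eq_bigr => j _; rewrite mulrACA.
have swap (T T' U : Type) (t : seq T) (t' : seq T') (v : seq U) (f : T -> T' -> U -> K) :
    \sum_(i <- t) \sum_(j <- t') \sum_(k <- v) f i j k =
    \sum_(k <- v) \sum_(i <- t) \sum_(j <- t') f i j k.
  rewrite [RHS]exchange_big; apply: eq_bigr => i _; exact: exchange_big.
rewrite swap; apply: eq_bigr => i _; rewrite swap; apply: eq_bigr => j _.
rewrite !calg_mulE mulr_suml; apply: eq_bigr => p _.
by rewrite mulr_sumr.
Qed.

Definition derivation b := forall x y, b (x * y) = b x * eps y + eps x * b y.

Lemma eps1 : eps 1 = 1. Proof. exact: sym_dual1. Qed.
Lemma epsM x y : eps (x * y) = eps x * eps y. Proof. exact: sym_dualM. Qed.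

Lemma derivation1 b : derivation b -> b 1 = 0.
Proof.
move=> hb; have := hb 1 1; rewrite mulr1 eps1 mulr1 mul1r => /eqP.
by rewrite -{1}[b 1]addr0 (inj_eq (addrI _)) eq_sym => /eqP.
Qed.

Lemma derivation_ordge1 b : derivation b -> ordge 1 b.
Proof. by move=> /derivation1; exact: ordge1. Qed.

Lemma derivation_ext b1 b2 : derivation b1 -> derivation b2 ->
  (forall w, b1 (sym_gen w) = b2 (sym_gen w)) -> b1 = b2.
Proof.
move=> h1 h2 hg; apply: linear_ext; apply: sym_ind => [|//|c x y hx hy|x y hx hy].
- by rewrite !derivation1.
- by rewrite !linearP hx hy.
- by rewrite h1 h2 hx hy.
Qed.

Lemma inf_charE psi x :
  inf_char psi x = (sym_lift (linear_pack (inf_char_linear0 psi)) x)`_1.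
Proof. by []. Qed.

Lemma inf_char_gen psi w : inf_char psi (sym_gen w) = psi w.
Proof. by rewrite inf_charE sym_lift_gen /= coefZ coefX; exact: mulr1. Qed.

Lemma inf_char_derivation psi : derivation (inf_char psi : A).
Proof.
set F := sym_lift (linear_pack (inf_char_linear0 psi)).
have F0 x : (F x)`_0 = eps x.
  elim/sym_ind: x => [|w|c x y hx hy|x y hx hy].
  - by rewrite [F 1]sym_lift1 eps1 coef1.
  - by rewrite [eps _]sym_dual_gen sym_lift_gen [LHS]coefZ coefX mulr0.
  - by rewrite linearP coefD coefZ hx hy linearP.
  - by rewrite [F _]nuhomM -[_ ** _]/(F x * F y) coef0M hx hy epsM.
move=> x y; rewrite !inf_charE -/F -!F0 [F (x * y)]nuhomM -[F x ** F y]/(F x * F y).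
by rewrite coefM !big_ord_recl big_ord0 addr0 addrC.
Qed.

Lemma derivation_inf_char b : derivation b -> inf_char (pullback b (@sym_gen K E)) = b.
Proof.
move=> hb; apply: derivation_ext => //; first exact: inf_char_derivation.
by move=> w; rewrite inf_char_gen.
Qed.

Lemma one_product x y : (1 : A) (x * y) = (1 : A) x * (1 : A) y.
Proof. exact: epsM. Qed.

Lemma derivation_sum b : derivation b -> forall x y,
  b (x * y) = \sum_(i <- [:: true; false]) (if i then b else 1 : A) x * (if i then 1 else b : A) y.
Proof. by move=> hb x y; rewrite !big_cons big_nil addr0 hb. Qed.

(** The mixed terms b1(x) b2(y) + b2(x) b1(y) are symmetric in b1 and b2 and cancel. *)
Lemma commutator_derivation b1 b2 :
  derivation b1 -> derivation b2 -> derivation (b1 * b2 - b2 * b1).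
Proof.
move=> h1 h2 x y; have d1 := derivation_sum h1; have d2 := derivation_sum h2.
rewrite lmapBE (calg_mul_product d1 d2) (calg_mul_product d2 d1).
rewrite !big_cons !big_nil !addr0 !mul1r !mulr1 !lmapBE.
rewrite !(calg_oneE C).
by ring.
Qed.

Lemma pow_binomial b x n M : ordge 1 (b - 1) -> deg_lt C M x ->
  (b ^+ n) x = \sum_(k < M.+1) 'C(n, k)%:R * ((b - 1) ^+ k) x.
Proof.
move=> hb xM; pose F k := 'C(n, k)%:R * ((b - 1) ^+ k) x : K.
transitivity (\sum_(k < n.+1) F k).
  rewrite -{1}[b](subrK 1) addrC exprDn_comm; last exact/commr_sym/commr1.
  rewrite lmap_sumE; apply: eq_bigr => k _.
  by rewrite expr1n mul1r -scaler_nat.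
have Fn k : (n.+1 <= k)%N -> F k = 0 by move=> nk; rewrite /F bin_small ?mul0r.
have FM k : (M.+1 <= k)%N -> F k = 0.
  move=> Mk; rewrite /F (ordge_vanish K_char0 (ordgeX k hb) xM) ?mulr0 //.
  exact: ltnW.
rewrite -(sum_widen (leq_maxl n.+1 M.+1) Fn).
by rewrite -(sum_widen (leq_maxr n.+1 M.+1) FM).
Qed.

Lemma char_ordge1 phi : ordge 1 ((sym_dual phi : A) - 1).
Proof. by apply: ordge1; rewrite lmapBE [sym_dual phi 1]sym_dual1 calg_one1 subrr. Qed.

Lemma charX phi n : exists psi, (sym_dual phi : A) ^+ n = sym_dual psi.
Proof.
elim: n => [|n [psi IH]]; first by exists \0.
by exists (star C phi psi); rewrite exprS IH; exact: cmul_char.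
Qed.

Lemma ln_char_derivation phi : derivation (calg_ln (sym_dual phi : A)).
Proof.
move=> x y; set b : A := sym_dual phi; have hb : ordge 1 (b - 1) := char_ordge1 phi.
have [N xN] := deg_lt_exists C x; have [N' yN] := deg_lt_exists C y.
have [N'' xyN] := deg_lt_exists C (x * y).
pose M := maxn N (maxn N' N'').
have xM := deg_lt_leq (leq_maxl N (maxn N' N'')) xN.
have yM := deg_lt_leq (leq_trans (leq_maxl N' N'') (leq_maxr N _)) yN.
have xyM := deg_lt_leq (leq_trans (leq_maxr N' N'') (leq_maxr N _)) xyN.
rewrite (calg_lnE K_char0 hb xM) (calg_lnE K_char0 hb yM) (calg_lnE K_char0 hb xyM).
rewrite !log_truncE !lmap_sumE.
have := @log_binomial K K_char0 (fun k => ((b - 1) ^+ k) x) (fun k => ((b - 1) ^+ k) y)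
  (fun k => ((b - 1) ^+ k) (x * y)) M.
rewrite !expr0 [X in _ = X]addrC; apply=> n.
rewrite -!pow_binomial //; have [psi ->] := charX phi n; exact: sym_dualM.
Qed.

Let divided b k : A := (k`!%:R)^-1 *: b ^+ k.

Let dividedS b k : b * divided b k = k.+1%:R *: divided b k.+1.
Proof.
rewrite /divided -scalerAr -exprS scalerA factS natrM invfM mulrA.
by rewrite mulfV ?mul1r // natSr_neq0.
Qed.

Lemma divided_product b k : derivation b -> forall x y,
  divided b k (x * y) = \sum_(i < k.+1) divided b i x * divided b (k - i)%N y.
Proof.
move=> hb; elim: k => [|k IH] x y.
  by rewrite big_ord_recl big_ord0 addr0 /divided subn0 fact0 invr1 !scale1r one_product.
have k0 := natSr_neq0 K_char0 k.
apply: (mulfI k0); rewrite -[LHS]/((k.+1%:R *: divided b k.+1) _) -dividedS.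
rewrite (calg_mul_product (derivation_sum hb) IH) !big_cons big_nil addr0.
(* Letting b act on the left or on the right factor produces the weights j and k+1-j, whose sum k+1
   is cancelled. *)
pose G i := (i%:R : K) * (divided b i x * divided b (k.+1 - i)%N y).
pose H i := ((k.+1 - i)%:R : K) * (divided b i x * divided b (k.+1 - i)%N y).
have -> : \sum_(j < k.+1) (b * divided b j) x * (1 * divided b (k - j)%N) y =
    \sum_(j < k.+2) G j.
  rewrite [RHS]big_ord_recl {1}/G mul0r add0r; apply: eq_bigr => j _.
  rewrite mul1r dividedS lmapZE /G lift0 subSS; exact/esym/mulrA.
have -> : \sum_(j < k.+1) (1 * divided b j) x * (b * divided b (k - j)%N) y =
    \sum_(j < k.+2) H j.
  have H0 : H k.+1 = 0 by rewrite /H subnn mul0r.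
  rewrite [RHS]big_ord_recr [X in _ = _ + X]H0 addr0; apply: eq_bigr => j _.
  have jk : (j <= k)%N by rewrite -ltnS.
  rewrite mul1r dividedS lmapZE /H subSn //; exact: mulrCA.
rewrite -big_split mulr_sumr; apply: eq_bigr => j _.
rewrite -[LHS]/(G j + H j) /G /H -mulrDl -natrD subnKC //.
by rewrite -ltnS.
Qed.

Lemma exp_derivation_char b : derivation b -> exists phi, calg_exp b = sym_dual phi.
Proof.
move=> hb; have hb1 := derivation_ordge1 hb.
pose L := calg_exp b; exists (pullback L (@sym_gen K E)).
have LE x N : deg_lt C N x -> L x = \sum_(k < N.+1) divided b k x.
  by move=> xN; rewrite (calg_expE K_char0 hb1 xN) exp_truncE lmap_sumE.
have L1 : L 1 = 1.
  have d0 : divided b 0 = 1 by rewrite /divided fact0 invr1 scale1r.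
  have d1 : divided b 1 = b by rewrite /divided factS fact0 invr1 scale1r expr1.
  rewrite (LE _ _ (deg_lt_one C)) !big_ord_recl big_ord0 addr0.
  rewrite -[LHS]/(divided b 0 1 + divided b 1 1) d0 d1 calg_one1 (derivation1 hb).
  exact: addr0.
have vanish x N k : deg_lt C N x -> (N <= k)%N -> divided b k x = 0.
  by move=> xN Nk; rewrite lmapZE (ordge_vanish K_char0 (ordgeX k hb1) xN) ?scaler0.
have LM x y : L (x * y) = L x * L y.
  have [N xN] := deg_lt_exists C x; have [N' yN] := deg_lt_exists C y.
  (* Generating polynomials of the divided powers of [b] at x and at y. By the Leibniz rule their
     product generates those at x * y, and evaluation at 1 sums the series. *)
  pose px := \poly_(k < N.+1) (divided b k x : K).
  pose py := \poly_(k < N'.+1) (divided b k y : K).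
  have pxE k : px`_k = divided b k x.
    by rewrite coef_poly; case: ltnP => // /ltnW /(vanish _ _ _ xN).
  have pyE k : py`_k = divided b k y.
    by rewrite coef_poly; case: ltnP => // /ltnW /(vanish _ _ _ yN).
  have -> : L x = px.[1].
    by rewrite (LE _ _ xN) horner_poly; apply: eq_bigr => k _; rewrite expr1n mulr1.
  have -> : L y = py.[1].
    by rewrite (LE _ _ yN) horner_poly; apply: eq_bigr => k _; rewrite expr1n mulr1.
  have size_pxy : (size (px * py)%R <= (N.+1 + N'.+1).+1)%N.
    apply: leq_trans (size_polyMleq _ _) _; apply: leq_trans (leq_pred _) _.
    apply: leq_trans (leqnSn _); apply: leq_add; exact: size_poly.
  rewrite -[RHS]hornerM (horner_coef_wide _ size_pxy).
  have xyN := deg_lt_mul (deg_lt_leq (leqnSn N) xN) (deg_lt_leq (leqnSn N') yN).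
  rewrite (LE _ _ xyN); apply: eq_bigr => k _.
  rewrite divided_product // coefM expr1n mulr1; apply: eq_bigr => i _.
  by rewrite pxE pyE.
apply: linear_ext; apply: sym_ind => [|w|c x y hx hy|x y hx hy].
- by rewrite [RHS]sym_dual1 -/L L1.
- by rewrite sym_dual_gen.
- by rewrite !linearP hx hy.
- by rewrite [RHS]sym_dualM -hx -hy -LM.
Qed.

End Derivations.

(** * Shuffles and the Campbell-Baker-Hausdorff series *)

Section Cut.
Variables (T : Type) (V : nmodType).
Implicit Types (h : seq T -> seq T -> V) (w : seq T).

Definition cut h w : V := \sum_(i < (size w).+1) h (take i w) (drop i w).

Lemma cut_nil h : cut h [::] = h [::] [::].
Proof. by rewrite /cut big_ord_recl big_ord0 addr0. Qed.

Lemma cut_cons h b w : cut h (b :: w) = h [::] (b :: w) + cut (fun u v => h (b :: u) v) w.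
Proof. by rewrite /cut big_ord_recl. Qed.

Lemma eq_cut h h' w : (forall u v, h u v = h' u v) -> cut h w = cut h' w.
Proof. by move=> hh'; apply: eq_bigr => i _. Qed.

Lemma cutD h h' w : cut (fun u v => h u v + h' u v) w = cut h w + cut h' w.
Proof. exact: big_split. Qed.

End Cut.

Section Shuffle.
Variable T : Type.
Implicit Types u v w : seq T.

(** The inner fixpoint keeps u and recurses on v, since a shuffle may take its first letter from
    either word. *)
Fixpoint shuffles u : seq T -> seq (seq T) :=
  if u is a :: u' then
    (fix shuffles_u v := if v is b :: v' then
       [seq a :: w | w <- shuffles u' v] ++ [seq b :: w | w <- shuffles_u v']
     else [:: u])
  else fun v => [:: v].

Definition shsum (V : nmodType) (f : seq T -> V) u v : V := \sum_(w <- shuffles u v) f w.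

Lemma shsum0l (V : nmodType) (f : seq T -> V) v : shsum f [::] v = f v.
Proof. exact: big_seq1. Qed.
Lemma shsum0r (V : nmodType) (f : seq T -> V) u : shsum f u [::] = f u.
Proof. by case: u => [|a u]; exact: big_seq1. Qed.

Lemma shsum_cons (V : nmodType) (f : seq T -> V) a u b v :
  shsum f (a :: u) (b :: v) =
  shsum (fun w => f (a :: w)) u (b :: v) + shsum (fun w => f (b :: w)) (a :: u) v.
Proof. by rewrite /shsum [shuffles _ _]/= big_cat !big_map. Qed.

Lemma eq_shsum (V : nmodType) (f g : seq T -> V) u v : f =1 g -> shsum f u v = shsum g u v.
Proof. by move=> fg; apply: eq_bigr => w _. Qed.

Lemma shsumD (V : nmodType) (f g : seq T -> V) u v :
  shsum (fun w => f w + g w) u v = shsum f u v + shsum g u v.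
Proof. exact: big_split. Qed.

Lemma shsum_big (V : nmodType) (I : Type) (r : seq I) (f : I -> seq T -> V) u v :
  shsum (fun w => \sum_(i <- r) f i w) u v = \sum_(i <- r) shsum (f i) u v.
Proof. exact: exchange_big. Qed.

(** The bialgebra axiom linking shuffles and deconcatenation, tested against a function of the two
    parts. *)
Lemma shsum_cut (V : nmodType) (h : seq T -> seq T -> V) u v :
  shsum (cut h) u v =
  cut (fun u1 u2 => cut (fun v1 v2 =>
    shsum (fun w1 => shsum (h w1) u2 v2) u1 v1) v) u.
Proof.
elim: u v h => [|a u IHu] v h.
  by rewrite shsum0l cut_nil; apply: eq_cut => v1 v2; rewrite !shsum0l.
elim: v h => [|b v IHv] h.
  by rewrite shsum0r; apply: eq_cut => u1 u2; rewrite cut_nil !shsum0r.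
rewrite shsum_cons.
under eq_shsum do rewrite cut_cons.
under [X in _ + X]eq_shsum do rewrite cut_cons.
rewrite !shsumD addrACA -(shsum_cons (h [::])) IHu IHv.
rewrite [X in _ = X]cut_cons [X in _ = X + _]cut_cons shsum0l -!addrA.
congr (_ + _).
rewrite [X in _ + X = _]cut_cons [LHS]addrCA; congr (_ + _).
  by apply: eq_cut => v1 v2; rewrite !shsum0l.
rewrite -cutD; apply: eq_cut => u1 u2; rewrite !cut_cons !shsum0r -addrA.
congr (_ + _); rewrite -cutD; apply: eq_cut => v1 v2.
by rewrite [RHS]shsum_cons.
Qed.

End Shuffle.

Lemma size_shuffles (T : eqType) (u v w : seq T) :
  w \in shuffles u v -> size w = (size u + size v)%N.
Proof.
elim: u v w => [|a u IHu] v w; first by rewrite inE => /eqP ->.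
elim: v w => [|c v IHv] w; first by rewrite inE => /eqP ->; rewrite addn0.
rewrite [shuffles _ _]/= mem_cat => /orP [] /mapP [w' hw' ->] /=.
  by rewrite (IHu _ _ hw') addSn.
by rewrite (IHv _ hw') addnS.
Qed.

Section ShuffleCharacters.
Variable K : fieldType.
Hypothesis K_char0 : [pchar K] =i pred0.
Implicit Types (f g : ncseries K) (u v w : seq bool).

(** Characters of the shuffle algebra, that is, group-like series. *)
Definition shuffle_char f := f [::] = 1 /\ forall u v, shsum f u v = f u * f v.

Lemma nc_mulE f g w : nc_mul f g w = cut (fun u v => f u * g v) w.
Proof. by []. Qed.

Lemma nc_mul_char f g : shuffle_char f -> shuffle_char g -> shuffle_char (nc_mul f g).
Proof.
move=> [f1 fM] [g1 gM]; split=> [|u v]; first by rewrite nc_mulE cut_nil f1 g1 mulr1.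
rewrite (shsum_cut (fun u v => f u * g v)) !nc_mulE [RHS]mulr_suml.
apply: eq_bigr => i _; rewrite mulr_sumr; apply: eq_bigr => j _.
rewrite mulrACA -fM -gM mulr_suml; apply: eq_bigr => w1 _.
by rewrite mulr_sumr.
Qed.

Lemma nc_one_char : shuffle_char (@nc_one K).
Proof.
split=> // u v; case: u v => [|a u] [|b v]; rewrite ?shsum0l ?shsum0r /nc_one /=;
  rewrite ?mul1r ?mulr0 ?mulr1 //.
have shsum_zero u' v' : shsum (fun=> 0 : K) u' v' = 0 by rewrite /shsum big1.
by rewrite shsum_cons !shsum_zero addr0.
Qed.

Lemma nc_mul1l f w : nc_mul (@nc_one K) f w = f w.
Proof.
case: w => [|b w]; rewrite nc_mulE ?cut_nil ?cut_cons /nc_one eqxx mul1r //.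
by rewrite /cut big1 ?addr0 // => i _; rewrite mul0r.
Qed.

Lemma nc_mul_varl b f c w : nc_mul (nc_var K b) f (c :: w) = (c == b)%:R * f w.
Proof.
rewrite nc_mulE cut_cons {1}/nc_var mul0r add0r -[in RHS](nc_mul1l f w) nc_mulE.
rewrite /cut mulr_sumr; apply: eq_bigr => i _; rewrite mulrA; congr (_ * _).
by rewrite /nc_var /nc_one eqseq_cons -natrM mulnb.
Qed.

Lemma nc_mul_varl_nil b f : nc_mul (nc_var K b) f [::] = 0.
Proof. by rewrite nc_mulE cut_nil /nc_var mul0r. Qed.

Lemma nc_pow_var b n w : nc_pow (nc_var K b) n w = (w == nseq n b)%:R.
Proof.
elim: n w => [//|n IH] [|c w]; first exact: nc_mul_varl_nil.
by rewrite [LHS]nc_mul_varl [X in _ * X]IH -natrM mulnb.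
Qed.

Lemma nc_exp_var b w :
  nc_expseries (nc_var K b) w = ((size w)`!%:R)^-1 * (w == nseq (size w) b)%:R.
Proof.
rewrite /nc_expseries big_ord_recr big1 => [|i _].
  by rewrite nc_pow_var; exact: add0r.
rewrite nc_pow_var; case: eqP => [e|_]; last by rewrite mulr0.
by have := ltn_ord i; have := congr1 size e; rewrite size_nseq /= => <-; rewrite ltnn.
Qed.

(** The exponential f of a variable b satisfies (|w|+1) f(cw) = [c = b] f(w). Multiplying a shuffle
    sum by its total length reduces it to shorter words, and the product of values obeys the same
    recursion. *)
Lemma nc_exp_char b : shuffle_char (nc_expseries (nc_var K b)).
Proof.
set f := nc_expseries _.
have f1 : f [::] = 1 by rewrite /f nc_exp_var /= fact0 invr1 mulr1.
have fS c w : (size w).+1%:R * f (c :: w) = (c == b)%:R * f w.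
  rewrite /f !nc_exp_var /= factS natrM eqseq_cons -mulnb natrM invfM.
  by field; rewrite factr_neq0 // nat1r natSr_neq0.
have shS c u v : ((size u + size v).+1%:R) * shsum (fun w => f (c :: w)) u v =
    (c == b)%:R * shsum f u v.
  rewrite !mulr_sumr; apply: eq_big_seq => w /size_shuffles <-.
  exact: fS.
split=> //; elim=> [|a u IHu] v; first by rewrite shsum0l f1 mul1r.
elim: v => [|c v IHv]; first by rewrite shsum0r f1 mulr1.
apply: (mulfI (natSr_neq0 K_char0 (size u + size (c :: v)))).
rewrite shsum_cons mulrDr shS IHu.
have -> : (size u + size (c :: v)).+1 = (size (a :: u) + size v).+1.
  by rewrite /= addnS addSn.
rewrite shS IHv mulrA -fS [X in _ + X]mulrCA -fS.
by rewrite /= addSn -addnS -!nat1r natrD -!nat1r; ring.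
Qed.

Lemma nc_pow_char f n : shuffle_char f -> shuffle_char (nc_pow f n).
Proof.
by move=> hf; elim: n => [|n IH]; [exact: nc_one_char | exact: nc_mul_char].
Qed.

Lemma nc_powS f n : nc_pow f n.+1 = nc_mul f (nc_pow f n).
Proof. by []. Qed.

Lemma nc_pow_small f n w : f [::] = 0 -> (size w < n)%N -> nc_pow f n w = 0.
Proof.
move=> f0; elim: n w => [//|n IH] w wn; rewrite nc_powS nc_mulE /cut big_ord_recl.
rewrite take0 f0 mul0r add0r big1 // => i _; rewrite IH ?mulr0 //.
rewrite size_drop lift0; apply: (@leq_trans (size w)); last exact: wn.
by rewrite ltn_subrL /= (leq_ltn_trans _ (ltn_ord i)).
Qed.

Lemma nc_mul_sumr f (I : Type) (r : seq I) (g : I -> ncseries K) (c : I -> K) w :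
  nc_mul f (fun w => \sum_(i <- r) c i * g i w) w =
  \sum_(i <- r) c i * nc_mul f (g i) w.
Proof.
rewrite /nc_mul; under eq_bigr do rewrite mulr_sumr.
rewrite exchange_big; apply: eq_bigr => i _; rewrite mulr_sumr.
by apply: eq_bigr => j _; rewrite mulrCA.
Qed.

Lemma eq_nc_mul f f' g g' : f =1 f' -> g =1 g' -> nc_mul f g =1 nc_mul f' g'.
Proof. by move=> ff' gg' w; apply: eq_bigr => i _; rewrite ff' gg'. Qed.

Lemma nc_pow_binomial f n w :
  nc_pow (fun w => nc_one K w + f w) n w = \sum_(k < n.+1) 'C(n, k)%:R * nc_pow f k w.
Proof.
elim: n w => [|n IH] w.
  by rewrite big_ord_recl big_ord0 addr0 mul1r.
transitivity (nc_pow (fun w => nc_one K w + f w) n w +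
    nc_mul f (nc_pow (fun w => nc_one K w + f w) n) w).
  rewrite -[X in _ = X + _]nc_mul1l -big_split; apply: eq_bigr => i _.
  exact: mulrDl.
rewrite (eq_nc_mul (f' := f) (g' := fun w => \sum_(k < n.+1) 'C(n, k)%:R * nc_pow f k w)) //.
rewrite (nc_mul_sumr _ _ (fun k : 'I_n.+1 => nc_pow f k)) IH.
rewrite [RHS]big_ord_recl bin0.
under [X in _ = _ + X]eq_bigr do rewrite lift0 binS natrD mulrDl.
rewrite big_split addrA; congr (_ + _).
rewrite big_ord_recl bin0 [X in _ = _ + X]big_ord_recr bin_small // mul0r.
by rewrite [X in _ = _ + X]addr0; congr (_ + _); apply: eq_bigr => k _; rewrite lift0.
Qed.

Lemma nc_ln1pE f w M : f [::] = 0 -> (size w <= M)%N ->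
  nc_ln1p f w = \sum_(1 <= n < M.+1) log_coef K n * nc_pow f n w.
Proof.
move=> f0 wM; rewrite (big_cat_nat (n := (size w).+1)) //= [X in _ = _ + X]big_nat.
rewrite [X in _ = _ + X]big1 ?addr0 // => n /andP [wn _].
by rewrite nc_pow_small ?mulr0.
Qed.

(** Powers of 1 + f are again shuffle characters, so [log_binomial] applies to the values at u, at v
    and on their shuffles; its right-hand side vanishes because both words are nonempty. *)
Lemma nc_ln_primitive f u v : f [::] = 0 -> shuffle_char (fun w => nc_one K w + f w) ->
  u <> [::] -> v <> [::] -> shsum (nc_ln1p f) u v = 0.
Proof.
move=> f0 hf u0 v0; pose M := (size u + size v)%N.
have size_sh : forall w, w \in shuffles u v -> (size w <= M)%N.
  by move=> w /size_shuffles ->.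
have powE n w : (size w <= M)%N -> nc_pow (fun w => nc_one K w + f w) n w =
    \sum_(k < M.+1) 'C(n, k)%:R * nc_pow f k w.
  move=> wM; pose F k := 'C(n, k)%:R * nc_pow f k w.
  have Fn k : (n.+1 <= k)%N -> F k = 0 by move=> nk; rewrite /F bin_small ?mul0r.
  have FM k : (M.+1 <= k)%N -> F k = 0.
    by move=> Mk; rewrite /F nc_pow_small ?mulr0 //; exact: leq_ltn_trans wM Mk.
  rewrite nc_pow_binomial -[LHS](sum_widen (F := F) (leq_maxl n.+1 M.+1) Fn).
  by rewrite -[RHS](sum_widen (F := F) (leq_maxr n.+1 M.+1) FM).
have := @log_binomial K K_char0 (fun k => nc_pow f k u) (fun k => nc_pow f k v)
  (fun k => shsum (nc_pow f k) u v) M.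
have one0 w : w <> [::] -> nc_one K w = 0 by case: w.
rewrite [nc_pow f 0 u]one0 // [nc_pow f 0 v]one0 // mul0r mulr0 addr0 => <-.
  transitivity (shsum (fun w => \sum_(1 <= n < M.+1) log_coef K n * nc_pow f n w) u v).
    by apply: eq_big_seq => w hw; apply: nc_ln1pE; rewrite ?size_sh.
  rewrite shsum_big; apply: eq_bigr => n _; exact/esym/mulr_sumr.
move=> n; have [_ /(_ u v) hn] := nc_pow_char n hf.
rewrite -!powE ?leq_addr ?leq_addl // -hn.
transitivity (shsum (fun w => \sum_(k < M.+1) 'C(n, k)%:R * nc_pow f k w) u v).
  rewrite shsum_big; apply: eq_bigr => k _; exact: mulr_sumr.
by apply: eq_big_seq => w hw; rewrite powE ?size_sh.
Qed.

Lemma cbh_coef_nil : cbh_coef K [::] = 0.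
Proof. by rewrite /cbh_coef /nc_ln1p big_nil. Qed.

Lemma cbh_primitive u v : u <> [::] -> v <> [::] -> shsum (cbh_coef K) u v = 0.
Proof.
have hg := nc_mul_char (nc_exp_char false) (nc_exp_char true).
apply: nc_ln_primitive; first by rewrite hg.1 subrr.
have -> // : (fun w => nc_one K w + (nc_mul (nc_expseries (nc_var K false))
  (nc_expseries (nc_var K true)) w - nc_one K w)) =
  nc_mul (nc_expseries (nc_var K false)) (nc_expseries (nc_var K true)).
by apply/funext => w; rewrite addrC subrK.
Qed.

End ShuffleCharacters.

(** * Dynkin's operator *)

Section Dynkin.
Variables (K : fieldType) (R : algType K) (a : bool -> R).
Implicit Types (f : seq bool -> K) (u v w : seq bool).

Definition wprod w : R := foldr (fun b x => a b * x) 1 w.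
(** The antipode of the free algebra: the letters are reversed and negated. *)
Definition wantipode w : R := foldr (fun b x => - (x * a b)) 1 w.
(** Right-nested commutator; the last summand handles a one-letter word, whose tail has bracket
    0. *)
Fixpoint wbracket w : R :=
  if w is b :: w' then a b * wbracket w' - wbracket w' * a b + (w' == [::])%:R *: a b
  else 0.

Lemma big_words0 (V : nmodType) (F : seq bool -> V) :
  \sum_(w <- words bool 0) F w = F [::].
Proof. exact: big_seq1. Qed.

(** The unshuffle coproduct of the sum of all f(w) w over words of length n, evaluated by the
    bilinear extension of [M]. [split_sumS] sends the first letter of w to the left or to the right
    leg. *)
Definition split_sum n f (M : seq bool -> seq bool -> R) : R :=
  \sum_(i < n.+1) \sum_(u <- words bool i) \sum_(v <- words bool (n - i))
    shsum f u v *: M u v.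

Lemma split_sum0 f M : split_sum 0 f M = f [::] *: M [::] [::].
Proof. by rewrite /split_sum big_ord_recl big_ord0 addr0 !big_words0 shsum0l. Qed.

Lemma split_sumS n f M : split_sum n.+1 f M =
  \sum_b split_sum n (fun w => f (b :: w)) (fun u v => M (b :: u) v + M u (b :: v)).
Proof.
pose shl u v := if u is b :: u' then shsum (fun w => f (b :: w)) u' v else 0.
pose shr u v := if v is b :: v' then shsum (fun w => f (b :: w)) u v' else 0.
have shE u v : (0 < size u + size v)%N -> shsum f u v = shl u v + shr u v.
  case: u v => [|b u] [|c v] // _; rewrite /shl /shr.
  - by rewrite !shsum0l add0r.
  - by rewrite !shsum0r addr0.
  - exact: shsum_cons.
transitivity (\sum_(i < n.+2) \sum_(u <- words bool i) \sum_(v <- words bool (n.+1 - i))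
     shl u v *: M u v +
   \sum_(i < n.+2) \sum_(u <- words bool i) \sum_(v <- words bool (n.+1 - i))
     shr u v *: M u v).
  rewrite -big_split; apply: eq_bigr => i _; rewrite -big_split.
  apply: eq_big_seq => u; rewrite mem_words => /eqP ui; rewrite -big_split.
  apply: eq_big_seq => v; rewrite mem_words => /eqP vi.
  have uv : (0 < size u + size v)%N by rewrite ui vi subnKC // -ltnS.
  rewrite (shE _ _ uv); exact: scalerDl.
transitivity (\sum_b split_sum n (fun w => f (b :: w)) (fun u v => M (b :: u) v) +
   \sum_b split_sum n (fun w => f (b :: w)) (fun u v => M u (b :: v))); last first.
  rewrite -big_split; apply: eq_bigr => b _; rewrite -big_split; apply: eq_bigr => i _.
  rewrite -big_split; apply: eq_bigr => u _; rewrite -big_split; apply: eq_bigr => v _.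
  exact/esym/scalerDr.
congr (_ + _).
  rewrite big_ord_recl big_words0 big1 ?add0r => [|v _]; last exact: scale0r.
  rewrite exchange_big; apply: eq_bigr => i _; rewrite lift0 subSS.
  exact: big_words_cons.
rewrite big_ord_recr -[LHS]/(_ + _) [X in _ + X]big1 ?addr0 => [|u _]; last first.
  by rewrite subnn big_words0 scale0r.
rewrite exchange_big; apply: eq_bigr => i _; rewrite [RHS]exchange_big.
apply: eq_bigr => u _; have iN : (i <= n)%N by rewrite -ltnS.
by rewrite [nat_of_ord _]/= subSn // big_words_cons.
Qed.

Lemma eq_split_sum n f M M' : (forall u v, M u v = M' u v) ->
  split_sum n f M = split_sum n f M'.
Proof.
move=> MM'; apply: eq_bigr => i _; apply: eq_bigr => u _; apply: eq_bigr => v _.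
by rewrite MM'.
Qed.

Lemma split_sumD n f M M' :
  split_sum n f (fun u v => M u v + M' u v) = split_sum n f M + split_sum n f M'.
Proof.
rewrite -big_split; apply: eq_bigr => i _; rewrite -big_split; apply: eq_bigr => u _.
by rewrite -big_split; apply: eq_bigr => v _; exact: scalerDr.
Qed.

Lemma split_sum_mull n f M x : split_sum n f (fun u v => x * M u v) = x * split_sum n f M.
Proof.
rewrite mulr_sumr; apply: eq_bigr => i _; rewrite mulr_sumr; apply: eq_bigr => u _.
by rewrite mulr_sumr; apply: eq_bigr => v _; rewrite scalerAr.
Qed.

Lemma split_sum_mulr n f M x : split_sum n f (fun u v => - (M u v * x)) = - (split_sum n f M * x).
Proof.
rewrite mulr_suml -sumrN; apply: eq_bigr => i _; rewrite mulr_suml -sumrN.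
apply: eq_bigr => u _; rewrite mulr_suml -sumrN; apply: eq_bigr => v _.
by rewrite scalerN scalerAl.
Qed.

(* Convolution of the identity and the antipode. *)
Lemma split_sum_antipode n f :
  split_sum n f (fun u v => wprod u * wantipode v) = ((n == 0%N)%:R * f [::]) *: 1.
Proof.
elim: n f => [|n IH] f; first by rewrite split_sum0 mulr1 mul1r.
rewrite split_sumS mul0r scale0r big1 // => b _.
rewrite (eq_split_sum _ _ (M' := fun u v => a b * (wprod u * wantipode v) +
    - (wprod u * wantipode v * a b))); last first.
  by move=> u v; rewrite /= mulrN !mulrA.
rewrite split_sumD split_sum_mull split_sum_mulr IH.
by rewrite -scalerAl -scalerAr mulr1 mul1r subrr.
Qed.

(** Dynkin's operator is the convolution of the length-weighted identity with the antipode. The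
    weight grows by 1 with each new left letter, and that extra term is the convolution computed in
    [split_sum_antipode]. *)
Lemma split_sum_bracket n f :
  split_sum n f (fun u v => (size u)%:R *: (wprod u * wantipode v)) =
  \sum_(w <- words bool n) f w *: wbracket w.
Proof.
elim: n f => [|n IH] f.
  by rewrite split_sum0 big_words0 /= scale0r.
rewrite split_sumS big_words_cons; apply: eq_bigr => b _.
rewrite (eq_split_sum _ _ (M' := fun u v =>
    (a b * ((size u)%:R *: (wprod u * wantipode v)) +
    - ((size u)%:R *: (wprod u * wantipode v) * a b)) +
    a b * (wprod u * wantipode v))); last first.
  move=> u v; rewrite /= -natr1 scalerDl scale1r mulrN scalerN -!scalerAr -scalerAl !mulrA.
  by rewrite addrAC.
rewrite !split_sumD !split_sum_mull split_sum_mulr IH split_sum_antipode.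
transitivity (\sum_(w <- words bool n)
   (f (b :: w) *: (a b * wbracket w - wbracket w * a b) +
    (f (b :: w) * (w == [::])%:R) *: a b)); last first.
  by apply: eq_bigr => w _; rewrite [RHS]scalerDr scalerA.
rewrite big_split /=; congr (_ + _).
  rewrite mulr_sumr mulr_suml -sumrB; apply: eq_bigr => w _.
  by rewrite -scalerAr -scalerAl -scalerBr.
rewrite -scalerAr mulr1 -scaler_suml; congr (_ *: _).
case: n {IH} => [|n]; first by rewrite big_words0 mul1r mulr1.
rewrite mul0r big1_seq // => w /= ; rewrite -[_ \in _]/(w \in words bool n.+1) mem_words.
by case: w => // c w _; rewrite mulr0.
Qed.

(** For primitive f only splittings with an empty part survive; an empty left part has weight 0, and
    an empty right part has weight n. *)
Lemma dynkin n f : (forall u v, u <> [::] -> v <> [::] -> shsum f u v = 0) ->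
  \sum_(w <- words bool n) f w *: wbracket w =
  n%:R *: \sum_(w <- words bool n) f w *: wprod w.
Proof.
move=> f0; rewrite -split_sum_bracket /split_sum big_ord_recr /= big1 ?add0r.
  rewrite scaler_sumr; apply: eq_big_seq => u; rewrite mem_words => /eqP un.
  by rewrite subnn big_words0 shsum0r un /= mulr1 !scalerA mulrC.
move=> i _; rewrite big1_seq // => u _; rewrite big1_seq // => v /=.
rewrite mem_words => /eqP vi.
case: u => [|b u]; first by rewrite scale0r scaler0.
rewrite f0 ?scale0r // => v0; move: vi (ltn_ord i); rewrite v0 /= => /esym/eqP.
by rewrite subn_eq0 leqNgt => /negP.
Qed.

Lemma wprod_cat u v : wprod (u ++ v) = wprod u * wprod v.
Proof. by elim: u => [|b u IH] /=; rewrite ?mul1r // IH mulrA. Qed.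

Lemma words_cut (V : nmodType) n (h : seq bool -> seq bool -> V) :
  \sum_(w <- words bool n) cut h w =
  \sum_(i < n.+1) \sum_(u <- words bool i) \sum_(v <- words bool (n - i)) h u v.
Proof.
elim: n h => [|n IH] h.
  by rewrite big_ord_recl big_ord0 addr0 !big_words0 cut_nil.
rewrite big_ord_recl big_words0 subn0 !big_words_cons.
under eq_bigr do under eq_bigr do rewrite cut_cons.
under eq_bigr do rewrite big_split IH.
rewrite big_split; congr (_ + _); rewrite exchange_big; apply: eq_bigr => i _.
by rewrite lift0 subSS big_words_cons.
Qed.

Definition homog n f : R := \sum_(w <- words bool n) f w *: wprod w.
Definition ev_trunc_series M f : R := \sum_(n < M.+1) homog n f.

Lemma homog_mul n (f g : ncseries K) :
  homog n (nc_mul f g) = \sum_(i < n.+1) homog i f * homog (n - i) g.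
Proof.
transitivity (\sum_(w <- words bool n) cut (fun u v => (f u * g v) *: (wprod u * wprod v)) w).
  apply: eq_bigr => w _; rewrite scaler_suml; apply: eq_bigr => i _.
  by rewrite -wprod_cat cat_take_drop.
rewrite words_cut; apply: eq_bigr => i _; rewrite mulr_suml; apply: eq_bigr => u _.
rewrite mulr_sumr; apply: eq_bigr => v _.
by rewrite -scalerAl -scalerAr scalerA.
Qed.

End Dynkin.

(** * Convolution as Campbell-Baker-Hausdorff multiplication *)

Section CumulantGroup.
Variables (K : fieldType) (E : lmodType K) (C : conv_structure E).
Hypothesis K_char0 : [pchar K] =i pred0.
Local Notation A := (calg C).
Implicit Types (phi psi : ldual E).

Section Series.
Variable a : bool -> A.
Hypothesis a_ordge1 : forall b, ordge 1 (a b).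
Implicit Types f g : ncseries K.
Local Notation evs := (ev_trunc_series a).

Lemma wprod_ordge w : ordge (size w) (wprod a w).
Proof.
elim: w => [|b w IH]; first exact: ordge0.
by rewrite /= -add1n; exact: ordge_mul.
Qed.

Lemma homog_ordge n f : ordge n (homog a n f).
Proof.
rewrite /homog big_seq; apply: ordge_sum => w; rewrite mem_words => /eqP <-.
by apply: ordgeZ; exact: wprod_ordge.
Qed.

Lemma ev_series_mul M f g : ordge M.+1 (evs M f * evs M g - evs M (nc_mul f g)).
Proof.
(* A formal variable separates the homogeneous components. The product of the two polynomials agrees
   with that of the product series up to degree M, and its higher coefficients have order above
   M. *)
pose p f : {poly A} := \poly_(i < M.+1) homog a i f.
have pE h : evs M h = (p h).[1].
  by rewrite horner_poly; apply: eq_bigr => i _; rewrite expr1n mulr1.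
have coefp h i : (i <= M)%N -> (p h)`_i = homog a i h by move=> iM; rewrite coef_poly ltnS iM.
have pordge h i : ordge i (p h)`_i.
  rewrite coef_poly; case: ifP => _; [exact: homog_ordge | exact: ordge_zero].
have size_pp : (size (p f * p g)%R <= M.+1 + M.+1)%N.
  apply: leq_trans (size_polyMleq _ _) _; apply: leq_trans (leq_pred _) _.
  by apply: leq_add; exact: size_poly.
rewrite {1}pE {1}pE -hornerM_comm; last by rewrite /comm_poly mulr1 mul1r.
rewrite (horner_coef_wide _ size_pp) big_split_ord.
rewrite -[X in ordge _ (X - _)]/(_ + _) addrAC.
rewrite [X in ordge _ (X + _)](_ : _ = 0) ?add0r.
  apply: ordge_sum => i _; rewrite expr1n mulr1 coefM; apply: ordge_sum => j _.
  apply: (@ordge_leq _ _ _ _ (j + (rshift M.+1 i - j))).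
    by rewrite subnKC ?leq_addr // -ltnS.
  by apply: ordge_mul.
apply/eqP; rewrite subr_eq0; apply/eqP; apply: eq_bigr => n _.
rewrite expr1n mulr1 homog_mul coefM; apply: eq_bigr => i _.
have nM : (n <= M)%N by rewrite -ltnS.
have iN : (i <= n)%N by rewrite -ltnS.
by rewrite !coefp // (leq_trans _ nM) // leq_subr.
Qed.

Lemma ev_series_one M : evs M (@nc_one K) = 1.
Proof.
rewrite /ev_trunc_series big_ord_recl big1 ?addr0 => [|i _].
  by rewrite /homog big_words0 /nc_one eqxx scale1r.
rewrite /homog big1_seq // => w /andP [_]; rewrite mem_words.
by case: w => // b w _; rewrite scale0r.
Qed.

Lemma ev_series_pow M f k : ordge M.+1 (evs M f ^+ k - evs M (nc_pow f k)).
Proof.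
elim: k => [|k IH]; first by rewrite expr0 ev_series_one subrr; exact: ordge_zero.
apply: ordge_sub_trans (ev_series_mul M f (nc_pow f k)).
by rewrite exprS -mulrBr; exact: ordge_mull.
Qed.

Lemma ev_series_exp M b : evs M (nc_expseries (nc_var K b)) = exp_trunc M (a b).
Proof.
rewrite exp_truncE; apply: eq_bigr => n _; rewrite /homog.
rewrite (bigD1_seq (nseq n b)) ?words_uniq ?mem_words ?size_nseq //=.
rewrite nc_exp_var size_nseq eqxx mulr1 big1_seq ?addr0 => [|w /andP [wn]].
  by congr (_ *: _); elim: (val n) => [|k IH]; rewrite /= ?expr0 // exprS -IH.
by rewrite mem_words nc_exp_var => /eqP ->; rewrite (negPf wn) mulr0 scale0r.
Qed.

Lemma ev_series_ln M f : f [::] = 0 ->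
  ordge M.+1 ((horner_alg (evs M f) (log_poly K M) : A) - evs M (nc_ln1p f)).
Proof.
move=> f0; have -> : evs M (nc_ln1p f) =
    \sum_(1 <= l < M.+1) log_coef K l *: evs M (nc_pow f l).
  transitivity (\sum_(n < M.+1) \sum_(1 <= l < M.+1) log_coef K l *: homog a n (nc_pow f l)).
    apply: eq_bigr => n _; rewrite /homog.
    transitivity (\sum_(w <- words bool n) \sum_(1 <= l < M.+1)
        log_coef K l *: (nc_pow f l w *: wprod a w)).
      apply: eq_big_seq => w; rewrite mem_words => /eqP wn.
      have wM : (size w <= M)%N by rewrite wn -ltnS.
      rewrite (nc_ln1pE f0 wM) scaler_suml.
      by apply: eq_bigr => l _; rewrite scalerA.
    by rewrite exchange_big; apply: eq_bigr => l _; rewrite scaler_sumr.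
  by rewrite exchange_big; apply: eq_bigr => l _; rewrite scaler_sumr.
rewrite /log_poly ev_big -sumrB; apply: ordge_sum => l _.
by rewrite ev_scaleXn -scalerBr; apply: ordgeZ; exact: ev_series_pow.
Qed.

Lemma cbh_trunc M : ordge M.+1
  (log_trunc M (exp_trunc M (a false) * exp_trunc M (a true)) - evs M (cbh_coef K)).
Proof.
set g := nc_mul (nc_expseries (nc_var K false)) (nc_expseries (nc_var K true)).
set f : ncseries K := fun w => g w - nc_one K w.
have f0 : f [::] = 0.
  by rewrite /f /g (nc_mul_char (nc_exp_char K_char0 false) (nc_exp_char K_char0 true)).1 subrr.
have evf : evs M f = evs M g - 1.
  rewrite -(ev_series_one M) -sumrB; apply: eq_bigr => n _.
  by rewrite -sumrB; apply: eq_bigr => w _; rewrite scalerBl.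
apply: ordge_sub_trans (ev_series_ln M f0); apply: ordge_evB.
rewrite evf opprB addrA subrK -!ev_series_exp; exact: ev_series_mul.
Qed.

Lemma ev_series_cbh M : evs M (cbh_coef K) =
  \sum_(1 <= n < M.+1) \sum_(w <- words bool n) (cbh_coef K w / n%:R) *: wbracket a w.
Proof.
rewrite /ev_trunc_series big_ord_recl {1}/homog big_words0 cbh_coef_nil scale0r add0r.
rewrite big_add1 big_mkord; apply: eq_bigr => n _; rewrite lift0.
transitivity (n.+1%:R^-1 *: \sum_(w <- words bool n.+1) cbh_coef K w *: wbracket a w).
  rewrite (dynkin _ _ (cbh_primitive K_char0)) scalerA mulVf ?scale1r //.
  exact: natSr_neq0.
by rewrite scaler_sumr; apply: eq_bigr => w _; rewrite scalerA mulrC.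
Qed.

Lemma wbracket_ordge w : ordge (size w) (wbracket a w).
Proof.
elim: w => [|b w IH]; first exact: ordge0.
rewrite /=; apply: ordgeD.
  apply: ordgeB; first by rewrite -add1n; exact: ordge_mul.
  by rewrite -addn1; exact: ordge_mul.
case: w {IH} => [|c w]; first by rewrite scale1r; exact: a_ordge1.
by rewrite scale0r; exact: ordge_zero.
Qed.

End Series.

Definition cumul phi : ldual E := pullback (calg_ln (sym_dual phi : A)) (@sym_gen K E).
Definition lie psi1 psi2 : ldual E :=
  pullback ((inf_char psi1 : A) * (inf_char psi2 : A) -
            (inf_char psi2 : A) * (inf_char psi1 : A)) (@sym_gen K E).

(** The commutator is a derivation over the counit, hence determined by its restriction to E; nested
    brackets in E^* thus become nested commutators. *)
Lemma lieE psi1 psi2 : (inf_char (lie psi1 psi2) : A) =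
  (inf_char psi1 : A) * (inf_char psi2 : A) - (inf_char psi2 : A) * (inf_char psi1 : A).
Proof.
apply: (@derivation_inf_char K E C); apply: commutator_derivation;
  exact: inf_char_derivation.
Qed.

Lemma inf_char_cumul phi : (inf_char (cumul phi) : A) = calg_ln (sym_dual phi : A).
Proof. exact: (derivation_inf_char (ln_char_derivation C K_char0 phi)). Qed.

Lemma cumul_inj : injective cumul.
Proof.
move=> phi psi e; have := congr1 (fun c : ldual E => calg_exp (inf_char c : A)) e.
rewrite !inf_char_cumul !(calg_lnK K_char0 (char_ordge1 _ _)).
move=> e'; apply: linear_ext => w.
by rewrite -[LHS]sym_dual_gen -[RHS]sym_dual_gen e'.
Qed.

Lemma cumul_surj psi : exists phi, cumul phi = psi.
Proof.
have hd : derivation (inf_char psi : A) := inf_char_derivation C psi.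
have [phi phiE] := exp_derivation_char K_char0 hd; exists phi.
have hl : calg_ln (sym_dual phi : A) = inf_char psi.
  by rewrite -phiE calg_expK //; exact: derivation_ordge1.
by apply: linear_ext => w; rewrite -[LHS]/(calg_ln (sym_dual phi : A) _) hl inf_char_gen.
Qed.

Lemma nested_bracketE (psi : bool -> ldual E) w : w <> [::] ->
  (inf_char (nested_bracket lie psi w) : A) = wbracket (fun b => inf_char (psi b) : A) w.
Proof.
elim: w => [/(_ erefl)//|b [|c w] IH] _.
  by rewrite /= scale1r mulr0 mul0r subrr add0r.
rewrite [LHS]lieE IH // -[RHS]/(_ - _ + _) scale0r addr0.
by [].
Qed.

(** The character of the convolution is the product of the exponentials of both cumulants. Modulo
    each order its logarithm is the truncated series in brackets, and at a generator of bounded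
    degree the truncation is exact. *)
Lemma cbh_cumul phi1 phi2 : cbh lie (cumul phi1) (cumul phi2) = cumul (star C phi1 phi2).
Proof.
pose psi (b : bool) := if b then cumul phi2 else cumul phi1.
pose a (b : bool) : A := inf_char (psi b).
have a1 b : ordge 1 (a b) by apply: derivation_ordge1; exact: inf_char_derivation.
pose Phi : A := (sym_dual phi1 : A) * (sym_dual phi2 : A).
have PhiE : Phi = sym_dual (star C phi1 phi2) := cmul_char C phi1 phi2.
have hPhi : ordge 1 (Phi - 1) by rewrite PhiE; exact: char_ordge1.
have exp_a b : calg_exp (a b) = sym_dual (if b then phi2 else phi1).
  by rewrite /a /psi; case: b; rewrite inf_char_cumul calg_lnK //; exact: char_ordge1.
have PhiN N : ordge N (Phi - exp_trunc N (a false) * exp_trunc N (a true)).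
  rewrite /Phi -(exp_a true) -(exp_a false).
  apply: (@ordge_sub_trans _ _ _ _ _ (exp_trunc N (a false) * calg_exp (a true))).
    by rewrite -mulrBl; apply: ordge_mulr; exact: calg_exp_ordge.
  by rewrite -mulrBr; apply: ordge_mull; exact: calg_exp_ordge.
have lnE N : ordge N (calg_ln Phi - ev_trunc_series a N (cbh_coef K)).
  apply: ordge_sub_trans (calg_ln_ordge K_char0 N hPhi) _.
  apply: ordge_sub_trans _ (ordge_leq (leqnSn N) (cbh_trunc a1 N)).
  by apply: ordge_evB; rewrite opprB addrA subrK.
have cbhE : (fun w : E => \sum_(n \in [set n | (0 < n)%N]%classic) \sum_(t : n.-tuple bool)
    cbh_coef K t / n%:R * nested_bracket lie psi t w) = cumul (star C phi1 phi2).
  apply/funext => w; rewrite -[RHS]/(calg_ln (sym_dual _ : A) (sym_gen w)) -PhiE.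
  have [N wN] := deg_lt_exists C (sym_gen w).
  rewrite (ordge_eq K_char0 (lnE N) wN) ev_series_cbh lmap_sumE.
  have tupleE n : (0 < n)%N -> \sum_(t : n.-tuple bool)
      cbh_coef K t / n%:R * nested_bracket lie psi t w =
      (\sum_(u <- words bool n) (cbh_coef K u / n%:R) *: wbracket a u) (sym_gen w).
    move=> n0; rewrite lmap_sumE.
    transitivity (\sum_(u <- words bool n) cbh_coef K u / n%:R * nested_bracket lie psi u w).
      rewrite -(big_map val xpredT (fun u => cbh_coef K u / n%:R * nested_bracket lie psi u w)).
      apply: perm_big; apply: uniq_perm; rewrite ?words_uniq //.
        by rewrite map_inj_uniq ?index_enum_uniq //; exact: val_inj.
      move=> u; rewrite mem_words; apply/mapP/eqP => [[t _ ->]|un].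
        exact: size_tuple.
      by exists (Tuple (introT eqP un)); first exact: mem_index_enum.
    apply: eq_big_seq => u; rewrite mem_words => /eqP un.
    have u0 : u <> [::] by move=> u0; rewrite -un u0 in n0.
    by rewrite lmapZE -(nested_bracketE psi u0) inf_char_gen.
  rewrite (@fsum_pos _ _ N.+1) => [|n Nn].
    by rewrite big_nat [RHS]big_nat; apply: eq_bigr => n /andP [n0 _]; exact: tupleE.
  rewrite tupleE ?(leq_trans _ Nn) // lmap_sumE big1_seq // => u /andP [_].
  rewrite mem_words => /eqP un; rewrite lmapZE.
  rewrite (ordge_vanish K_char0 (wbracket_ordge a1 u) wN) ?scaler0 //.
  by rewrite un; exact: ltnW.
rewrite /cbh -/psi cbhE; apply: linear_ext => w; apply: to_ldualE.
by move=> c x y; rewrite linearP.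
Qed.

End CumulantGroup.

(** * The cumulant Lie algebra of a u.a.u.-product *)

Section Cumulants.
Variables (K : fieldType) (d m : nat) (P : uproduct K d m).
Hypothesis K_char0 : [pchar K] =i pred0.
Hypothesis HP : uau_product P.
Variables (V : lmodType K) (X : eqType) (e : X -> V).
Hypothesis eP : free_basis e.
Local Notation D := (algp_talg m V).
Local Notation E := (pow d D).
Implicit Types (phi psi : ldual E).

Lemma pow_char_separated (u v : sym E) :
  (forall phi, sym_dual phi u = sym_dual phi v) -> u = v.
Proof.
(* A first letter and a remaining word encode exactly the nonempty words. *)
pose g (i : 'I_d * ('I_m * X) * seq ('I_m * X)) : E :=
  pow_single i.1.1 (word (letter e) (i.1.2 :: i.2)).
have gP := letter_free m eP.
move=> uv; apply/eqP; rewrite -subr_eq0; apply/eqP.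
apply: (@sym_separated K E _ g K_char0); last by move=> phi; rewrite linearB uv subrr.
- move=> S S0 SL Sg; apply: pow_ind => // k a; move: a; apply: gP.1 => [|a y z Sy Sz|].
  + by rewrite pow_single0.
  + by rewrite pow_single_linear; exact: SL.
  + by case=> [/(_ erefl)//|y w] _; exact: (Sg (k, y, w)).
- move=> beta; have [phi phiE] := pow_free (W := K^o)
    (fun k w => if w is y :: w' then beta (k, y, w') else 0) gP.
  by exists phi => -[[k y] w]; rewrite /g phiE.
Qed.

(** Both sides are multiplicative and unital in x and agree on E by the defining property of
    [sigma]. *)
Lemma sym_comult_char phi psi x :
  tens_dual (sym_dual phi) (sym_dual psi) (sym_comult P V x) =
  sym_dual (conv P phi psi) x.
Proof.
move: x; apply: sym_ind => [|w|a x y hx hy|x y hx hy].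
- rewrite [sym_comult P V _]sym_lift1 [LHS]tens_dual_pure !sym_dual1.
  exact: mul1r.
- rewrite [sym_comult P V _]sym_lift_gen sym_dual_gen.
  exact/esym/(sigmaP HP eP).
- by rewrite !linearP hx hy.
- rewrite [sym_comult P V _]nuhomM.
  rewrite [LHS](@tens_dualM _ (sym E) (sym E) (sym_lift _) (sym_lift _)).
  by rewrite [RHS]sym_dualM -hx -hy.
Qed.

Lemma dilation0 x : dilation m V 0 x = 0.
Proof.
rewrite -[RHS]/(nuhom_zero D D x); apply: talg_copies_ext => l v.
by rewrite dilation_gen scale0r.
Qed.

Lemma dilation1 x : dilation m V 1 x = x.
Proof.
rewrite -[RHS]/(nuhom_id D x); apply: talg_copies_ext => l v.
by rewrite dilation_gen scale1r.
Qed.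

Lemma dilationM s t x : dilation m V s (dilation m V t x) = dilation m V (s * t) x.
Proof.
rewrite -nuhom_compE; apply: talg_copies_ext => l v.
by rewrite nuhom_compE !dilation_gen linearZZ dilation_gen scalerA mulrC.
Qed.

Lemma dilation_poly (w : E) : exists (N : nat) (p : nat -> E),
  forall t, pow_map d (dilation m V t) w = \sum_(k < N) t ^+ k *: p k.
Proof.
have lin a x y :
    (exists N (p : nat -> E), forall t,
       pow_map d (dilation m V t) x = \sum_(k < N) t ^+ k *: p k) ->
    (exists N (p : nat -> E), forall t,
       pow_map d (dilation m V t) y = \sum_(k < N) t ^+ k *: p k) ->
    exists N (p : nat -> E), forall t,
       pow_map d (dilation m V t) (a *: x + y) = \sum_(k < N) t ^+ k *: p k.
  move=> [N [p pE]] [M [q qE]].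
  pose tr n (f : nat -> E) k : E := if (k < n)%N then f k else 0.
  exists (maxn N M), (fun k => a *: tr N p k + tr M q k) => t.
  have widen n (f : nat -> E) : (n <= maxn N M)%N ->
      \sum_(k < n) t ^+ k *: f k = \sum_(k < maxn N M) t ^+ k *: tr n f k.
    move=> nNM; rewrite (big_ord_widen _ (fun k => t ^+ k *: f k) nNM) big_mkcond.
    by apply: eq_bigr => k _; rewrite /tr; case: ifP => //; rewrite scaler0.
  rewrite linearP pE qE (widen _ _ (leq_maxl _ _)) (widen _ _ (leq_maxr _ _)).
  rewrite scaler_sumr -big_split; apply: eq_bigr => k _.
  by rewrite scalerDr !scalerA mulrC.
have zero : exists N (p : nat -> E), forall t,
    pow_map d (dilation m V t) (0 : E) = \sum_(k < N) t ^+ k *: p k.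
  by exists 0%N, (fun=> 0) => t; rewrite big_ord0 linear0.
move: w; apply: pow_ind => // r a; move: a.
apply: (letter_free m eP).1 => [|a x y hx hy|w w0].
- by rewrite pow_single0.
- by rewrite pow_single_linear; exact: lin.
exists (size w).+1, (fun k => if k == size w then pow_single r (word (letter e) w) else 0).
move=> t; rewrite big_ord_recr big1 => [|k _]; last first.
  by rewrite [_ == size w](ltn_eqF (ltn_ord k)) scaler0.
rewrite eqxx pow_map_single nuhom_word -[RHS]/(0 + _) add0r.
have -> : word (dilation m V t \o letter e) w = word (fun y => t *: letter e y) w.
  by apply: eq_word => y; exact: (dilation_gen t y.1 (e y.2)).
rewrite (word_scale _ (fun=> t)) //.
have -> : \prod_(y <- w) t = t ^+ size w.
  by elim: (w) => [|y w' IH]; rewrite ?big_nil // big_cons IH exprS.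
exact: (scalable_linear (@pow_single_linear K d D r)).
Qed.

Lemma pow_dilation0 (w : E) : pow_map d (dilation m V 0) w = 0.
Proof. by apply/ffunP => k; rewrite !ffunE dilation0. Qed.

Definition product_structure : conv_structure E :=
  @ConvStructure K E (sym_comult P V) (@conv K d m P V)
    (fun t => pow_map d (dilation m V t)) sym_comult_char
    (conv_assoc HP (V := V)) (conv0l HP (V := V)) (conv0r HP (V := V)) pow_char_separated
    (conv_dilation HP (V := V))
    pow_dilation0
    (fun w => pow_map_id w dilation1)
    (fun s t w => esym (pow_map_comp w (fun y => esym (dilationM s t y))))
    dilation_poly.

Local Notation C := product_structure.
Local Notation A := (calg C).

Lemma sconv_powE (b : A) l : sconv_pow P b l = b ^+ l.
Proof.
elim: l => [//|l IH]; rewrite exprS -IH; exact: linear_ext.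
Qed.

Lemma cumulantE : cumulant P (V := V) = cumul C.
Proof.
apply/funext => phi; apply: linear_ext => w.
rewrite -[LHS]/(sconv_ln P (sym_dual phi) (sym_gen w)).
rewrite -[RHS]/(calg_ln (sym_dual phi : A) (sym_gen w)) /sconv_ln /calg_ln.
congr (to_ldual _ _); apply/funext => x.
have -> : (sym_dual phi \- sym_counit E : {linear _ -> _}) = (sym_dual phi : A) - 1.
  exact: linear_ext.
by apply: eq_fsbigr => l _; rewrite sconv_powE.
Qed.

Lemma cumulant_lieE : cumulant_lie P (V := V) = lie C.
Proof. by apply/funext => psi1; apply/funext => psi2; exact: linear_ext. Qed.

Lemma cumulant_inv_cumul psi : cumulant P (cumulant_inv P psi) = psi.
Proof.
rewrite /cumulant_inv; case: pselect => [h|[]]; first exact: (projT2 (cid h)).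
by rewrite cumulantE; exact: cumul_surj.
Qed.

Lemma cumulantK : cancel (cumulant P (V := V)) (cumulant_inv P (V := V)).
Proof.
move=> phi; have := cumulant_inv_cumul (cumulant P phi).
by rewrite cumulantE; exact: (cumul_inj K_char0).
Qed.

Lemma conv_cbh phi1 phi2 : conv P phi1 phi2 =
  cumulant_inv P (cbh (cumulant_lie P (V := V)) (cumulant P phi1) (cumulant P phi2)).
Proof.
apply: (can_inj cumulantK); rewrite cumulant_inv_cumul cumulantE cumulant_lieE.
exact/esym/(cbh_cumul C K_char0).
Qed.

End Cumulants.

Theorem theorem8p2 (R : realType) (d m : nat) (hd : (0 < d)%N) (hm : (0 < m)%N) :
  (forall P P' : uproduct R[i] d m, uau_product P -> uau_product P' ->
     (forall n : nat, (0 < n)%N ->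
        (forall phi : ldual (pow d (algp_talg m 'rV[R[i]]_n)),
           cumulant P phi = cumulant P' phi) /\
        (forall psi1 psi2 : ldual (pow d (algp_talg m 'rV[R[i]]_n)),
           cumulant_lie P psi1 psi2 = cumulant_lie P' psi1 psi2)) ->
     forall (A1 A2 : algp R[i] m) (phi1 : ldual (pow d A1)) (phi2 : ldual (pow d A2)),
       P A1 A2 phi1 phi2 = P' A1 A2 phi1 phi2) /\
  forall P : uproduct R[i] d m, uau_product P ->
    (forall n : nat, (0 < n)%N ->
       cancel (@cumulant R[i] d m P 'rV[R[i]]_n)
              (@cumulant_inv R[i] d m P 'rV[R[i]]_n) /\
       cancel (@cumulant_inv R[i] d m P 'rV[R[i]]_n)
              (@cumulant R[i] d m P 'rV[R[i]]_n) /\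
       forall phi1 phi2 : ldual (pow d (algp_talg m 'rV[R[i]]_n)),
         conv P phi1 phi2 =
         cumulant_inv P
           (cbh (@cumulant_lie R[i] d m P 'rV[R[i]]_n)
                (cumulant P phi1) (cumulant P phi2))) /\
    (forall (A1 A2 : algp R[i] m) (phi1 : ldual (pow d A1)) (phi2 : ldual (pow d A2))
            (W1 : 'I_m -> set A1) (W2 : 'I_m -> set A2),
       (forall l, [/\ subspace (W1 l), finite_dim (W1 l) &
                      forall a, W1 l a -> algp_sub A1 l a]) ->
       (forall l, [/\ subspace (W2 l), finite_dim (W2 l) &
                      forall a, W2 l a -> algp_sub A2 l a]) ->
       ((exists l a, W1 l a /\ a <> 0) \/ (exists l a, W2 l a /\ a <> 0)) ->
       forall (n : nat) (p1 : 'I_m -> {linear 'rV[R[i]]_n -> A1})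
              (p2 : 'I_m -> {linear 'rV[R[i]]_n -> A2}),
         direct_sum_iso W1 W2 p1 p2 ->
         forall x : pow d (algp_talg m 'rV[R[i]]_n),
           (forall k, alt_tensors p1 p2 (x k)) ->
           P A1 A2 phi1 phi2 (pow_map d (alt_incl p1 p2) x) =
           conv P (pow_pullback phi1 (copies_hom p1))
                  (pow_pullback phi2 (copies_hom p2)) x).
Proof.
have char0 : [pchar R[i]] =i pred0 := Num.Theory.pchar_num _.
split=> [P P' HP HP' eqPP' A1 A2|P HP].
  apply: eq_conv_eq_product => // n n0 phi1 phi2.
  have [ecum elie] := eqPP' n n0.
  have eP := free_basis_row R[i] n.
  have ecum' : @cumulant R[i] d m P 'rV[R[i]]_n = @cumulant R[i] d m P' 'rV[R[i]]_n.
    exact/funext.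
  have elie' : @cumulant_lie R[i] d m P 'rV[R[i]]_n = @cumulant_lie R[i] d m P' 'rV[R[i]]_n.
    by apply/funext => psi1; exact/funext.
  (* The inverse is defined from the cumulant mapping alone, so it agrees for both products. *)
  have einv : @cumulant_inv R[i] d m P 'rV[R[i]]_n = @cumulant_inv R[i] d m P' 'rV[R[i]]_n.
    by rewrite /cumulant_inv ecum'.
  by rewrite (conv_cbh char0 HP eP) (conv_cbh char0 HP' eP) ecum' elie' einv.
split=> [n _|A1 A2 phi1 phi2 W1 W2 hW1 hW2 _ n p1 p2 [p1W p2W _] x _].
  have eP := free_basis_row R[i] n; split; first exact: (cumulantK char0 HP eP).
  split; first by move=> psi; exact: (cumulant_inv_cumul char0 HP eP).
  exact: (conv_cbh char0 HP eP).
symmetry; apply: conv_alt_incl => // l v.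
  by have [_ _] := hW1 l; apply; exact: p1W.
by have [_ _] := hW2 l; apply; exact: p2W.
Qed.
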